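(* Let $\psi:\mathbb D\to\mathbb C$ be a holomorphic function which extends to a $\mathcal C^1$ function on $\overline{\mathbb D}$ and satisfies $\psi(0)=0$. Let $\lambda\in\mathbb D$ and set $\varphi(z)=\lambda z(1+\psi(z))$. Assume that $\varphi$ is univalent on $\overline{\mathbb D}$ and that $\varphi(\overline{\mathbb D})\subset\mathbb D$. Assume also that, for all $z\in\overline{\mathbb D}$, $$\sum_{j\ge0}\mathrm{Re}\left(\frac{z\,(\varphi^{[j]})'(z)\,\psi'(\varphi^{[j]}(z))}{1+\psi(\varphi^{[j]}(z))}\right)>-1.$$ Then the composition operator $C_\varphi:f\mapsto f\circ\varphi$ on $H^2(\mathbb D)$ has a minimal commutant.
   Context: $\mathbb D$ is the open unit disc, $H^2(\mathbb D)$ the Hardy space, $\varphi^{[j]}$ is the $j$-th iterate of $\varphi$ (with $\varphi^{[0]}$ the identity). Univalent means injective. For a bounded operator $A$ on a Hilbert space $H$, $\{A\}'=\{T\in\mathcal B(H):TA=AT\}$, $\mathrm{alg}(A)=\{p(A):p\text{ a polynomial}\}$, and $A$ has a minimal commutant if $\overline{\mathrm{alg}(A)}^{\sigma}=\{A\}'$, where $\sigma$ denotes the weak operator topology. *)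

(* Defs.v *)
From HB Require Import structures.
From mathcomp Require Import all_boot all_order all_algebra.
From mathcomp Require Import ring complex.
From mathcomp Require Import all_classical all_reals all_analysis.

Set Implicit Arguments.
Unset Strict Implicit.
Unset Printing Implicit Defensive.

Import Order.TTheory GRing.Theory Num.Theory.
Import numFieldNormedType.Exports.

Local Open Scope classical_set_scope.
Local Open Scope ring_scope.

(* The complex numbers, packaged as a [numClosedFieldType]: [R[i]] itself is
   declared in the library as a left module over [R], whereas [Cplx R] carries
   the topology and the normed module structure over itself. *)
Definition Cplx (R : realType) : numClosedFieldType := R[i].
Arguments Cplx : simpl never.

Section Disc.
Variable R : realType.
Local Notation C := (Cplx R).

Definition odisc : set C := [set z | `|z| < 1].
Definition cdisc : set C := [set z | `|z| <= 1].

Definition holomorphic_on (A : set C) (f : C -> C) :=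
  forall z, A z -> derivable f z 1.

(* Complex derivative relative to [A]: the limit of the difference quotients
   over w in A \ {z}.  It is the usual derivative at interior points of [A], and
   also makes sense at the boundary points of the closed disc. *)
Definition derive_in (A : set C) (f : C -> C) (z : C) : C :=
  lim ((f w - f z) / (w - z) @[w --> within A z^']).

(* Continuously differentiable on [A], in the complex sense.  For [f] holomorphic
   in the open disc and [A] the closed disc, this is equivalent to [f] being the
   restriction of a real C^1 function, the Cauchy-Riemann equation passing to
   the boundary by continuity. *)
Definition C1_on (A : set C) (f : C -> C) :=
  (forall z, A z -> cvg ((f w - f z) / (w - z) @[w --> within A z^'])) /\
  {within A, continuous (derive_in A f)}.

Definition square_summable (a : nat -> C) :=
  cvgn (series (fun n => ComplexField.Normc.normc (a n) ^+ 2)).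

Definition power_series_on_disc (f : C -> C) (a : nat -> C) :=
  forall z, odisc z -> series (fun n => a n * z ^+ n) @ \oo --> f z.

(* A function on the open disc is represented by its extension by 0 to the
   whole plane, so that equality of functions is equality on the disc. *)
Definition hardy : {pred C -> C} := fun f =>
  `[< (forall z, ~ odisc z -> f z = 0) /\
      exists2 a, square_summable a & power_series_on_disc f a >].

Lemma normcE (z : C) : (ComplexField.Normc.normc z)%:C%C = `|z| :> R[i].
Proof. by []. Qed.

Lemma normcD (x y : C) : ComplexField.Normc.normc (x + y) <=
  ComplexField.Normc.normc x + ComplexField.Normc.normc y.
Proof. by rewrite -lecR rmorphD /= !normcE; exact: ler_normD. Qed.

Lemma normcM (x y : C) : ComplexField.Normc.normc (x * y) =
  ComplexField.Normc.normc x * ComplexField.Normc.normc y.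
Proof. exact: ComplexField.Normc.normcM. Qed.

Lemma normc_ge0 (x : C) : 0 <= ComplexField.Normc.normc x.
Proof. by rewrite -lecR normcE; exact: normr_ge0. Qed.

Lemma square_summableD (a b : nat -> C) (k : C) :
  square_summable a -> square_summable b ->
  square_summable (fun n => k * a n + b n).
Proof.
move=> sa sb; rewrite /square_summable.
pose u := fun n => (2 * ComplexField.Normc.normc k ^+ 2) *
                     ComplexField.Normc.normc (a n) ^+ 2 +
                   2 * ComplexField.Normc.normc (b n) ^+ 2.
apply: (@series_le_cvg R _ u).
- by move=> n; exact: sqr_ge0.
- by move=> n; apply: addr_ge0; rewrite !mulr_ge0//; exact: normc_ge0.
- move=> n; rewrite /u.
  set x := ComplexField.Normc.normc (k * a n).
  set y := ComplexField.Normc.normc (b n).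
  apply: (@le_trans _ _ ((x + y) ^+ 2)).
    by rewrite lerXn2r// ?nnegrE ?addr_ge0 ?normc_ge0//; exact: normcD.
  rewrite -mulrA -exprMn -normcM -/x -subr_ge0.
  suff -> : 2 * x ^+ 2 + 2 * y ^+ 2 - (x + y) ^+ 2 = (x - y) ^+ 2.
    exact: sqr_ge0.
  ring.
- have -> : series u =
      (2 * ComplexField.Normc.normc k ^+ 2) *:
        series (fun n => ComplexField.Normc.normc (a n) ^+ 2) +
      2 *: series (fun n => ComplexField.Normc.normc (b n) ^+ 2).
    apply/funext => n; rewrite /series /= /u big_split/= -!mulr_sumr.
    by [].
  by apply: is_cvgD; apply: is_cvgZr.
Qed.

Lemma hardy_submod_closed : submod_closed hardy.
Proof.
split.
  apply/asboolP; split=> //; exists (fun=> 0).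
    rewrite /square_summable (_ : series _ = cst 0); first exact: is_cvg_cst.
    apply/funext => n; rewrite /series /= big1// => i _.
    by rewrite !(expr0n, addr0, sqrtr0).
  move=> z _; rewrite (_ : series _ = cst 0); first exact: cvg_cst.
  by apply/funext => n; rewrite /series /= big1// => i _; rewrite mul0r.
move=> k f g /asboolP[f0 [a sa fa]] /asboolP[g0 [b sb gb]].
apply/asboolP; split.
  move=> z nz.
  by rewrite -[LHS]/(k * f z + g z) f0// g0// mulr0 addr0.
exists (fun n => k * a n + b n); first exact: square_summableD.
move=> z dz.
have -> : series (fun n => (k * a n + b n) * z ^+ n) =
    k *: series (fun n => a n * z ^+ n) + series (fun n => b n * z ^+ n).
  apply/funext => n; rewrite /series /=.
  rewrite -[RHS]/(k * _ + _) mulr_sumr -big_split/=.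
  by apply: eq_bigr => i _; rewrite mulrDl mulrA.
by apply: cvgD; [apply: cvgZr; exact: fa | exact: gb].
Qed.

HB.instance Definition _ :=
  GRing.isSubmodClosed.Build C (C -> C) hardy hardy_submod_closed.

(* The Hardy space of the unit disc. *)
Record H2 := MkH2 { H2_fun :> C -> C; _ : H2_fun \in hardy }.

HB.instance Definition _ := [isSub for H2_fun].
HB.instance Definition _ := [Choice of H2 by <:].
HB.instance Definition _ := [SubChoice_isSubLmodule of H2 by <:].

(* Taylor coefficients at 0; [get] picks the sequence, which is unique. *)
Definition H2_coef (f : H2) : nat -> C :=
  get [set a | square_summable a /\ power_series_on_disc f a].

Definition H2_dot (f g : H2) : C :=
  limn (series (fun n => H2_coef f n * (H2_coef g n)^* )).

(* [T] is the operator f |-> f \o phi, for [phi] mapping the disc to itself;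
   this determines [T], as elements of [H2] vanish outside the disc. *)
Definition is_composition_op (phi : C -> C) (T : H2 -> H2) :=
  forall (f : H2) z, odisc z -> T f z = f (phi z).

End Disc.

Section Operators.
Variables (R : realType) (H : lmodType (Cplx R)) (dot : H -> H -> Cplx R).
Local Notation C := (Cplx R).

Definition norm_of_dot (x : H) : C := sqrtC (dot x x).

Definition bounded_op (T : H -> H) := linear T /\
  exists2 M : C, 0 <= M & forall x, norm_of_dot (T x) <= M * norm_of_dot x.

Definition commutant (A : H -> H) : set (H -> H) :=
  [set T | bounded_op T /\ T \o A = A \o T].

Definition poly_op (A : H -> H) (p : {poly C}) (x : H) : H :=
  \sum_(i < size p) p`_i *: iter i A x.

Definition alg (A : H -> H) : set (H -> H) := range (poly_op A).

(* The weak operator topology is the coarsest one that makes all the functionals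
   T |-> <T x, y> continuous. *)
Definition matrix_coefs (T : H -> H) : {ptws H * H -> C} :=
  fun xy => dot (T xy.1) xy.2.

Definition wot_closure (S : set (H -> H)) : set (H -> H) :=
  [set T | bounded_op T /\
    closure (S : set (initial_topology matrix_coefs)) T].

Definition minimal_commutant (A : H -> H) :=
  bounded_op A /\ wot_closure (alg A) = commutant A.

End Operators.

(* Main.v *)
(* Idea.  The Koenigs function s = lim phi^[n] / lambda^n is univalent on the closed
   disc, s o phi = lambda s, and 1 plus the sum in the hypothesis is z s'(z) / s(z);
   so s maps the disc onto a starlike domain and phi_t = s^-1 (t s), 0 < t <= 1, are
   self-maps of the disc fixing 0, whose composition operators are contractions.
   If T commutes with C_phi then T s^n is an eigenvector for lambda^n, hence a
   multiple of s^n.  Let F be a functional continuous for the weak operator topology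
   that vanishes on all powers of C_phi.  Expanding f o s^-1 at 0 turns F(C_phi^N)
   into a power series evaluated at lambda^N, so all its coefficients vanish, and
   this forces F(T C_{phi_t}) = 0 for small t.  The function t |-> F(T C_{phi_t})
   extends analytically to a neighbourhood of (0, 1), so it vanishes there, and
   letting t tend to 1 gives F(T) = 0.  The closure statement follows, since a weak
   operator neighbourhood only involves a finite-dimensional space of values. *)

(* The expansion of [f \o s^-1] at 0 converges only on a disc inside the Koenigs domain, so the
   powers of the operator are exploited only for large N and give information only for small t;
   starlikeness supplies the path of self-maps from there to t = 1. For t < 1 the closed disc is
   mapped into a strictly smaller one, also for complex parameters near t; this puts every
   [f \o phi_t] in the disc algebra and makes the dependence on t analytic. At t = 1 this
   compactness is lost and only the contraction bound remains, hence the final passage to the limit.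
   The hypothesis is used at boundary points too: it keeps s' nonzero there, so that s^-1 is
   differentiable up to the boundary, and it makes the inclusion strict for t < 1. Holomorphy is
   handled without integrals: uniform differentiability on the closed disc gives uniform
   approximation by polynomials, and Taylor coefficients, the maximum principle and the norm bounds
   rest on it. The multipliers c_n in T s^n = c_n s^n are never estimated: convergence comes from
   the continuity of F(T .). *)
Require Import Defs.
From mathcomp Require Import all_boot all_order all_algebra.
From mathcomp Require Import ring lra complex.
From mathcomp Require Import all_classical all_reals all_analysis.
Import Order.TTheory GRing.Theory Num.Theory.
Import numFieldNormedType.Exports.
Local Open Scope classical_set_scope.
Local Open Scope ring_scope.


(** * The modulus as a real number *)

Section Modulus.
Set Implicit Arguments.
Unset Strict Implicit.
Variable R : realType.
Local Notation C := (Cplx R).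
Implicit Types (z w : C) (r e : R).

(** The norm of [Cplx R] takes its values in [Cplx R] itself; with a real modulus and the embedding
    [rc], estimates are real inequalities within reach of [lra] and [nra]. *)
Definition cmod z : R := ComplexField.Normc.normc z.
Definition rc r : C := r%:C%C.

Lemma cmodE z : rc (cmod z) = `|z|. Proof. by []. Qed.

Lemma rcD r e : rc (r + e) = rc r + rc e. Proof. exact: rmorphD. Qed.
Lemma rcB r e : rc (r - e) = rc r - rc e. Proof. exact: rmorphB. Qed.
Lemma rcM r e : rc (r * e) = rc r * rc e. Proof. exact: rmorphM. Qed.
Lemma rcX r n : rc (r ^+ n) = rc r ^+ n. Proof. exact: rmorphXn. Qed.
Lemma rcV r : rc r^-1 = (rc r)^-1. Proof. exact: fmorphV. Qed.
Lemma rc0 : rc 0 = 0. Proof. exact: rmorph0. Qed.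
Lemma rc1 : rc 1 = 1. Proof. exact: rmorph1. Qed.
Lemma rc_nat n : rc n%:R = n%:R. Proof. exact: rmorph_nat. Qed.
Lemma rc_inj : injective rc. Proof. exact: complexI. Qed.
Lemma rc_le r e : (rc r <= rc e) = (r <= e). Proof. exact: lecR. Qed.
Lemma rc_lt r e : (rc r < rc e) = (r < e). Proof. exact: ltcR. Qed.
Lemma rc_sum I (s : seq I) (P : pred I) (F : I -> R) :
  rc (\sum_(i <- s | P i) F i) = \sum_(i <- s | P i) rc (F i).
Proof. exact: rmorph_sum. Qed.

Lemma cmod_ge0 z : 0 <= cmod z. Proof. exact: normc_ge0. Qed.
Lemma cmod0 : cmod 0 = 0. Proof. by apply: rc_inj; rewrite cmodE normr0 rc0. Qed.
Lemma cmod1 : cmod 1 = 1. Proof. by apply: rc_inj; rewrite cmodE normr1 rc1. Qed.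
Lemma cmod_eq0 z : (cmod z == 0) = (z == 0).
Proof. by rewrite -(inj_eq rc_inj) cmodE rc0 normr_eq0. Qed.
Lemma cmod_gt0 z : (0 < cmod z) = (z != 0).
Proof. by rewrite lt_def cmod_eq0 cmod_ge0 andbT. Qed.
Lemma cmodD z w : cmod (z + w) <= cmod z + cmod w.
Proof. by rewrite -rc_le rcD !cmodE ler_normD. Qed.
Lemma cmodN z : cmod (- z) = cmod z.
Proof. by apply: rc_inj; rewrite !cmodE normrN. Qed.
Lemma cmodB z w : cmod (z - w) <= cmod z + cmod w.
Proof. by rewrite (le_trans (cmodD _ _))// cmodN. Qed.
Lemma cmodC z w : cmod (z - w) = cmod (w - z).
Proof. by rewrite -cmodN opprB. Qed.
Lemma cmod_tri u z w : cmod (z - w) <= cmod (z - u) + cmod (u - w).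
Proof. by rewrite (le_trans _ (cmodD _ _))// addrA subrK. Qed.
Lemma cmod_triB z w : cmod z - cmod w <= cmod (z - w).
Proof. by rewrite lerBlDr (le_trans _ (cmodD _ _))// subrK. Qed.
Lemma cmodM z w : cmod (z * w) = cmod z * cmod w.
Proof. by apply: rc_inj; rewrite rcM !cmodE normrM. Qed.
Lemma cmodX z n : cmod (z ^+ n) = cmod z ^+ n.
Proof. by apply: rc_inj; rewrite rcX !cmodE normrX. Qed.
Lemma cmodV z : cmod z^-1 = (cmod z)^-1.
Proof. by apply: rc_inj; rewrite rcV !cmodE normfV. Qed.
Lemma cmod_rc r : cmod (rc r) = `|r|.
Proof. by apply: rc_inj; rewrite cmodE /rc normc_def /= expr0n addr0 sqrtr_sqr. Qed.
Lemma cmod_nat n : cmod n%:R = n%:R.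
Proof. by rewrite -rc_nat cmod_rc normr_nat. Qed.
Lemma cmod_sum I (s : seq I) (P : pred I) (F : I -> C) :
  cmod (\sum_(i <- s | P i) F i) <= \sum_(i <- s | P i) cmod (F i).
Proof.
rewrite -rc_le rc_sum cmodE (le_trans (ler_norm_sum _ _ _))//.
Qed.
Lemma cmod_conj z : cmod z^* = cmod z.
Proof. by apply: rc_inj; rewrite !cmodE norm_conjC. Qed.
Lemma cmod_mulconj z : z * z^* = rc (cmod z ^+ 2).
Proof. by rewrite -normCK rcX cmodE. Qed.

Lemma complex_decomp z : z = rc (complex.Re z) + 'i%C * rc (complex.Im z).
Proof. exact: complexE. Qed.
Lemma normRe_le z : `|complex.Re z| <= cmod z.
Proof. by rewrite -rc_le cmodE; exact: normc_ge_Re. Qed.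
Lemma cmod_i : cmod 'i%C = 1.
Proof.
apply/eqP; rewrite -(@eqrXn2 _ 2)// ?cmod_ge0// -cmodX.
by rewrite (_ : 'i%C ^+ 2 = -1 :> C) ?cmodN ?cmod1 ?expr1n// sqr_i.
Qed.
Lemma Re_i z : complex.Re (- 'i%C * z) = complex.Im z.
Proof. by case: z => a b /=; rewrite !(oppr0, mul0r, sub0r) mulN1r opprK. Qed.
Lemma normIm_le z : `|complex.Im z| <= cmod z.
Proof. by rewrite -Re_i (le_trans (normRe_le _))// cmodM cmodN cmod_i mul1r. Qed.
Lemma cmod_leReIm z : cmod z <= `|complex.Re z| + `|complex.Im z|.
Proof.
by rewrite {1}(complex_decomp z) (le_trans (cmodD _ _))// cmodM cmod_i mul1r !cmod_rc.
Qed.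
Lemma ReD z w : complex.Re (z + w) = complex.Re z + complex.Re w.
Proof. by case: z w => ? ? []. Qed.
Lemma ReN z : complex.Re (- z) = - complex.Re z.
Proof. by case: z. Qed.
Lemma ReB z w : complex.Re (z - w) = complex.Re z - complex.Re w.
Proof. by rewrite ReD ReN. Qed.
Lemma ImB z w : complex.Im (z - w) = complex.Im z - complex.Im w.
Proof. by case: z w => ? ? []. Qed.
Lemma Re_rcM r z : complex.Re (rc r * z) = r * complex.Re z.
Proof. by case: z => a b /=; rewrite mul0r subr0. Qed.
Lemma Re_rc r : complex.Re (rc r) = r. Proof. by []. Qed.
Lemma cmod_sq z : cmod z ^+ 2 = complex.Re z ^+ 2 + complex.Im z ^+ 2.
Proof. by apply: rc_inj; rewrite rcX cmodE /rc add_Re2_Im2. Qed.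

End Modulus.


(** * Limits and compactness in the complex plane *)

Section Limits.
Set Implicit Arguments.
Unset Strict Implicit.
Variable R : realType.
Local Notation C := (Cplx R).
Implicit Types (z w : C) (r e : R) (u v : nat -> C).

Definition limC u l := forall e, 0 < e -> exists N, forall n, (N <= n)%N -> cmod (u n - l) < e.

Lemma invS_lt e : 0 < e -> exists N, forall n, (N <= n)%N -> n.+1%:R^-1 < e.
Proof.
move=> e0; have /cvgrPdist_lt/(_ e e0)[N _ H] := @cvg_harmonic R.
exists N => n Nn; have := H n Nn; by rewrite /= sub0r normrN ger0_norm// invr_ge0 ler0n.
Qed.

Lemma expr_lt r e : 0 <= r -> r < 1 -> 0 < e ->
  exists N, forall n, (N <= n)%N -> r ^+ n < e.
Proof.
move=> r0 r1 e0; have : `|r| < 1 by rewrite ger0_norm.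
move=> /cvg_expr/cvgrPdist_lt/(_ e e0)[N _ H].
exists N => n Nn; have := H n Nn; by rewrite /= sub0r normrN ger0_norm// exprn_ge0.
Qed.

Lemma limC_cvg u l : limC u l <-> u @ \oo --> l.
Proof.
split=> [H|/cvgrPdist_lt H e e0].
  apply/cvgrPdist_lt => e e0.
  have eE : e = rc (cmod e) by rewrite cmodE ger0_norm// ltW.
  have /H[N HN] : 0 < cmod e by rewrite cmod_gt0 gt_eqF.
  exists N => // n /= Nn.
  by rewrite -cmodE eE rc_lt cmodC HN.
have /H[N _ HN] : 0 < rc e by rewrite -(rc0 R) rc_lt.
by exists N => n /HN /=; rewrite -cmodE rc_lt cmodC.
Qed.

Lemma limC_uniq u l l' : limC u l -> limC u l' -> l = l'.
Proof.
move=> H H'; apply/eqP; rewrite -subr_eq0 -cmod_eq0 eq_le cmod_ge0 andbT leNgt.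
apply/negP => e0; have e2 : 0 < cmod (l - l') / 2 by lra.
have [N HN] := H _ e2; have [N' HN'] := H' _ e2.
have := HN _ (leq_maxl N N'); have := HN' _ (leq_maxr N N').
have := cmod_tri (u (maxn N N')) l l'; rewrite (cmodC l (u _)); lra.
Qed.

Lemma limC_cmod_le u l M N : (forall n, (N <= n)%N -> cmod (u n) <= M) -> limC u l -> cmod l <= M.
Proof.
move=> H ul; apply/ler_addgt0Pr => e e0; have [N' HN] := ul _ e0.
have := HN _ (leq_maxr N N'); have := H _ (leq_maxl N N').
have := cmod_triB l (u (maxn N N')); rewrite (cmodC l); lra.
Qed.

Lemma limC_cst c : limC (fun=> c) c.
Proof. by move=> e e0; exists 0%N => n _; rewrite subrr cmod0. Qed.

Lemma limC_D u v l m : limC u l -> limC v m -> limC (fun n => u n + v n) (l + m).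
Proof.
move=> H H' e e0; have e2 : 0 < e / 2 by lra.
have [N HN] := H _ e2; have [N' HN'] := H' _ e2.
exists (maxn N N') => n; rewrite geq_max => /andP[/HN h /HN' h'].
have := cmodD (u n - l) (v n - m); rewrite addrACA -opprD; lra.
Qed.

Lemma limC_sub u v l : limC u l -> limC (fun n => u n - v n) 0 -> limC v l.
Proof.
move=> ul uv e e0; have e2 : 0 < e / 2 by lra.
have [N HN] := ul _ e2; have [N' HN'] := uv _ e2.
exists (maxn N N') => n; rewrite geq_max => /andP[/HN h /HN' ].
rewrite subr0 => h'; have := cmod_tri (u n) (v n) l; rewrite (cmodC (v n) (u n)); lra.
Qed.

Lemma limC_M u v l m : limC u l -> limC v m -> limC (fun n => u n * v n) (l * m).
Proof.
move=> H H' e e0.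
have k0 : 0 < cmod l + cmod m + 1 by have := cmod_ge0 l; have := cmod_ge0 m; lra.
pose d := Num.min 1 (e / 2 / (cmod l + cmod m + 1)).
have d0 : 0 < d by rewrite lt_min ltr01/= divr_gt0// divr_gt0.
have d1 : d <= 1 by rewrite ge_min lexx.
have de : d * (cmod l + cmod m + 1) <= e / 2.
  by rewrite -ler_pdivlMr// ge_min lexx orbT.
have [N HN] := H _ d0; have [N' HN'] := H' _ d0.
exists (maxn N N') => n; rewrite geq_max => /andP[/HN h /HN' h'].
rewrite (_ : _ - _ = (u n - l) * (v n - m) + (l * (v n - m) + m * (u n - l))); last by ring.
apply: le_lt_trans (cmodD _ _) _; apply: le_lt_trans (lerD (lexx _) (cmodD _ _)) _.
rewrite !cmodM.
have a := cmod_ge0 (u n - l); have b := cmod_ge0 (v n - m).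
have l0 := cmod_ge0 l; have m0 := cmod_ge0 m.
have : cmod (u n - l) * cmod (v n - m) <= d by nra.
have : cmod l * cmod (v n - m) <= cmod l * d by nra.
have : cmod m * cmod (u n - l) <= cmod m * d by nra.
nra.
Qed.

Lemma limC_B u v l m : limC u l -> limC v m -> limC (fun n => u n - v n) (l - m).
Proof.
move=> H H'; have := limC_D H (limC_M (limC_cst (-1)) H').
by under [X in limC X]funext do rewrite mulN1r; rewrite mulN1r.
Qed.

Lemma limC_X u l k : limC u l -> limC (fun n => u n ^+ k) (l ^+ k).
Proof.
move=> ul; elim: k => [|k IH]; first exact: limC_cst.
under [X in limC X]funext do rewrite exprS.
by rewrite exprS; exact: limC_M.
Qed.

Lemma limC_sum (I : Type) (s : seq I) (F : I -> nat -> C) (l : I -> C) :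
  (forall i, limC (F i) (l i)) ->
  limC (fun n => \sum_(i <- s) F i n) (\sum_(i <- s) l i).
Proof.
move=> H; elim: s => [|i s IH].
  by rewrite big_nil; under [X in limC X]funext do rewrite big_nil; exact: limC_cst.
rewrite big_cons; under [X in limC X]funext do rewrite big_cons.
exact: limC_D.
Qed.

Lemma limC_sub_seq u l (s : nat -> nat) : (forall k, (k <= s k)%N) -> limC u l -> limC (u \o s) l.
Proof.
move=> Hs H e /H[N HN]; exists N => n Nn /=; apply: HN.
exact: leq_trans Nn (Hs n).
Qed.

(** The extraction [s] need not be increasing: [k <= s k] is enough for limits to be inherited
    ([limC_sub_seq]). *)
Definition subseq_cpt (K : set C) := forall u, (forall n, K (u n)) ->
  exists z, exists s : nat -> nat,
    [/\ K z, forall k, (k <= s k)%N & limC (u \o s) z].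

(** Bolzano-Weierstrass: real and imaginary parts live in a compact square, and indices are picked
    within [1 / (k + 1)] of a cluster point. *)
Lemma disc_cpt M : subseq_cpt [set z | cmod z <= M].
Proof.
move=> u uM.
pose v n : R * R := (complex.Re (u n), complex.Im (u n)).
have cp : compact (`[- M, M] `*` `[- M, M] : set (R * R)).
  by apply: compact_setX; exact: segment_compact.
have [|p [_ clp]] := cp (v @ \oo) _.
  exists 0%N => // n _ /=; have := uM n => /= un.
  by rewrite /= !in_itv/= -!ler_norml (le_trans (normRe_le _))// (le_trans (normIm_le _)).
pose z : C := rc p.1 + 'i%C * rc p.2.
have /choice[s Hs] k : exists n, (k <= n)%N /\ cmod (u n - z) < k.+1%:R^-1.
  have k0 : 0 < (k.+1%:R^-1 / 2 : R) by rewrite divr_gt0// invr_gt0 ltr0n.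
  have nb : nbhs p (ball p (k.+1%:R^-1 / 2)) by apply: nbhsx_ballx.
  have tl : (v @ \oo) (v @` [set n | (k <= n)%N]).
    by exists k => // n /= kn; exists n.
  have [q [[n /= kn <-] [b1 b2]]] := clp _ _ tl nb.
  exists n; split => //.
  have e1 : complex.Re (u n - z) = complex.Re (u n) - p.1.
    by rewrite ReB /z ReD Re_rc (_ : complex.Re ('i%C * _) = 0) ?addr0//= mul0r mul1r subrr.
  have e2 : complex.Im (u n - z) = complex.Im (u n) - p.2.
    by rewrite ImB /z /= mul0r mul1r !add0r.
  apply: le_lt_trans (cmod_leReIm _) _; rewrite e1 e2.
  move: b1 b2; rewrite /ball/= ![`|_ - p.1|]distrC ![`|_ - p.2|]distrC => b1 b2.
  by rewrite [ltRHS]splitr ltrD.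
have cv : limC (u \o s) z.
  move=> e /invS_lt[N HN]; exists N => n /HN h; have [_ h'] := Hs n.
  exact: lt_trans h' h.
exists z, s; split => //=.
- by apply: (@limC_cmod_le (u \o s) _ _ 0 _ cv) => n _; exact: uM.
- by move=> k; have [] := Hs k.
Qed.

(** A tail is bounded, hence has a convergent extraction by [disc_cpt], whose limit attracts the
    whole Cauchy sequence. *)
Lemma cauchyC u : (forall e, 0 < e -> exists N, forall m n, (N <= m)%N -> (N <= n)%N ->
    cmod (u m - u n) < e) -> exists l, limC u l.
Proof.
move=> H; have [N HN] := H 1 ltr01.
have [|z [s [_ Hs cv]]] := @disc_cpt (cmod (u N) + 1) (fun n => u (N + n)%N).
  move=> n /=; have := HN _ _ (leq_addr n N) (leqnn N).
  by have := cmod_triB (u (N + n)%N) (u N); lra.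
exists z => e e0; have e2 : 0 < e / 2 by lra.
have [N1 H1] := H _ e2; have [N2 H2] := cv _ e2.
exists N1 => n Nn; pose m := maxn N1 N2.
have := H2 m (leq_maxr _ _) => /= h2.
have le : (N1 <= N + s m)%N.
  by apply: leq_trans (leq_maxl N1 N2) _; apply: leq_trans (Hs m) (leq_addl _ _).
have := H1 _ _ Nn le.
have := cmod_tri (u (N + s m)%N) (u n) z; lra.
Qed.

Definition cont_on (K : set C) (F : C -> R) := forall z, K z -> forall e, 0 < e ->
  exists2 d, 0 < d & forall w, K w -> cmod (w - z) < d -> `|F w - F z| < e.

Lemma min_attained (K : set C) (F : C -> R) : subseq_cpt K -> (exists z, K z) ->
  (forall z, K z -> 0 <= F z) -> cont_on K F ->
  exists2 z, K z & forall w, K w -> F z <= F w.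
Proof.
move=> cK [z0 Kz0] F0 cF.
pose m := inf (F @` K).
have hi : has_inf (F @` K).
  by split; [exists (F z0), z0|exists 0 => _ [w /F0 h <-]].
have /choice[u Hu] (n : nat) : exists z, K z /\ F z < m + n.+1%:R^-1.
  have k0 : 0 < (n.+1%:R^-1 : R) by rewrite invr_gt0 ltr0n.
  by have [_ [z Kz <-] h] := inf_adherent k0 hi; exists z.
have [n|z [s [Kz Hs cv]]] := cK u; first by have [] := Hu n.
exists z => // w Kw.
have mw : m <= F w by apply: (ge_inf (proj2 hi)); exists w.
apply: le_trans mw; apply/ler_addgt0Pr => e e0.
have e2 : 0 < e / 2 by lra.
have [d d0 Hd] := cF z Kz _ e2.
have [N1 H1] := cv _ d0; have [N2 H2] := invS_lt e2.
pose n := maxn N1 N2.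
have h1 := H1 n (leq_maxl _ _).
have h2 := H2 (s n) (leq_trans (leq_maxr N1 N2) (Hs n)).
have [Ku h3] := Hu (s n).
have /= := Hd _ Ku h1; rewrite ltr_norml => /andP[h4 _].
have h5 : F (u (s n)) < m + e / 2 by apply: lt_trans h3 _; rewrite ltrD2l.
move: h5 h4 e0; clear; lra.
Qed.

Definition cont_onC (K : set C) (f : C -> C) := forall z, K z -> forall e, 0 < e ->
  exists2 d, 0 < d & forall w, K w -> cmod (w - z) < d -> cmod (f w - f z) < e.

(** Otherwise there are pairs at distance below [1 / (n + 1)] whose values stay [e] apart; both
    members of a subsequence converge to one point, against continuity there. *)
Lemma heine_cantor (K : set C) (f : C -> C) : subseq_cpt K -> cont_onC K f ->
  forall e, 0 < e -> exists2 d, 0 < d & forall z w, K z -> K w -> cmod (w - z) < d ->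
    cmod (f w - f z) < e.
Proof.
move=> cK cf e e0; apply: contrapT => H.
have /choice[u Hu] (n : nat) : exists p : C * C, [/\ K p.1, K p.2,
    cmod (p.2 - p.1) < n.+1%:R^-1 & e <= cmod (f p.2 - f p.1)].
  apply: contrapT => H'; apply: H.
  exists (n.+1%:R^-1); first by rewrite invr_gt0 ltr0n.
  move=> z w Kz Kw h; rewrite ltNge; apply/negP => h'; apply: H'.
  by exists (z, w).
have [n|z [s [Kz Hs cv]]] := cK (fst \o u); first by have [] := Hu n.
have e2 : 0 < e / 2 by lra.
have [d d0 Hd] := cf z Kz _ e2.
have d2 : 0 < d / 2 by lra.
have [N1 H1] := cv _ d2; have [N2 H2] := invS_lt d2.
pose n := maxn N1 N2.
have h1 := H1 n (leq_maxl _ _).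
have h2 := H2 (s n) (leq_trans (leq_maxr N1 N2) (Hs n)).
have [K1 K2 h3 h4] := Hu (s n).
have {}h3 := lt_trans h3 h2.
have a : cmod (f (u (s n)).1 - f z) < e / 2 by apply: Hd => //; move: h1 => /=; lra.
have b : cmod (f (u (s n)).2 - f z) < e / 2.
  apply: Hd => //; move: h1 => /=.
  have := cmod_tri (u (s n)).1 (u (s n)).2 z; lra.
have := cmod_tri (f z) (f (u (s n)).2) (f (u (s n)).1); rewrite (cmodC (f z)); lra.
Qed.

Lemma cont_bounded (K : set C) (f : C -> C) : subseq_cpt K -> cont_onC K f ->
  exists M, forall z, K z -> cmod (f z) <= M.
Proof.
move=> cK cf; apply: contrapT => H.
have /choice[u Hu] (n : nat) : exists z, K z /\ n%:R < cmod (f z).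
  apply: contrapT => H'; apply: H; exists n%:R => z Kz.
  by rewrite leNgt; apply/negP => h; apply: H'; exists z.
have [n|z [s [Kz Hs cv]]] := cK u; first by have [] := Hu n.
have [d d0 Hd] := cf z Kz _ ltr01.
have [N HN] := cv _ d0.
pose n := maxn N (Num.truncn (cmod (f z) + 1)).+1.
have [Ku h] := Hu (s n).
have := Hd _ Ku (HN n (leq_maxl _ _)); rewrite /=.
have h2 : cmod (f z) + 1 < n%:R.
  apply: lt_le_trans (truncnS_gt _) _; rewrite ler_nat leq_maxr//.
have h3 : (n%:R : R) <= (s n)%:R by rewrite ler_nat.
have := cmod_triB (f (u (s n))) (f z); lra.
Qed.

Lemma ball_within_nbhs z e : 0 < e -> nbhs z [set w : C | cmod (w - z) < e].
Proof.
move=> e0; apply/nbhs_ballP; exists (rc e) => /=; first by rewrite -(rc0 R) rc_lt.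
by move=> w /=; rewrite -ball_normE /= -cmodE rc_lt cmodC.
Qed.

Lemma nbhs_ball_cmod z (P : set C) : nbhs z P ->
  exists2 e, 0 < e & forall w, cmod (w - z) < e -> P w.
Proof.
move=> /nbhs_ballP[e /= e0 H].
have eE : e = rc (cmod e) by rewrite cmodE ger0_norm// ltW.
exists (cmod e); first by rewrite cmod_gt0 gt_eqF.
move=> w h; apply: H; rewrite -ball_normE /= -cmodE eE rc_lt cmodC.
exact: h.
Qed.

End Limits.


(** * Uniformly complex-differentiable functions *)

Section UnifDiff.
Set Implicit Arguments.
Unset Strict Implicit.
Variable R : realType.
Local Notation C := (Cplx R).
Implicit Types (z w : C) (r e : R) (K L : set C) (f g : C -> C).

Definition bdd_on K f := exists M, forall z, K z -> cmod (f z) <= M.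

(* This uniform differentiability is what all the arguments use: it is stable
   under products, compositions and uniform limits of functions and derivatives,
   and for continuously differentiable functions it holds on compact convex sets. *)
Definition udiff K f f' := [/\ bdd_on K f, bdd_on K f' &
  forall e, 0 < e -> exists2 d, 0 < d & forall z w, K z -> K w -> cmod (w - z) < d ->
    cmod (f w - f z - f' z * (w - z)) <= e * cmod (w - z)].

Definition convexC K := forall z w t, K z -> K w -> 0 <= t -> t <= 1 ->
  K (z + rc t * (w - z)).

Definition unif_lim K (u : nat -> C -> C) f := forall e, 0 < e ->
  exists N, forall n z, (N <= n)%N -> K z -> cmod (u n z - f z) < e.

Lemma bdd_pos K f : bdd_on K f -> exists2 M, 0 < M & forall z, K z -> cmod (f z) <= M.
Proof.
move=> [M H]; exists (`|M| + 1); first by have := normr_ge0 M; lra.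
by move=> z /H; have := ler_norm M; lra.
Qed.

Lemma bdd_D K f g : bdd_on K f -> bdd_on K g -> bdd_on K (fun z => f z + g z).
Proof.
move=> [M H] [N H']; exists (M + N) => z Kz; apply: le_trans (cmodD _ _) _.
by apply: lerD; [exact: H|exact: H'].
Qed.

Lemma bdd_M K f g : bdd_on K f -> bdd_on K g -> bdd_on K (fun z => f z * g z).
Proof.
move=> [M H] [N H']; exists (M * N) => z Kz; rewrite cmodM.
by apply: ler_pM; rewrite ?cmod_ge0//; [exact: H|exact: H'].
Qed.

Lemma udiff_ext K f f' g g' : (forall z, K z -> f z = g z) ->
  (forall z, K z -> f' z = g' z) -> udiff K f f' -> udiff K g g'.
Proof.
move=> e1 e2 [[M1 b1] [M2 b2] H]; split.
- by exists M1 => z Kz; rewrite -e1// b1.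
- by exists M2 => z Kz; rewrite -e2// b2.
- move=> e /H[d d0 Hd]; exists d => // z w Kz Kw h.
  by rewrite -!e1// -e2// Hd.
Qed.

Lemma udiff_cst K c : udiff K (fun=> c) (fun=> 0).
Proof.
split; [by exists (cmod c)|by exists 0 => z _; rewrite cmod0|].
move=> e e0; exists 1 => // z w _ _ _.
by rewrite subrr mul0r subr0 cmod0 mulr_ge0 ?cmod_ge0 ?ltW.
Qed.

Lemma udiff_id K : bdd_on K id -> udiff K id (fun=> 1).
Proof.
move=> b; split=> //; first by exists 1 => z _; rewrite cmod1.
move=> e e0; exists 1 => // z w _ _ _.
by rewrite mul1r subrr cmod0 mulr_ge0 ?cmod_ge0 ?ltW.
Qed.

Lemma udiff_D K f f' g g' : udiff K f f' -> udiff K g g' ->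
  udiff K (fun z => f z + g z) (fun z => f' z + g' z).
Proof.
move=> [b1 b2 H] [c1 c2 H']; split; [exact: bdd_D|exact: bdd_D|].
move=> e e0; have e2 : 0 < e / 2 by lra.
have [d d0 Hd] := H _ e2; have [d' d0' Hd'] := H' _ e2.
exists (Num.min d d'); first by rewrite lt_min d0.
move=> z w Kz Kw; rewrite lt_min => /andP[h h'].
have := Hd _ _ Kz Kw h; have := Hd' _ _ Kz Kw h'.
have := cmodD (f w - f z - f' z * (w - z)) (g w - g z - g' z * (w - z)).
rewrite (_ : f w - f z - f' z * (w - z) + (g w - g z - g' z * (w - z)) =
  f w + g w - (f z + g z) - (f' z + g' z) * (w - z)); last by ring.
lra.
Qed.

(** Only nearby points are compared because [K] is not assumed convex; [mean_value_le] is the global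
    version. *)
Lemma udiff_lip K f f' : udiff K f f' -> exists r d, [/\ 0 < r, 0 < d &
  forall z w, K z -> K w -> cmod (w - z) < d -> cmod (f w - f z) <= r * cmod (w - z)].
Proof.
move=> [_ /bdd_pos[M M0 b] H].
have [d d0 Hd] := H 1 ltr01.
exists (M + 1), d; split; [lra|by []|] => z w Kz Kw h.
have := Hd _ _ Kz Kw h; have := cmod_triB (f w - f z) (f' z * (w - z)).
rewrite cmodM; have := b _ Kz; have := cmod_ge0 (w - z).
have := cmod_ge0 (f' z); nra.
Qed.

Lemma udiff_cont K f f' : udiff K f f' -> forall e, 0 < e -> exists2 d, 0 < d &
  forall z w, K z -> K w -> cmod (w - z) < d -> cmod (f w - f z) < e.
Proof.
move=> /udiff_lip[L [d [L0 d0 H]]] e e0.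
exists (Num.min d (e / L)); first by rewrite lt_min d0 divr_gt0.
move=> z w Kz Kw; rewrite lt_min ltr_pdivlMr// => /andP[h h'].
have := H _ _ Kz Kw h; nra.
Qed.

Lemma udiff_contC K f f' : udiff K f f' -> cont_onC K f.
Proof.
move=> /udiff_cont H z Kz e /H[d d0 Hd]; exists d => // w Kw; exact: Hd.
Qed.

(** Exchanging [z] and [w] and adding the two first-order expansions leaves
    [(f' w - f' z) * (w - z)]: uniform differentiability forces a continuous derivative. *)
Lemma udiff_dcont K f f' : udiff K f f' -> forall e, 0 < e -> exists2 d, 0 < d &
  forall z w, K z -> K w -> cmod (w - z) < d -> cmod (f' w - f' z) < e.
Proof.
move=> [_ _ H] e e0; have e4 : 0 < e / 4 by lra.
have [d d0 Hd] := H _ e4; exists d => // z w Kz Kw h.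
have [->|zw] := eqVneq z w; first by rewrite subrr cmod0.
have p0 : 0 < cmod (w - z) by rewrite cmod_gt0 subr_eq0 eq_sym.
rewrite -(ltr_pM2r p0) -cmodM.
have a := Hd _ _ Kz Kw h; rewrite cmodC in h; have b := Hd _ _ Kw Kz h.
rewrite (cmodC z w) in b.
have := cmodD (f w - f z - f' z * (w - z)) (f z - f w - f' w * (z - w)).
rewrite (_ : f w - f z - f' z * (w - z) + (f z - f w - f' w * (z - w)) =
   (f' w - f' z) * (w - z)); last by ring.
nra.
Qed.

Lemma udiff_M K f f' g g' : udiff K f f' -> udiff K g g' ->
  udiff K (fun z => f z * g z) (fun z => f' z * g z + f z * g' z).
Proof.
move=> uf ug; have [b1 b2 H] := uf; have [c1 c2 H'] := ug; split.
- exact: bdd_M.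
- by apply: bdd_D; exact: bdd_M.
move=> e e0.
have [A A0 fA] := bdd_pos b1; have [B B0 gB] := bdd_pos c1.
have [A' A0' fA'] := bdd_pos b2.
have eA : 0 < e / 3 / A by rewrite !divr_gt0.
have eB : 0 < e / 3 / B by rewrite !divr_gt0.
have eA' : 0 < e / 3 / A' by rewrite !divr_gt0.
have [d1 d10 h1] := H _ eB; have [d2 d20 h2] := H' _ eA.
have [d3 d30 h3] := udiff_cont ug eA'.
exists (Num.min d1 (Num.min d2 d3)); first by rewrite !lt_min d10 d20.
move=> z w Kz Kw; rewrite !lt_min => /and3P[l1 l2 l3].
have := h1 _ _ Kz Kw l1; have := h2 _ _ Kz Kw l2; have := h3 _ _ Kz Kw l3.
move=> k3 k2 k1.
rewrite (_ : _ - _ - _ = (f w - f z - f' z * (w - z)) * g w +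
  (f z * (g w - g z - g' z * (w - z)) + f' z * (w - z) * (g w - g z))); last by ring.
apply: le_trans (cmodD _ _) _; apply: le_trans (lerD (lexx _) (cmodD _ _)) _.
rewrite !cmodM; have p := cmod_ge0 (w - z).
have t1 : cmod (f w - f z - f' z * (w - z)) * cmod (g w) <= e / 3 * cmod (w - z).
  apply: (@le_trans _ _ (e / 3 / B * cmod (w - z) * B)).
    by apply: ler_pM; rewrite ?cmod_ge0// gB.
  by rewrite mulrAC divfK// gt_eqF.
have t2 : cmod (f z) * cmod (g w - g z - g' z * (w - z)) <= e / 3 * cmod (w - z).
  apply: (@le_trans _ _ (A * (e / 3 / A * cmod (w - z)))).
    by apply: ler_pM; rewrite ?cmod_ge0// fA.
  by rewrite mulrA (mulrC A) divfK// gt_eqF.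
have t3 : cmod (f' z) * cmod (w - z) * cmod (g w - g z) <= e / 3 * cmod (w - z).
  apply: (@le_trans _ _ (A' * cmod (w - z) * (e / 3 / A'))).
    apply: ler_pM; rewrite ?mulr_ge0 ?cmod_ge0//; last exact: ltW.
    by apply: ler_wpM2r => //; exact: fA'.
  by rewrite mulrAC (mulrC A') divfK// gt_eqF.
lra.
Qed.

Lemma udiff_scale K c f f' : udiff K f f' -> udiff K (fun z => c * f z) (fun z => c * f' z).
Proof.
move=> H; apply: udiff_ext (udiff_M (udiff_cst K c) H) => // z _.
by rewrite mul0r add0r.
Qed.

Lemma udiff_B K f f' g g' : udiff K f f' -> udiff K g g' ->
  udiff K (fun z => f z - g z) (fun z => f' z - g' z).
Proof.
move=> H H'; apply: udiff_ext (udiff_D H (udiff_scale (-1) H')) => z _; by rewrite mulN1r.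
Qed.

Lemma udiff_X K f f' n : udiff K f f' -> exists g', udiff K (fun z => f z ^+ n) g'.
Proof.
move=> H; elim: n => [|n [g' IH]].
  by exists (fun=> 0); apply: udiff_ext (udiff_cst K 1).
exists (fun z => f' z * f z ^+ n + f z * g' z).
by apply: udiff_ext (udiff_M H IH) => // z _; rewrite exprS.
Qed.

Lemma udiff_comp K L f f' g g' : udiff L f f' -> udiff K g g' -> (forall z, K z -> L (g z)) ->
  udiff K (fun z => f (g z)) (fun z => f' (g z) * g' z).
Proof.
move=> uf ug KL; have [[M1 b1] b2 H] := uf; have [c1 c2 H'] := ug.
have b2' : bdd_on K (fun z => f' (g z)) by have [M HM] := b2; exists M => z /KL/HM.
split.
- by exists M1 => z /KL/b1.
- exact: bdd_M.
move=> e e0; have [A A0 fA] := bdd_pos b2'.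
have [l [d1 [l0 d10 h1]]] := udiff_lip ug.
have e1 : 0 < e / 2 / l by rewrite !divr_gt0.
have e2 : 0 < e / 2 / A by rewrite !divr_gt0.
have [d2 d20 h2] := H _ e1; have [d3 d30 h3] := H' _ e2.
exists (Num.min d1 (Num.min d3 (d2 / l))); first by rewrite !lt_min d10 d30 divr_gt0.
move=> z w Kz Kw; rewrite !lt_min ltr_pdivlMr// => /and3P[l1 l2 l3].
have k1 := h1 _ _ Kz Kw l1; have k3 := h3 _ _ Kz Kw l2.
have gd : cmod (g w - g z) < d2 by apply: le_lt_trans k1 _; rewrite mulrC.
have k2 := h2 _ _ (KL _ Kz) (KL _ Kw) gd.
rewrite (_ : _ - _ - _ = (f (g w) - f (g z) - f' (g z) * (g w - g z)) +
   f' (g z) * (g w - g z - g' z * (w - z))); last by ring.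
apply: le_trans (cmodD _ _) _; rewrite cmodM.
have t1 : cmod (f (g w) - f (g z) - f' (g z) * (g w - g z)) <= e / 2 * cmod (w - z).
  apply: le_trans k2 _; apply: (@le_trans _ _ (e / 2 / l * (l * cmod (w - z)))).
    by apply: ler_wpM2l => //; exact: ltW.
  by rewrite mulrA divfK// gt_eqF.
have t2 : cmod (f' (g z)) * cmod (g w - g z - g' z * (w - z)) <= e / 2 * cmod (w - z).
  apply: (@le_trans _ _ (A * (e / 2 / A * cmod (w - z)))).
    by apply: ler_pM; rewrite ?cmod_ge0// fA.
  by rewrite mulrA (mulrC A) divfK// gt_eqF.
lra.
Qed.

(** The segment is cut into equal steps short enough for the first-order expansion, each
    contributing at most [M + e] times its length; then [e] tends to 0. *)
Lemma mean_value_le K f f' (M : R) : convexC K -> udiff K f f' -> (forall z, K z -> cmod (f' z) <= M) ->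
  forall z w, K z -> K w -> cmod (f w - f z) <= M * cmod (w - z).
Proof.
move=> cK [_ _ H] fM z w Kz Kw.
have [->|zw] := eqVneq z w; first by rewrite !subrr cmod0 mulr0.
have p0 : 0 < cmod (w - z) by rewrite cmod_gt0 subr_eq0 eq_sym.
rewrite -ler_pdivrMr//; apply/ler_addgt0Pr => e e0; rewrite ler_pdivrMr//.
have [d d0 Hd] := H e e0.
have dn0 : 0 < d / cmod (w - z) by rewrite divr_gt0.
have [N /(_ N (leqnn N)) HN] := invS_lt dn0.
pose p k : C := z + rc (k%:R / N.+1%:R) * (w - z).
have Nn : (N.+1%:R : R) != 0 by rewrite pnatr_eq0.
have Kp k : (k <= N.+1)%N -> K (p k).
  move=> kN; apply: cK => //.
  by rewrite ler_pdivrMr ?ltr0n// mul1r ler_nat.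
have st k : p k.+1 - p k = rc (N.+1%:R^-1) * (w - z).
  rewrite /p -addn1 natrD mulrDl rcD mul1r; ring.
have P k : (k <= N.+1)%N -> cmod (f (p k) - f z) <= k%:R * ((M + e) * cmod (w - z) / N.+1%:R).
  elim: k => [_|k IH kN].
    by rewrite /p (mul0r _^-1) rc0 mul0r addr0 subrr cmod0 mul0r.
  have {}IH := IH (ltnW kN).
  have nst : cmod (p k.+1 - p k) = cmod (w - z) / N.+1%:R.
    by rewrite st cmodM cmod_rc ger0_norm ?invr_ge0// mulrC.
  have sm : cmod (p k.+1 - p k) < d.
    by rewrite nst mulrC -ltr_pdivlMr.
  have := Hd _ _ (Kp _ (ltnW kN)) (Kp _ kN) sm => h.
  have h1 := cmod_triB (f (p k.+1) - f (p k)) (f' (p k) * (p k.+1 - p k)).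
  rewrite cmodM in h1.
  have h2 := cmod_tri (f (p k)) (f (p k.+1)) (f z).
  have h3 : cmod (f' (p k)) * cmod (p k.+1 - p k) <= M * cmod (p k.+1 - p k).
    by apply: ler_wpM2r; rewrite ?cmod_ge0//; apply: fM; exact: Kp (ltnW kN).
  rewrite -(addn1 k) natrD mulrDl mul1r addn1 -mulrA -nst.
  rewrite -mulrA -nst in IH; lra.
have := P _ (leqnn _); rewrite mulrC divfK//.
by rewrite /p divff// rc1 mul1r [z + _]addrC subrK.
Qed.

Lemma unif_lim_limC K (u : nat -> C -> C) f z : unif_lim K u f -> K z -> limC (u^~ z) (f z).
Proof. by move=> H Kz e /H[N HN]; exists N => n Nn; exact: HN. Qed.

Lemma unif_lim_bdd K (u : nat -> C -> C) f : unif_lim K u f -> (forall n, bdd_on K (u n)) ->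
  bdd_on K f.
Proof.
move=> H b; have [N HN] := H 1 ltr01; have [M HM] := b N.
exists (M + 1) => z Kz; have := HN N z (leqnn _) Kz; have := HM _ Kz.
have := cmod_triB (f z) (u N z); rewrite (cmodC (f z)); lra.
Qed.

(** The mean value inequality for [u m - u N] bounds its increments uniformly in [m]; letting [m]
    tend to infinity transfers the expansion of [u N] to [f]. *)
Lemma udiff_lim K (u u' : nat -> C -> C) f f' : convexC K -> (forall n, udiff K (u n) (u' n)) ->
  unif_lim K u f -> unif_lim K u' f' -> udiff K f f'.
Proof.
move=> cK H ul ul'; split.
- by apply: unif_lim_bdd ul _ => n; have [] := H n.
- by apply: unif_lim_bdd ul' _ => n; have [] := H n.
move=> e e0; have e4 : 0 < e / 4 by lra.
have [N HN] := ul' _ e4.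
have [d d0 Hd] : exists2 d, 0 < d & forall z w, K z -> K w -> cmod (w - z) < d ->
    cmod (u N w - u N z - u' N z * (w - z)) <= e / 4 * cmod (w - z).
  by have [_ _] := H N; apply.
exists d => // z w Kz Kw h.
have key : cmod ((f w - u N w) - (f z - u N z)) <= e / 2 * cmod (w - z).
  apply: (@limC_cmod_le _ (fun m => (u m w - u N w) - (u m z - u N z)) _ _ N).
    move=> m Nm.
    apply: (mean_value_le (f := fun z => u m z - u N z) (f' := fun z => u' m z - u' N z) cK) => //.
      exact: udiff_B.
    move=> x Kx; have := HN m x Nm Kx; have := HN N x (leqnn _) Kx.
    have := cmod_tri (f' x) (u' m x) (u' N x); rewrite (cmodC (f' x)); lra.
  by apply: limC_B; apply: limC_B; (exact: (unif_lim_limC ul)) || exact: limC_cst.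
have h1 := Hd _ _ Kz Kw h.
have h2 : cmod ((u' N z - f' z) * (w - z)) <= e / 4 * cmod (w - z).
  by rewrite cmodM ler_wpM2r ?cmod_ge0// ltW// HN.
rewrite (_ : _ - _ - _ = ((f w - u N w) - (f z - u N z)) +
  ((u N w - u N z - u' N z * (w - z)) + (u' N z - f' z) * (w - z))); last by ring.
apply: le_trans (cmodD _ _) _; apply: le_trans (lerD (lexx _) (cmodD _ _)) _.
lra.
Qed.

(** Compactness of [0, 1] as a gluing principle: the local property at the supremum of the [t] with
    [Q 0 t] both reaches this supremum and passes it, unless it is 1. *)
Lemma cousin (Q : R -> R -> Prop) :
  (forall a b c, 0 <= a -> a <= b -> b <= c -> c <= 1 -> Q a b -> Q b c -> Q a c) ->
  (forall t, 0 <= t -> t <= 1 -> exists2 d, 0 < d & forall a b, 0 <= a -> b <= 1 ->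
     a <= t -> t <= b -> b - a < d -> Q a b) -> Q 0 1.
Proof.
move=> Qadd Qloc.
pose S := [set t : R | [/\ 0 <= t, t <= 1 & Q 0 t]].
have S0 : S 0.
  have [d d0 Hd] := Qloc 0 (lexx _) ler01.
  by split=> //; apply: Hd => //; rewrite subrr.
have hs : has_sup S by split; [exists 0|exists 1 => t []].
have s0 : 0 <= sup S by apply: (ub_le_sup (proj2 hs)).
have s1 : sup S <= 1 by apply: ge_sup; [exists 0|move=> t []].
have [d d0 Hd] := Qloc _ s0 s1.
have d2 : 0 < d / 2 by lra.
have [a [a0 a1 Qa] ha] := sup_adherent d2 hs.
have as_ : a <= sup S by apply: (ub_le_sup (proj2 hs)).
(* Since [a] exceeds [sup S - d / 2], the interval from [a] to [b] has length below
   [d / 2 + d / 3 < d]. *)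
pose b := Num.min 1 (sup S + d / 3).
have sb : sup S <= b by rewrite le_min s1/=; lra.
have b1 : b <= 1 by rewrite ge_min lexx.
have bd : b <= sup S + d / 3 by rewrite ge_min lexx orbT.
have Qb : Q 0 b.
  apply: (Qadd _ a _) => //; first by lra.
  by apply: Hd => //; lra.
have Sb : S b by split=> //; lra.
have bs : b <= sup S by apply: (ub_le_sup (proj2 hs)).
suff <- : b = 1 by [].
apply/eqP; rewrite eq_le b1 leNgt; apply/negP => lt1.
have : sup S + d / 3 <= b.
  by move: lt1; rewrite /b gt_min ltxx le_min lexx/= andbT; exact: ltW.
lra.
Qed.

Definition diff_within K f z c := forall e, 0 < e -> exists2 d, 0 < d &
  forall w, K w -> cmod (w - z) < d -> cmod (f w - f z - c * (w - z)) <= e * cmod (w - z).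

Lemma udiff_diff_within K f f' z : udiff K f f' -> K z -> diff_within K f z (f' z).
Proof. by move=> [_ _ H] Kz e /H[d d0 Hd]; exists d => // w Kw; exact: Hd. Qed.

Lemma diff_within_cont K f f' : (forall z, K z -> diff_within K f z (f' z)) -> cont_onC K f.
Proof.
move=> H z Kz e e0; have [d d0 Hd] := H z Kz 1 ltr01.
have c0 : 0 < cmod (f' z) + 1 by have := cmod_ge0 (f' z); lra.
exists (Num.min d (e / (cmod (f' z) + 1))); first by rewrite lt_min d0 divr_gt0.
move=> w Kw; rewrite lt_min ltr_pdivlMr// => /andP[h h'].
have := Hd _ Kw h; have := cmod_triB (f w - f z) (f' z * (w - z)); rewrite cmodM; nra.
Qed.

(** A fundamental theorem of calculus without integral: on the segment from [z] to [w], the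
    increments of [f - f' z * id] are small near each point, and [cousin] adds them up. *)
Lemma C1_udiff K f f' : convexC K -> subseq_cpt K ->
  (forall z, K z -> diff_within K f z (f' z)) -> cont_onC K f' -> udiff K f f'.
Proof.
move=> cK cpK df cf'; split.
- exact: cont_bounded (diff_within_cont df).
- exact: cont_bounded.
move=> e e0; have e2 : 0 < e / 2 by lra.
have [d d0 Hd] := heine_cantor cpK cf' e2.
exists d => // z w Kz Kw h.
pose p t : C := z + rc t * (w - z).
have Kp t : 0 <= t -> t <= 1 -> K (p t) by exact: cK.
have pB a b : p b - p a = rc (b - a) * (w - z) by rewrite /p rcB; ring.
have npB a b : a <= b -> cmod (p b - p a) = (b - a) * cmod (w - z).
  by move=> ab; rewrite pB cmodM cmod_rc ger0_norm// subr_ge0.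
pose k t := f (p t) - f' z * p t.
(* Additive by the triangle inequality. Locally, one half of [e] pays for the expansion at [p t],
   the other for replacing [f' (p t)] by [f' z]. *)
pose Q a b : Prop := cmod (k b - k a) <= e * ((b - a) * cmod (w - z)).
suff : Q 0 1.
  rewrite /Q subr0 mul1r /k /p rc1 rc0 mul1r mul0r addr0 [z + _]addrC subrK.
  by rewrite (_ : f w - f' z * w - (f z - f' z * z) = f w - f z - f' z * (w - z))//; ring.
apply: cousin.
  move=> a b c _ ab bc _; rewrite /Q => h1 h2; have := cmod_tri (k b) (k c) (k a); lra.
move=> t t0 t1; have [dl dl0 Hdl] := df _ (Kp t t0 t1) _ e2.
have q0 : 0 < cmod (w - z) + 1 by have := cmod_ge0 (w - z); lra.
exists (dl / (cmod (w - z) + 1)); first by rewrite divr_gt0.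
have loc x : 0 <= x -> x <= 1 -> `|x - t| < dl / (cmod (w - z) + 1) ->
    cmod (k x - k t) <= e * (`|x - t| * cmod (w - z)).
  move=> x0 x1; rewrite ltr_pdivlMr// => xt.
  have nx : cmod (p x - p t) = `|x - t| * cmod (w - z) by rewrite pB cmodM cmod_rc.
  have b1 : cmod (p x - p t) < dl.
    by rewrite nx; have := normr_ge0 (x - t); lra.
  have b2 := Hdl _ (Kp x x0 x1) b1.
  have b3 : cmod (f' (p t) - f' z) <= e / 2.
    apply: ltW; apply: Hd => //; first exact: Kp.
    rewrite (_ : p t - z = rc t * (w - z)); last by rewrite /p; ring.
    rewrite cmodM cmod_rc ger0_norm//; apply: le_lt_trans h.
    by rewrite ler_piMl ?cmod_ge0.
  rewrite (_ : k x - k t = (f (p x) - f (p t) - f' (p t) * (p x - p t)) +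
     (f' (p t) - f' z) * (p x - p t)); last by rewrite /k; ring.
  apply: le_trans (cmodD _ _) _; rewrite -nx cmodM.
  have := cmod_ge0 (p x - p t); nra.
move=> a b a0 b1 at_ tb bad.
have la : cmod (k a - k t) <= e * (`|a - t| * cmod (w - z)).
  by apply: loc => //; [lra|apply: le_lt_trans bad; rewrite ler0_norm; lra].
have lb : cmod (k b - k t) <= e * (`|b - t| * cmod (w - z)).
  by apply: loc => //; [lra|apply: le_lt_trans bad; rewrite ger0_norm; lra].
rewrite ler0_norm ?subr_le0// in la; rewrite ger0_norm ?subr_ge0// in lb.
rewrite /Q; have := cmod_tri (k t) (k b) (k a); rewrite (cmodC (k t) (k a)).
lra.
Qed.

End UnifDiff.


(** * Cauchy formula by roots of unity *)

Section DiscAlgebra.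
Set Implicit Arguments.
Unset Strict Implicit.
Variable R : realType.
Local Notation C := (Cplx R).
Implicit Types (z w : C) (r e : R) (f g : C -> C) (p q : {poly C}).

Definition udisc : set C := [set z | cmod z <= 1].

Lemma cdiscE z : cdisc z <-> cmod z <= 1.
Proof. by rewrite /cdisc /= -cmodE -(rc1 R) rc_le. Qed.

Lemma odiscE z : odisc z <-> cmod z < 1.
Proof. by rewrite /odisc /= -cmodE -(rc1 R) rc_lt. Qed.

Lemma convexC_disc M : convexC [set z : C | cmod z <= M].
Proof.
move=> z w t /= zM wM t0 t1.
rewrite (_ : z + rc t * (w - z) = rc (1 - t) * z + rc t * w); last by rewrite rcB rc1; ring.
apply: le_trans (cmodD _ _) _; rewrite !cmodM !cmod_rc ger0_norm ?subr_ge0// ger0_norm//.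
have a := cmod_ge0 z; have b := cmod_ge0 w; nra.
Qed.

Lemma cmod_root N (w : C) : (0 < N)%N -> w ^+ N = 1 -> cmod w = 1.
Proof.
move=> N0 h; apply/eqP; rewrite -(@pexpr_eq1 _ _ N)//; last exact: cmod_ge0.
by rewrite -cmodX h cmod1.
Qed.

Lemma sqrt_unit w : cmod w = 1 -> exists s : C, [/\ s ^+ 2 = w, cmod s = 1 & 0 <= complex.Re s].
Proof.
move=> w1; have sq : (sqrtC w) ^+ 2 = w by exact: sqrtCK.
have n1 : cmod (sqrtC w) = 1.
  by apply/eqP; rewrite -(@pexpr_eq1 _ _ 2)//; [rewrite -cmodX sq w1|exact: cmod_ge0].
have [h|h] := leP 0 (complex.Re (sqrtC w)); first by exists (sqrtC w).
exists (- sqrtC w); split; first by rewrite sqrrN.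
- by rewrite cmodN.
- by rewrite ReN oppr_ge0 ltW.
Qed.

(** [|s + 1|^2 = 2 + 2 Re s] is at least 2, which exceeds [(7 / 5)^2]; the constant 5/7 is a
    rational substitute for the inverse of the square root of 2. *)
Lemma sqrt_unit_dist (s : C) : cmod s = 1 -> 0 <= complex.Re s -> cmod (s - 1) <= 5 / 7 * cmod (s ^+ 2 - 1).
Proof.
move=> s1 rs; have -> : s ^+ 2 - 1 = (s - 1) * (s + 1) by ring.
rewrite cmodM; have a := cmod_ge0 (s - 1).
suff : 7 / 5 <= cmod (s + 1) by nra.
have : cmod (s + 1) ^+ 2 = cmod s ^+ 2 + 2 * complex.Re s + 1.
  by rewrite !cmod_sq; case: s {s1 rs a} => x y /=; ring.
rewrite s1; have := cmod_ge0 (s + 1); nra.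
Qed.

Lemma root_tower m : exists w : C, [/\ w ^+ (2 ^ m) = -1, cmod w = 1 & cmod (w - 1) <= 2 * (5 / 7) ^+ m].
Proof.
elim: m => [|m [w [wm w1 wd]]].
  exists (-1); rewrite expn0 expr1 cmodN cmod1; split=> //.
  by rewrite -opprD cmodN expr0 mulr1 -[1 + 1]/(2%:R) cmod_nat.
have [s [sw s1 rs]] := sqrt_unit w1; exists s; split=> //.
  by rewrite expnS exprM sw.
have := sqrt_unit_dist s1 rs; rewrite sw exprS; lra.
Qed.

(** Plays the part of exp(2 pi i / N). Iterated square roots of -1 approach 1 geometrically, and
    [w ^+ (2 ^ m) = -1] forces the order of [w] to be exactly [2 ^ m.+1]. *)
Lemma root_near1 e M : 0 < e -> exists N, exists w : C,
  [/\ (M <= N)%N, (1 < N)%N, N.-primitive_root w & cmod (w - 1) < e].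
Proof.
move=> e0; have e2 : 0 < e / 2 by lra.
have [||k Hk] := expr_lt _ _ e2 (r := 5 / 7); [lra|lra|].
pose m := maxn k M; have [w [wm w1 wd]] := root_tower m.
exists (2 ^ m.+1)%N, w; split.
- apply: leq_trans (leq_maxr k M) _; apply: ltnW; apply: leq_trans (ltn_expl m (leqnn 2)) _.
  by rewrite leq_exp2l.
- by rewrite -[1%N]/(2 ^ 0)%N ltn_exp2l.
- have wp : w ^+ (2 ^ m.+1) = 1 by rewrite expnSr exprM wm sqrrN expr1n.
  have [d dp dd] := prim_order_exists (expn_gt0 2 m.+1) wp.
  have /dvdn_pfactor[//|j jm dj] := dd.
  move: jm; rewrite leq_eqVlt => /predU1P[jm|jm]; first by rewrite -jm -dj.
  exfalso; have : w ^+ (2 ^ m) = 1.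
    by apply/eqP; rewrite -(prim_order_dvd dp) dj dvdn_exp2l.
  rewrite wm => /eqP; rewrite eq_sym -subr_eq0 opprK -[1 + 1]/(2%:R).
  by rewrite pnatr_eq0.
- by have := Hk m (leq_maxl _ _); lra.
Qed.

Lemma geo_sum0 N (x : C) : x ^+ N = 1 -> x != 1 -> \sum_(k < N) x ^+ k = 0.
Proof.
move=> xN x1; have /eqP := subrX1 x N; rewrite xN subrr eq_sym mulf_eq0 subr_eq0.
by rewrite (negbTE x1) => /eqP.
Qed.

Lemma conj_root (w : C) : cmod w = 1 -> w^* = w^-1.
Proof.
move=> w1; have w0 : w != 0 by rewrite -cmod_gt0 w1.
by apply: (mulfI w0); rewrite cmod_mulconj w1 expr1n rc1 divff.
Qed.

(** Orthogonality of the characters of the group of N-th roots of 1; [size p <= N] keeps distinct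
    exponents distinct modulo N. *)
Lemma poly_parseval p N w : N.-primitive_root w -> (size p <= N)%N -> (0 < N)%N ->
  \sum_(n < N) cmod p`_n ^+ 2 = N%:R^-1 * \sum_(k < N) cmod p.[w ^+ k] ^+ 2.
Proof.
move=> wN pN N0; apply: (@rc_inj R).
have w1 : cmod w = 1 by apply: cmod_root N0 _; exact: prim_expr_order.
have wn0 : w != 0 by rewrite -cmod_gt0 w1.
have Nn : (N%:R : C) != 0 by rewrite pnatr_eq0 -lt0n.
rewrite rcM rcV rc_nat !rc_sum; apply: (mulfI Nn); rewrite mulVKf//.
transitivity (\sum_(k < N) \sum_(n < N) \sum_(m < N) p`_n * (p`_m)^* * (w ^+ n / w ^+ m) ^+ k).
  rewrite exchange_big/= mulr_sumr; apply: eq_bigr => n _.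
  rewrite exchange_big/= (bigD1 n)//= [X in _ + X]big1 ?addr0; last first.
    move=> m mn; rewrite -mulr_sumr geo_sum0 ?mulr0//.
      by rewrite exprMn exprVn -!exprM ![(_ * N)%N]mulnC !exprM (prim_expr_order wN) !expr1n invr1 mulr1.
    rewrite -subr_eq0 -(mulr1 1) -[X in _ - X * _](divff (expf_neq0 m wn0)) mulr1 -mulrBl mulf_neq0//.
      by rewrite subr_eq0 (eq_prim_root_expr wN) !modn_small// eq_sym.
    by rewrite invr_neq0// expf_neq0.
  rewrite divff ?expf_neq0//.
  under eq_bigr do rewrite expr1n mulr1.
  by rewrite sumr_const card_ord cmod_mulconj mulr_natl.
apply: eq_bigr => k _; rewrite -cmod_mulconj (horner_coef_wide _ pN) rmorph_sum/= mulr_suml.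
apply: eq_bigr => n _; rewrite mulr_sumr; apply: eq_bigr => m _.
have -> : (p`_m * w ^+ k ^+ m)^* = (p`_m)^* * (w^-1 ^+ k) ^+ m.
  by rewrite rmorphM/= !rmorphXn/= (conj_root w1).
rewrite exprMn !exprVn -!exprM ![(_ * k)%N]mulnC.
by rewrite mulrACA.
Qed.

Lemma poly_l2_le p M : (forall z, cmod z = 1 -> cmod p.[z] <= M) ->
  forall n, \sum_(i < n) cmod p`_i ^+ 2 <= M ^+ 2.
Proof.
move=> H n; have [N [w [nN N1 wN _]]] := root_near1 (maxn n (size p)) (@ltr01 R).
have N0 : (0 < N)%N := ltnW N1.
have M0 : 0 <= M by have := H 1 (cmod1 _); have := cmod_ge0 p.[1]; lra.
move: nN; rewrite geq_max => /andP[nN pN].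
apply: (@le_trans _ _ (\sum_(i < N) cmod p`_i ^+ 2)).
  rewrite (big_ord_widen N (fun i => cmod p`_i ^+ 2) nN) [leRHS](bigID (fun i : 'I_N => (i < n)%N))/=.
  by rewrite lerDl sumr_ge0// => i _; rewrite sqr_ge0.
rewrite (poly_parseval wN pN N0) ler_pdivrMl ?ltr0n//.
rewrite -[N in N%:R * _]card_ord mulr_natl -sumr_const; apply: ler_sum => k _.
rewrite lerXn2r ?nnegrE ?cmod_ge0// H// cmodX (cmod_root N0) ?expr1n//.
exact: prim_expr_order.
Qed.

Definition discalg g := forall e, 0 < e -> exists p, forall z, cmod z <= 1 -> cmod (g z - p.[z]) <= e.

Lemma udiff_sum K N (f f' : 'I_N -> C -> C) : (forall i, udiff K (f i) (f' i)) ->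
  udiff K (fun z => \sum_i f i z) (fun z => \sum_i f' i z).
Proof.
move=> H; elim: (index_enum _) => [|i s IH].
  by apply: udiff_ext (udiff_cst K 0) => z _; rewrite big_nil.
by apply: udiff_ext (udiff_D (H i) IH) => z _; rewrite big_cons.
Qed.

(** The real unit interval inside the complex plane, so that [udiff] and [mean_value_le] apply to
    functions of a real parameter. *)
Definition seg : set C := [set z | exists t, [/\ 0 <= t, t <= 1 & z = rc t]].

Lemma convexC_seg : convexC seg.
Proof.
move=> _ _ t [a [a0 a1 ->]] [b [b0 b1 ->]] t0 t1.
exists (a + t * (b - a)); split; [nra|nra|by rewrite rcD rcM rcB].
Qed.

Lemma bdd_seg : bdd_on seg id.
Proof. by exists 1 => _ [t [t0 t1 ->]]; rewrite cmod_rc ger0_norm. Qed.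

(* Let [w] be a primitive [N]-th root of 1 near 1.  The average [F t] over [k] of
   [g (z + t (w^k - z)) w^k / (w^k - z)] has derivative the average of
   [g' (z + t (w^k - z)) w^k], which is small because the increments of [g] along
   the polygon [z + t (w^k - z)] add up to 0.  Hence [F 0] and [F 1] are close;
   multiplied by [1 - z^N] they are [g z] and the value at [z] of the polynomial
   interpolating [g] at the [N]-th roots of 1. *)
Lemma cauchy_poly g g' : udiff udisc g g' -> forall e, 0 < e -> exists p,
  forall z, cmod z < 1 -> cmod (g z - p.[z]) <= 2 * e.
Proof.
move=> [bg bg' ug] e e0; have [d d0 Hd] := ug _ e0.
have [N [w [_ N1 wN wd]]] := root_near1 0 d0.
have N0 : (0 < N)%N := ltnW N1.
have wNN := prim_expr_order wN.
have w1 : cmod w = 1 by apply: cmod_root N0 _.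
have wk1 k : cmod (w ^+ k) = 1 by rewrite cmodX w1 expr1n.
have wk0 k : w ^+ k != 0 by rewrite -cmod_gt0 wk1.
have Nn : (N%:R : C) != 0 by rewrite pnatr_eq0 -lt0n.
(* Discrete Fourier coefficients of [g]: the coefficients of its interpolating polynomial. *)
pose c n := N%:R^-1 * \sum_(k < N) g (w ^+ k) * (w ^+ k) ^- n.
exists (\poly_(n < N) c n) => z z1.
have wz k : w ^+ k - z != 0.
  by rewrite subr_eq0; apply/eqP => h; move: z1; rewrite -h wk1 ltxx.
have geo k : \sum_(n < N) (z / w ^+ k) ^+ n = (1 - z ^+ N) * (w ^+ k / (w ^+ k - z)).
  have h : z / w ^+ k - 1 = - ((w ^+ k - z) / w ^+ k).
    by rewrite mulrBl divff// opprB.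
  have h0 : z / w ^+ k - 1 != 0 by rewrite h oppr_eq0 mulf_neq0// invr_neq0.
  apply: (mulfI h0); rewrite -subrX1 exprMn exprVn -exprM mulnC exprM wNN expr1n invr1 mulr1.
  rewrite h; field; by rewrite wk0 wz.
have Qz : (\poly_(n < N) c n).[z] = (1 - z ^+ N) * (N%:R^-1 * \sum_(k < N) g (w ^+ k) * (w ^+ k / (w ^+ k - z))).
  rewrite horner_poly; under eq_bigr do rewrite /c -mulrA mulr_suml.
  rewrite -mulr_sumr exchange_big/= mulrCA; congr (_ * _).
  rewrite mulr_sumr; apply: eq_bigr => k _.
  rewrite mulrCA -geo mulr_sumr; apply: eq_bigr => n _.
  by rewrite exprMn exprVn -mulrA [X in g _ * X]mulrC.
(* The same interpolation formula for the constant [g z]: after expansion only the exponent 0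
   survives the sum over the roots. *)
have Gz : g z = (1 - z ^+ N) * (N%:R^-1 * \sum_(k < N) g z * (w ^+ k / (w ^+ k - z))).
  rewrite mulrCA mulr_sumr; under eq_bigr do rewrite mulrCA -geo.
  rewrite -mulr_sumr exchange_big/=.
  rewrite (bigD1 (Ordinal N0))//= [X in _ + X]big1 ?addr0; last first.
    move=> n n0; under eq_bigr do rewrite exprMn -exprVn -exprM mulnC exprM.
    rewrite -mulr_sumr geo_sum0 ?mulr0//.
      by rewrite -exprM mulnC exprM exprVn wNN invr1 expr1n.
    rewrite exprVn invr_eq1 -(prim_order_dvd wN) gtnNdvd//.
    by rewrite lt0n; apply: contraNneq n0 => h; apply/eqP/val_inj.
  under eq_bigr do rewrite expr0.
  by rewrite sumr_const card_ord mulrC mulfK.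
pose F t := N%:R^-1 * \sum_(k < N) (w ^+ k / (w ^+ k - z)) * g (z + t * (w ^+ k - z)).
pose F' t := N%:R^-1 * \sum_(k < N) (w ^+ k / (w ^+ k - z)) * (g' (z + t * (w ^+ k - z)) * (w ^+ k - z)).
have inD k t : seg t -> udisc (z + t * (w ^+ k - z)).
  move=> [s [s0 s1 ->]]; apply: (@convexC_disc 1) => //=; last by rewrite wk1.
  exact: ltW.
have uF : udiff seg F F'.
  apply: udiff_scale; apply: udiff_sum => k; apply: udiff_scale.
  apply: (udiff_comp (g := fun t => z + t * (w ^+ k - z)) (g' := fun=> w ^+ k - z) (And3 bg bg' ug)).
    apply: udiff_ext (udiff_D (udiff_cst seg z) (udiff_scale (w ^+ k - z) (udiff_id bdd_seg))) => t _.
      by rewrite (mulrC t).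
    by rewrite add0r mulr1.
  exact: inD.
have bF' t : seg t -> cmod (F' t) <= e.
  move=> st; have [s [s0 s1 ts]] := st.
  have F'E : F' t = N%:R^-1 * \sum_(k < N) g' (z + t * (w ^+ k - z)) * w ^+ k.
    congr (_ * _); apply: eq_bigr => k _; by field; rewrite wz.
  rewrite F'E cmodM cmodV cmod_nat ler_pdivrMl ?ltr0n//.
  (* The polygon argument divides by its side length [s * cmod (w - 1)], so the degenerate polygon
     is treated apart. *)
  have [s00|sn0] := eqVneq s 0.
    have t0 : t = 0 by rewrite ts s00 rc0.
    have -> : \sum_(k < N) g' (z + t * (w ^+ k - z)) * w ^+ k = g' z * \sum_(k < N) w ^+ k.
      by rewrite mulr_sumr; apply: eq_bigr => k _; rewrite t0 mul0r addr0.
    rewrite geo_sum0// ?mulr0 ?cmod0 ?mulr_ge0 ?ler0n// ?ltW//.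
    by rewrite (_ : (w == 1) = (w ^+ 1 == 1))// -(prim_order_dvd wN) gtnNdvd.
  have wn1 : w != 1.
    by rewrite (_ : (w == 1) = (w ^+ 1 == 1))// -(prim_order_dvd wN) gtnNdvd.
  pose p k := z + t * (w ^+ k - z).
  have pB k : p k.+1 - p k = t * (w - 1) * w ^+ k by rewrite /p exprS; ring.
  have npB k : cmod (p k.+1 - p k) = s * cmod (w - 1).
    by rewrite pB !cmodM wk1 mulr1 ts cmod_rc ger0_norm.
  have tw0 : 0 < s * cmod (w - 1).
    by apply: mulr_gt0; [rewrite lt_def sn0|rewrite cmod_gt0 subr_eq0].
  have tele : \sum_(k < N) (g (p k.+1) - g (p k)) = 0.
    rewrite -(big_mkord xpredT (fun k => g (p k.+1) - g (p k))) telescope_sumr//.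
    by rewrite /p wNN expr0 subrr.
  rewrite -(ler_pM2l tw0).
  have -> : s * cmod (w - 1) * cmod (\sum_(k < N) g' (p k) * w ^+ k) =
     cmod (\sum_(k < N) (g (p k.+1) - g (p k) - g' (p k) * (p k.+1 - p k))).
    rewrite sumrB tele sub0r cmodN -[s]ger0_norm// -cmod_rc -ts -!cmodM mulr_sumr.
    by congr cmod; apply: eq_bigr => k _; rewrite pB; ring.
  apply: le_trans (cmod_sum _ _ _) _.
  apply: (@le_trans _ _ (\sum_(k < N) e * (s * cmod (w - 1)))).
    apply: ler_sum => k _; rewrite -(npB k); apply: Hd; [exact: inD|exact: inD|].
    by rewrite npB; apply: le_lt_trans wd; rewrite ler_piMl ?cmod_ge0.
  by rewrite sumr_const card_ord -mulr_natl le_eqVlt; apply/orP; left; apply/eqP; ring.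
have sg0 : seg 0 by exists 0; rewrite rc0 lexx ler01.
have sg1 : seg 1 by exists 1; rewrite rc1 lexx ler01.
have := mean_value_le convexC_seg uF bF' sg0 sg1.
rewrite subr0 cmod1 mulr1 => h.
have F1 : F 1 = N%:R^-1 * \sum_(k < N) g (w ^+ k) * (w ^+ k / (w ^+ k - z)).
  by congr (_ * _); apply: eq_bigr => k _; rewrite mulrC mul1r [z + _]addrC subrK.
have F0 : F 0 = N%:R^-1 * \sum_(k < N) g z * (w ^+ k / (w ^+ k - z)).
  by congr (_ * _); apply: eq_bigr => k _; rewrite mulrC mul0r addr0.
rewrite cmodC Qz Gz -F0 -F1 -mulrBr cmodM.
apply: ler_pM; rewrite ?cmod_ge0//.
apply: le_trans (cmodB _ _) _; rewrite cmod1 cmodX.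
have : cmod z ^+ N <= 1 by rewrite exprn_ile1 ?cmod_ge0// ltW.
lra.
Qed.

End DiscAlgebra.


(** * Power series and the disc algebra *)

Section PowerSeries.
Set Implicit Arguments.
Unset Strict Implicit.
Variable R : realType.
Local Notation C := (Cplx R).
Implicit Types (z w : C) (r e : R) (f g : C -> C) (p q : {poly C}) (a b : nat -> C).

Lemma udiff_poly p : exists g', udiff (@udisc R) (fun z => p.[z]) g'.
Proof.
have uid : udiff (@udisc R) id (fun=> 1) by apply: udiff_id; exists 1.
have /choice[g' Hg] (i : 'I_(size p)) : exists g', udiff (@udisc R) (fun z => z ^+ i) g'.
  exact: udiff_X uid.
exists (fun z => \sum_(i < size p) p`_i * g' i z).
apply: udiff_ext (udiff_sum (fun i : 'I_(size p) => udiff_scale p`_i (Hg i))) => // z _.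
by rewrite horner_coef.
Qed.

(** Boundary points are approached along their radius by [(1 - t) z]. *)
Lemma cont_boundary f M : cont_onC (@udisc R) f -> (forall z, cmod z < 1 -> cmod (f z) <= M) ->
  forall z, cmod z <= 1 -> cmod (f z) <= M.
Proof.
move=> cf H z z1; apply/ler_addgt0Pr => e e0.
have [d d0 Hd] := cf z z1 e e0.
pose t := Num.min (1 / 2) (d / 2) : R.
have t0 : 0 < t by rewrite lt_min; apply/andP; split; lra.
have t1 : t <= 1 / 2 by rewrite ge_min lexx.
have td : t <= d / 2 by rewrite ge_min lexx orbT.
have w1 : cmod (rc (1 - t) * z) < 1.
  by rewrite cmodM cmod_rc ger0_norm; [have := cmod_ge0 z; nra|lra].
have wz : cmod (rc (1 - t) * z - z) < d.
  rewrite (_ : _ - z = - (rc t * z)); last by rewrite rcB rc1; ring.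
  by rewrite cmodN cmodM cmod_rc ger0_norm; [have := cmod_ge0 z; nra|lra].
have := Hd _ (ltW w1) wz; have := H _ w1.
have := cmod_triB (f z) (f (rc (1 - t) * z)); rewrite (cmodC (f z)); lra.
Qed.

Lemma udiff_discalg g g' : udiff (@udisc R) g g' -> discalg g.
Proof.
move=> ug e e0; have e2 : 0 < e / 2 by lra.
have [p Hp] := cauchy_poly ug e2.
exists p; apply: cont_boundary.
  have [p' up] := udiff_poly p; exact: udiff_contC (udiff_B ug up).
by move=> z /Hp; lra.
Qed.

Lemma discalg_lim (u : nat -> C -> C) g : (forall n, discalg (u n)) -> unif_lim (@udisc R) u g -> discalg g.
Proof.
move=> H ul e e0; have e2 : 0 < e / 2 by lra.
have [N /(_ N _ (leqnn _)) HN] := ul _ e2; have [p Hp] := H N _ e2.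
exists p => z z1; have := HN z z1; have := Hp z z1.
have := cmod_tri (u N z) (g z) p.[z]; rewrite (cmodC (g z) (u N z)); lra.
Qed.

Lemma discalg_lin (c : C) f g : discalg f -> discalg g -> discalg (fun z => c * f z + g z).
Proof.
move=> H H' e e0; have k0 : 0 < cmod c + 1 by have := cmod_ge0 c; lra.
have e2 : 0 < e / 2 / (cmod c + 1) by rewrite !divr_gt0.
have e3 : 0 < e / 2 by lra.
have [p Hp] := H _ e2; have [q Hq] := H' _ e3.
exists (c *: p + q) => z z1; rewrite hornerD hornerZ.
rewrite (_ : _ - _ = c * (f z - p.[z]) + (g z - q.[z])); last by ring.
apply: le_trans (cmodD _ _) _; rewrite cmodM.
have := Hq z z1; have := Hp z z1; rewrite ler_pdivlMr//.
have := cmod_ge0 (f z - p.[z]); nra.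
Qed.

Lemma discalg_ext f g : (forall z, cmod z <= 1 -> f z = g z) -> discalg f -> discalg g.
Proof. by move=> fg H e /H[p Hp]; exists p => z z1; rewrite -fg// Hp. Qed.

Definition psum a n z := \sum_(i < n) a i * z ^+ i.

Definition pseries a f := forall z, cmod z < 1 -> limC (fun n => psum a n z) (f z).

Lemma geo_tail r n m : 0 <= r -> r < 1 -> (n <= m)%N -> \sum_(n <= i < m) r ^+ i <= r ^+ n / (1 - r).
Proof.
move=> r0 r1 cmod; rewrite ler_pdivlMr; last by lra.
suff -> : (\sum_(n <= i < m) r ^+ i) * (1 - r) = r ^+ n - r ^+ m.
  by have := exprn_ge0 m r0; lra.
rewrite mulr_suml (eq_bigr (fun i => - (r ^+ i.+1 - r ^+ i))); last first.
  by move=> i _; rewrite exprS; ring.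
by rewrite sumrN telescope_sumr// opprB.
Qed.

Lemma psumB a n m z : (n <= m)%N -> psum a m z - psum a n z = \sum_(n <= i < m) a i * z ^+ i.
Proof.
move=> cmod; rewrite /psum -(big_mkord xpredT (fun i => a i * z ^+ i)).
rewrite -(big_mkord xpredT (fun i => a i * z ^+ i)) (big_cat_nat (leq0n n) cmod)/=.
by rewrite addrAC subrr add0r.
Qed.

Lemma psum_tail a n m z A r : (forall i, cmod (a i) <= A) -> cmod z <= r -> r < 1 -> (n <= m)%N ->
  cmod (psum a m z - psum a n z) <= A * (r ^+ n / (1 - r)).
Proof.
move=> aA zr r1 cmod; have r0 : 0 <= r by apply: le_trans zr; exact: cmod_ge0.
have A0 : 0 <= A by apply: le_trans (aA 0%N); exact: cmod_ge0.
rewrite psumB//; apply: le_trans (cmod_sum _ _ _) _.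
apply: (@le_trans _ _ (A * \sum_(n <= i < m) r ^+ i)); last first.
  by apply: ler_wpM2l => //; exact: geo_tail.
rewrite mulr_sumr; apply: ler_sum => i _; rewrite cmodM cmodX.
by apply: ler_pM; rewrite ?exprn_ge0 ?cmod_ge0// lerXn2r ?nnegrE ?cmod_ge0.
Qed.

Lemma psum_cvg a z A : (forall i, cmod (a i) <= A) -> cmod z < 1 -> exists l, limC (fun n => psum a n z) l.
Proof.
move=> aA z1; apply: cauchyC => e e0.
have A0 : 0 <= A by apply: le_trans (aA 0%N); exact: cmod_ge0.
have k0 : 0 < (1 - cmod z) by lra.
have e1 : 0 < e / (A + 1) * (1 - cmod z) by rewrite mulr_gt0// divr_gt0//; lra.
have [N HN] := expr_lt (cmod_ge0 z) z1 e1.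
have key n m : (N <= n)%N -> (n <= m)%N -> cmod (psum a m z - psum a n z) < e.
  move=> Nn cmod'; apply: le_lt_trans (psum_tail aA (lexx _) z1 cmod') _.
  have := HN n Nn; rewrite -ltr_pdivrMr// ltr_pdivlMr; last by lra.
  have : 0 <= cmod z ^+ n / (1 - cmod z) by rewrite divr_ge0 ?exprn_ge0 ?cmod_ge0// ltW.
  set t := _ / _ => t0; nra.
exists N => m n Nm Nn; have [mn|/ltnW mn] := leqP m n; last exact: key.
by rewrite cmodC; exact: key.
Qed.

Lemma pseries_tail a f n z A r : (forall i, cmod (a i) <= A) -> pseries a f -> cmod z <= r -> r < 1 ->
  cmod (f z - psum a n z) <= A * (r ^+ n / (1 - r)).
Proof.
move=> aA af zr r1.
apply: (@limC_cmod_le _ (fun m => psum a m z - psum a n z) _ _ n).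
  by move=> m cmod'; exact: psum_tail.
by apply: limC_B; [apply: af; lra|exact: limC_cst].
Qed.

(** Identity theorem at 0. By strong induction the first possibly nonzero term [a n * z ^+ n] equals
    minus the rest of the series, which is of order [n + 1] in [z]. *)
Lemma psum_eq0 a (A B : R) : (forall i, cmod (a i) <= A * B ^+ i) -> 0 <= B ->
  (forall e, 0 < e -> exists z, [/\ 0 < cmod z, cmod z < e & limC (fun n => psum a n z) 0]) ->
  forall n, a n = 0.
Proof.
move=> aAB B0 H.
have A0 : 0 <= A by have := aAB 0%N; rewrite expr0 mulr1; apply: le_trans; exact: cmod_ge0.
move=> n; elim/ltn_ind: n => n IH.
apply/eqP; rewrite -cmod_eq0 eq_le cmod_ge0 andbT; apply/ler_addgt0Pr => e e0; rewrite add0r.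
(* The 2 bounds [1 / (1 - B |z|)] once [B |z| <= 1 / 2], which the first entry of [e'] ensures; the
   second entry gives [D |z| < e]. The added 1 keeps [D] positive. *)
pose D := 2 * (A * B ^+ n.+1) + 1.
have D1 : 0 < D by have := exprn_ge0 n.+1 B0; rewrite /D; nra.
pose e' := Num.min (1 / 2 / (B + 1)) (e / D).
have e'0 : 0 < e' by rewrite lt_min !divr_gt0//; lra.
have [z [z0 ze lz]] := H _ e'0.
move: ze; rewrite lt_min => /andP[].
rewrite ltr_pdivlMr ?ltr_wpDl// => zB; rewrite ltr_pdivlMr// => ze.
have q1 : B * cmod z <= 1 / 2 by have := cmod_ge0 z; nra.
have q0 : 0 <= B * cmod z by rewrite mulr_ge0 ?cmod_ge0.
have zn0 : 0 < cmod z ^+ n by rewrite exprn_gt0.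
suff h : cmod (a n) * cmod z ^+ n <= (D - 1) * cmod z * cmod z ^+ n.
  by move: h; rewrite ler_pM2r//; nra.
rewrite -cmodX -cmodM -cmodN -sub0r.
apply: (@limC_cmod_le _ (fun m => psum a m z - a n * z ^+ n) _ _ n.+1); last first.
  by apply: limC_B => //; exact: limC_cst.
move=> m cmod'.
have -> : a n * z ^+ n = psum a n.+1 z.
  by rewrite /psum big_ord_recr/= big1 ?add0r// => i _; rewrite IH ?mul0r.
rewrite psumB//; apply: le_trans (cmod_sum _ _ _) _.
apply: (@le_trans _ _ (A * \sum_(n.+1 <= i < m) (B * cmod z) ^+ i)).
  rewrite mulr_sumr; apply: ler_sum => i _; rewrite cmodM cmodX exprMn mulrA.
  by apply: ler_wpM2r; rewrite ?exprn_ge0 ?cmod_ge0.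
have q11 : B * cmod z < 1 by lra.
apply: le_trans (ler_wpM2l A0 (geo_tail q0 q11 cmod')) _.
rewrite mulrA ler_pdivrMr; last by lra.
rewrite exprMn [cmod z ^+ n.+1]exprS cmodX /D.
set t := B ^+ n.+1; set u := cmod z ^+ n; set v := cmod z.
have t0 : 0 <= t by rewrite exprn_ge0.
have -> : (2 * (A * t) + 1 - 1) * v * u * (1 - B * cmod z) = A * (t * (v * u)) * (2 * (1 - B * cmod z)) by ring.
by apply: ler_peMr; [rewrite !mulr_ge0// ?cmod_ge0// ltW|lra].
Qed.

End PowerSeries.


(** * The Hardy space *)

Section HardySpace.
Set Implicit Arguments.
Unset Strict Implicit.
Variable R : realType.
Local Notation C := (Cplx R).
Implicit Types (z w : C) (r e : R) (g h : C -> C) (p q : {poly C}) (a b : nat -> C) (f : H2 R).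

Lemma limC_conj (u : nat -> C) l : limC u l -> limC (fun n => (u n)^*) l^*.
Proof. by move=> H e /H[N HN]; exists N => n /HN; rewrite -rmorphB cmod_conj. Qed.

(** Writing squared moduli as products with conjugates turns the bound into a complex limit; it
    transfers square-sum bounds from approximating polynomials to limit coefficients. *)
Lemma limC_l2 n (F : nat -> nat -> C) (l : nat -> C) (B : R) N :
  (forall i, limC (F i) (l i)) ->
  (forall m, (N <= m)%N -> \sum_(i < n) cmod (F i m) ^+ 2 <= B) ->
  \sum_(i < n) cmod (l i) ^+ 2 <= B.
Proof.
move=> Fl FB.
have sq (v : nat -> C) : cmod (\sum_(i < n) v i * (v i)^*) = \sum_(i < n) cmod (v i) ^+ 2.
  under eq_bigr do rewrite cmod_mulconj.
  by rewrite -rc_sum cmod_rc ger0_norm// sumr_ge0// => i _; exact: sqr_ge0.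
rewrite -sq; apply: (@limC_cmod_le _ (fun m => \sum_(i < n) F i m * (F i m)^*) _ _ N).
  by move=> m /FB; rewrite (sq (F ^~ m)).
apply: limC_sum => i; apply: limC_M; first exact: Fl.
exact: limC_conj.
Qed.

Lemma cmod_le_sum2 a (M : R) n : 0 <= M -> (forall n, \sum_(i < n) cmod (a i) ^+ 2 <= M ^+ 2) ->
  cmod (a n) <= M.
Proof.
move=> M0 /(_ n.+1); rewrite big_ord_recr/= => h.
rewrite -ler_sqr ?nnegrE ?cmod_ge0//; apply: le_trans h.
by rewrite lerDr sumr_ge0// => i _; exact: sqr_ge0.
Qed.

(** By Parseval applied to differences, the coefficients of uniform polynomial approximations are
    Cauchy, uniformly in the index. Their limits are the Taylor coefficients, and a bound on the
    circle alone controls their square sum. *)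
Lemma discalg_coef g (M : R) : discalg g -> (forall z, cmod z = 1 -> cmod (g z) <= M) ->
  exists a, (forall n, \sum_(i < n) cmod (a i) ^+ 2 <= M ^+ 2) /\ pseries a g.
Proof.
move=> dg gM.
have M0 : 0 <= M by have := gM 1 (cmod1 _); have := cmod_ge0 (g 1); lra.
have /choice[p Hp] (k : nat) : exists p, forall z, cmod z <= 1 -> cmod (g z - p.[z]) <= k.+1%:R^-1.
  by apply: dg; rewrite invr_gt0 ltr0n.
have close k m (e : R) : k.+1%:R^-1 <= e -> m.+1%:R^-1 <= e -> forall n,
    \sum_(i < n) cmod ((p k)`_i - (p m)`_i) ^+ 2 <= (2 * e) ^+ 2.
  move=> ke me n; under eq_bigr do rewrite -coefB.
  apply: poly_l2_le => z z1; rewrite hornerD hornerN.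
  have := Hp k z; have := Hp m z; rewrite z1 lexx => /(_ isT) h1 /(_ isT) h2.
  have {}h1 := le_trans h1 me; have {}h2 := le_trans h2 ke.
  have := cmod_tri (g z) (p k).[z] (p m).[z]; rewrite (cmodC (p k).[z] (g z)); lra.
have cc k m (e : R) n : k.+1%:R^-1 <= e -> m.+1%:R^-1 <= e -> cmod ((p k)`_n - (p m)`_n) <= 2 * e.
  move=> ke me; have e0 : 0 <= e by apply: le_trans ke; rewrite invr_ge0 ler0n.
  apply: (@cmod_le_sum2 (fun n => (p k)`_n - (p m)`_n)); first lra.
  exact: close.
have /choice[a Ha] (n : nat) : exists l, limC (fun k => (p k)`_n) l.
  apply: cauchyC => e e0; have e4 : 0 < e / 4 by lra.
  have [N HN] := invS_lt e4; exists N => k m /HN/ltW h1 /HN/ltW h2.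
  by have := cc k m _ n h1 h2; lra.
exists a; split.
  move=> n; apply/ler_addgt0Pr => e e0.
  (* Chosen so that [(M + d) ^+ 2 <= M ^+ 2 + d * (2 * M + 1) <= M ^+ 2 + e]. *)
  pose d := Num.min 1 (e / (2 * M + 1)).
  have d0 : 0 < d by rewrite lt_min ltr01 divr_gt0//; lra.
  have d1 : d <= 1 by rewrite ge_min lexx.
  have de : d * (2 * M + 1) <= e by rewrite -ler_pdivlMr ?ge_min ?lexx ?orbT//; lra.
  have [N HN] := invS_lt d0.
  apply: (@limC_l2 _ (fun i k => (p k)`_i) _ _ N) => // k /HN/ltW kd.
  apply: (@le_trans _ _ ((M + d) ^+ 2)).
    apply: poly_l2_le => z z1.
    have := Hp k z; rewrite z1 lexx => /(_ isT) h1; have {}h1 := le_trans h1 kd.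
    have := gM z z1.
    have := cmod_triB (p k).[z] (g z); rewrite (cmodC (p k).[z] (g z)); lra.
  nra.
move=> z z1 e e0; have k0 : 0 < 1 - cmod z by lra.
have e1 : 0 < e * (1 - cmod z) / 8 by rewrite divr_gt0// mulr_gt0.
have e2 : 0 < e / 4 by lra.
(* The first entry makes the geometric sum [2 * d / (1 - cmod z)] of coefficient errors at most
   [e / 4], the second bounds the error of [p N] at [z]. *)
pose d := Num.min (e * (1 - cmod z) / 8) (e / 4).
have d0 : 0 < d by rewrite lt_min e1.
have [N /(_ N (leqnn _))/ltW HN] := invS_lt d0.
have an i : cmod (a i - (p N)`_i) <= 2 * d.
  apply: (@limC_cmod_le _ (fun k => (p k)`_i - (p N)`_i) _ _ N).
    move=> k Nk; apply: cc => //; apply: le_trans HN.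
    by rewrite lef_pV2 ?posrE ?ltr0n// ler_nat.
  by apply: limC_B => //; exact: limC_cst.
exists (size (p N)) => n nN.
have -> : psum a n z - g z = (psum (fun i => a i - (p N)`_i) n z - psum (fun i => a i - (p N)`_i) 0 z) - (g z - (p N).[z]).
  rewrite /psum [X in _ - X - _]big_ord0 subr0 (horner_coef_wide _ nN).
  rewrite opprB addrA -[in RHS]big_split/=; congr (_ - _).
  by apply: eq_bigr => i _; ring.
apply: le_lt_trans (cmodB _ _) _.
have h1 := psum_tail an (lexx _) z1 (leq0n n); rewrite expr0 in h1.
have h2 := le_trans (Hp N z (ltW z1)) HN.
have h3 : 2 * d * (1 / (1 - cmod z)) <= e / 4.
  rewrite mul1r ler_pdivrMr//.
  have : d <= e * (1 - cmod z) / 8 by rewrite ge_min lexx.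
  lra.
have h4 : d <= e / 4 by rewrite ge_min lexx orbT.
lra.
Qed.

Lemma max_principle g g' (M : R) : udiff (@udisc R) g g' -> (forall z, cmod z = 1 -> cmod (g z) <= M) ->
  forall z, cmod z <= 1 -> cmod (g z) <= M.
Proof.
move=> ug gM; apply: cont_boundary (udiff_contC ug) _ => z z1.
have M0 : 0 <= M by have := gM 1 (cmod1 _); have := cmod_ge0 (g 1); lra.
have k0 : 0 < 1 - cmod z by lra.
(* Applying the crude bound [1 / (1 - |z|)] to all the powers of [g] removes the
   constant. *)
have key k : cmod (g z) ^+ k <= M ^+ k / (1 - cmod z).
  have [h' uh] := udiff_X k ug.
  have [|a [a2 psa]] := @discalg_coef _ (M ^+ k) (udiff_discalg uh).
    by move=> x x1; rewrite cmodX lerXn2r ?nnegrE ?cmod_ge0// gM.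
  have ab := cmod_le_sum2 _ (exprn_ge0 k M0) a2.
  rewrite -cmodX.
  have := pseries_tail 0 ab psa (lexx _) z1.
  by rewrite /psum big_ord0 subr0 expr0 mul1r.
have [M00|Mn0] := eqVneq M 0.
  have := key 1%N; rewrite !expr1 M00 mul0r; exact.
have Mp : 0 < M by rewrite lt_def Mn0.
rewrite leNgt; apply/negP => gz.
have q0 : 0 <= M / cmod (g z) by rewrite divr_ge0// cmod_ge0.
have gp : 0 < cmod (g z) by apply: lt_trans gz.
have q1 : M / cmod (g z) < 1 by rewrite ltr_pdivrMr// mul1r.
have [N /(_ N (leqnn _)) HN] := expr_lt q0 q1 k0.
have := key N; rewrite ler_pdivlMr// leNgt => /negP; apply.
by move: HN; rewrite expr_div_n ltr_pdivrMr ?exprn_gt0// mulrC.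
Qed.

Lemma seriesE (V : zmodType) (u : nat -> V) n : series u n = \sum_(i < n) u i.
Proof. by rewrite /series/= big_mkord. Qed.

Lemma pseries_power_series a g : pseries a g <-> power_series_on_disc g a.
Proof.
have E z : series (fun n => a n * z ^+ n) = (fun n => psum a n z).
  by apply/funext => n; rewrite seriesE.
split=> H z; first by move=> /odiscE/H/limC_cvg; rewrite E.
by move=> /odiscE/H; rewrite E => /limC_cvg.
Qed.

Lemma sq_summ_bdd a : square_summable a ->
  forall n, \sum_(i < n) cmod (a i) ^+ 2 <= limn (series (fun n => cmod (a n) ^+ 2)).
Proof.
move=> sa n; rewrite -(seriesE (fun i => cmod (a i) ^+ 2)).
apply: nondecreasing_cvgn_le => //; apply: nondecreasing_series => i _ _; exact: sqr_ge0.
Qed.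

Lemma bdd_sq_summ a (M : R) : (forall n, \sum_(i < n) cmod (a i) ^+ 2 <= M) -> square_summable a.
Proof.
move=> H; apply: nondecreasing_is_cvgn.
  by apply: nondecreasing_series => i _ _; exact: sqr_ge0.
by exists M => _ [n _ <-]; rewrite seriesE.
Qed.

(* Sealed by [Qed] to keep unification from unfolding [get]. *)
Fact coef_sig : {c : H2 R -> nat -> C | forall f, c f = H2_coef f}.
Proof. by exists (@H2_coef R). Qed.

Definition coef f := sval coef_sig f.

Lemma H2_coefE f : H2_coef f = coef f. Proof. by rewrite /coef (svalP coef_sig). Qed.

Lemma coefP f : square_summable (coef f) /\ pseries (coef f) f.
Proof.
have [_ [a sa fa]] : (forall z, ~ odisc z -> f z = 0) /\
    exists2 a, square_summable a & power_series_on_disc f a.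
  by case: f => f fH; apply/asboolP.
have : [set a | square_summable a /\ power_series_on_disc f a] (H2_coef f).
  by apply: getPex; exists a.
by rewrite H2_coefE; case=> h1 h2; split=> //; apply/pseries_power_series.
Qed.

Lemma H2_out f z : ~ cmod z < 1 -> f z = 0.
Proof.
have [h _] : (forall z, ~ odisc z -> f z = 0) /\
    exists2 a, square_summable a & power_series_on_disc f a.
  by case: f => f fH; apply/asboolP.
by move=> z1; apply: h => /odiscE.
Qed.

Lemma H2_ext (f1 f2 : H2 R) : (forall z, cmod z < 1 -> f1 z = f2 z) -> f1 = f2.
Proof.
move=> H; apply/val_inj/funext => z /=.
by have [/H//|h] := pselect (cmod z < 1); rewrite !H2_out.
Qed.

Lemma H2D (f1 f2 : H2 R) z : (f1 + f2) z = f1 z + f2 z. Proof. by []. Qed.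
Lemma H2Z (c : C) f z : (c *: f) z = c * f z. Proof. by []. Qed.
Lemma H2N f z : (- f) z = - f z. Proof. by []. Qed.
Lemma H20 z : (0 : H2 R) z = 0. Proof. by []. Qed.

Fact hnorm_sig : {h : H2 R -> R | forall f, 0 <= h f /\
  h f ^+ 2 = limn (series (fun n => cmod (coef f n) ^+ 2))}.
Proof.
exists (fun f => Num.sqrt (limn (series (fun n => cmod (coef f n) ^+ 2)))) => f.
rewrite sqrtr_ge0 sqr_sqrtr//; apply: le_trans (sq_summ_bdd (proj1 (coefP f)) 0).
by rewrite big_ord0.
Qed.

Definition hnorm f : R := sval hnorm_sig f.

Lemma hnorm_ge0 f : 0 <= hnorm f. Proof. by have [] := svalP hnorm_sig f. Qed.

Lemma hnorm_sq f : hnorm f ^+ 2 = limn (series (fun n => cmod (coef f n) ^+ 2)).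
Proof. by have [] := svalP hnorm_sig f. Qed.

Lemma sum_le_hnorm f n : \sum_(i < n) cmod (coef f i) ^+ 2 <= hnorm f ^+ 2.
Proof. by rewrite hnorm_sq; apply: sq_summ_bdd; have [] := coefP f. Qed.

Lemma coef_le_hnorm f n : cmod (coef f n) <= hnorm f.
Proof. by apply: cmod_le_sum2; [exact: hnorm_ge0|exact: sum_le_hnorm]. Qed.

Lemma hnorm_le f (M : R) : 0 <= M -> (forall n, \sum_(i < n) cmod (coef f i) ^+ 2 <= M ^+ 2) -> hnorm f <= M.
Proof.
move=> M0 H; rewrite -ler_sqr ?nnegrE ?hnorm_ge0// hnorm_sq.
apply: limr_le; first by have [] := coefP f.
by apply: nearW => n; rewrite seriesE.
Qed.

Lemma pseries_unique a b g (A : R) : (forall i, cmod (a i) <= A) -> (forall i, cmod (b i) <= A) ->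
  pseries a g -> pseries b g -> a = b.
Proof.
move=> aA bA pa pb; apply/funext => n; apply/eqP; rewrite -subr_eq0; apply/eqP.
apply: (@psum_eq0 R (fun n => a n - b n) (A + A) 1) => //.
  by move=> i; rewrite expr1n mulr1; apply: le_trans (cmodB _ _) _; exact: lerD.
move=> e e0; pose t := Num.min (1 / 2) (e / 2) : R.
have t0 : 0 < t by rewrite lt_min; apply/andP; split; lra.
have t1 : t <= 1 / 2 by rewrite ge_min lexx.
have te : t <= e / 2 by rewrite ge_min lexx orbT.
have nt : cmod (rc t) = t by rewrite cmod_rc ger0_norm// ltW.
exists (rc t); rewrite nt; split; [by []|lra|].
have z1 : cmod (rc t) < 1 by rewrite nt; lra.
have := limC_B (pa _ z1) (pb _ z1); rewrite subrr.
congr limC; apply/funext => m; rewrite /psum -sumrB.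
by apply: eq_bigr => i _; ring.
Qed.

Lemma coef_unique f a (M : R) : 0 <= M -> (forall n, \sum_(i < n) cmod (a i) ^+ 2 <= M ^+ 2) ->
  pseries a f -> coef f = a.
Proof.
move=> M0 aM pa.
apply: (@pseries_unique _ _ f (M + hnorm f)) => //.
- by move=> i; have := coef_le_hnorm f i; lra.
- by move=> i; have := cmod_le_sum2 i M0 aM; have := hnorm_ge0 f; lra.
- by have [] := coefP f.
Qed.

Lemma coef_lin (c : C) (f1 f2 f3 : H2 R) : (forall z, cmod z < 1 -> f3 z = c * f1 z + f2 z) ->
  forall n, coef f3 n = c * coef f1 n + coef f2 n.
Proof.
move=> H n; pose A := cmod c * hnorm f1 + hnorm f2 + hnorm f3.
have p1 : 0 <= cmod c * hnorm f1 by rewrite mulr_ge0 ?cmod_ge0 ?hnorm_ge0.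
have p2 := hnorm_ge0 f2; have p3 := hnorm_ge0 f3.
rewrite (_ : coef f3 = fun n => c * coef f1 n + coef f2 n)//.
apply: (@pseries_unique _ _ f3 A).
- move=> i; apply: le_trans (coef_le_hnorm f3 i) _; rewrite /A lerDr.
  by apply: addr_ge0; [exact: p1|exact: p2].
- move=> i; apply: le_trans (cmodD _ _) _; rewrite cmodM /A -[leLHS]addr0.
  apply: lerD; last exact: p3.
  apply: lerD; last exact: coef_le_hnorm.
  by apply: ler_wpM2l; [exact: cmod_ge0|exact: coef_le_hnorm].
- by have [] := coefP f3.
move=> z z1; rewrite H//.
have := limC_D (limC_M (limC_cst c) (proj2 (coefP f1) z z1)) (proj2 (coefP f2) z z1).
congr limC; apply/funext => m; rewrite /psum mulr_sumr -big_split/=.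
by apply: eq_bigr => i _; ring.
Qed.

Lemma coefH2D (c : C) (f1 f2 : H2 R) n : coef (c *: f1 + f2) n = c * coef f1 n + coef f2 n.
Proof. by apply: coef_lin. Qed.

Lemma H2_coef0 f : (forall n, coef f n = 0) -> f = 0.
Proof.
move=> H; apply: H2_ext => z z1; rewrite H20.
apply: (@limC_uniq _ (fun n => psum (coef f) n z)); first exact: (proj2 (coefP f)).
rewrite (_ : (fun n => _) = fun=> 0); first exact: limC_cst.
by apply/funext => n; rewrite /psum big1// => i _; rewrite H mul0r.
Qed.

Lemma toH2_exists g : discalg g -> exists f, forall z, cmod z < 1 -> f z = g z.
Proof.
move=> dg.
have [p Hp] := dg 1 ltr01.
have [M HM] : bdd_on (@udisc R) (fun z => p.[z]) by have [g' []] := udiff_poly p.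
have gM z : cmod z = 1 -> cmod (g z) <= M + 1.
  move=> z1; have zz : cmod z <= 1 by rewrite z1.
  have := Hp z zz; have := HM z zz; have := cmod_triB (g z) p.[z]; lra.
have [a [a2 pa]] := discalg_coef dg gM.
have fH : (fun z => if cmod z < 1 then g z else 0) \in hardy (R := R).
  apply/asboolP; split; first by move=> z; case: ifP => // h []; apply/odiscE.
  exists a; first exact: bdd_sq_summ a2.
  by apply/pseries_power_series => z z1; rewrite z1; exact: pa.
by exists (MkH2 fH) => z z1 /=; rewrite z1.
Qed.

(** Total, with value 0 when no element of [H2] agrees with [g] in the open disc; this is why
    [discalg g] accompanies its uses. *)
Definition toH2 g : H2 R := xget (0 : H2 R) [set f : H2 R | forall z, cmod z < 1 -> f z = g z].

Lemma toH2E g z : discalg g -> cmod z < 1 -> toH2 g z = g z.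
Proof.
move=> /toH2_exists[f Hf] z1.
have : [set f : H2 R | forall z, cmod z < 1 -> f z = g z] (toH2 g) by apply: xgetPex; exists f.
by apply.
Qed.

Lemma toH2_unique g f : discalg g -> (forall z, cmod z < 1 -> f z = g z) -> f = toH2 g.
Proof. by move=> dg H; apply: H2_ext => z z1; rewrite toH2E// H. Qed.

Lemma hnorm_toH2 g (M : R) : discalg g -> (forall z, cmod z = 1 -> cmod (g z) <= M) -> hnorm (toH2 g) <= M.
Proof.
move=> dg gM.
have M0 : 0 <= M by have := gM 1 (cmod1 _); have := cmod_ge0 (g 1); lra.
have [a [a2 pa]] := discalg_coef dg gM.
apply: hnorm_le => // n; rewrite (coef_unique M0 a2)//.
by move=> z z1; rewrite toH2E//; exact: pa.
Qed.

Lemma hnorm_sub_le f1 f2 g (M : R) : discalg g -> (forall z, cmod z < 1 -> f1 z - f2 z = g z) ->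
  (forall z, cmod z = 1 -> cmod (g z) <= M) -> hnorm (f1 - f2) <= M.
Proof.
move=> dg H gM; rewrite (@toH2_unique g (f1 - f2))//.
exact: hnorm_toH2.
Qed.

End HardySpace.


(** * Inner product and subordination *)

Section HardyDot.
Set Implicit Arguments.
Unset Strict Implicit.
Variable R : realType.
Local Notation C := (Cplx R).
Implicit Types (z w : C) (r e : R) (f g : H2 R) (p q : {poly C}) (a b : nat -> C).

Lemma abs_cvg a (B : R) : (forall n, \sum_(i < n) cmod (a i) <= B) ->
  exists l, limC (fun n => \sum_(i < n) a i) l.
Proof.
move=> aB; pose S n : R := \sum_(i < n) cmod (a i).
have Sincr n m : (n <= m)%N -> S m = S n + \sum_(n <= i < m) cmod (a i).
  move=> cmod'; rewrite /S -!(big_mkord xpredT (fun i => cmod (a i))).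
  by rewrite (big_cat_nat (leq0n n) cmod').
have Smono n m : (n <= m)%N -> S n <= S m.
  by move=> /Sincr ->; rewrite lerDl sumr_ge0// => i _; exact: cmod_ge0.
pose s := sup (range S).
have hs : has_sup (range S) by split; [exists (S 0%N), 0%N|exists B => _ [n _ <-]; exact: aB].
apply: cauchyC => e e0; have e2 : 0 < e / 2 by lra.
have [_ [N _ <-] HN] := sup_adherent e2 hs.
have key m : (N <= m)%N -> cmod (\sum_(i < m) a i - \sum_(i < N) a i) < e / 2.
  move=> Nm; rewrite -!(big_mkord xpredT a) (big_cat_nat (leq0n N) Nm)/= addrAC subrr add0r.
  apply: le_lt_trans (cmod_sum _ _ _) _.
  have : S m <= s by apply: (ub_le_sup (proj2 hs)); exists m.
  rewrite (Sincr _ _ Nm); move: HN; rewrite -/s; lra.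
exists N => m n Nm Nn; have := key m Nm; have := key n Nn.
set x := (\sum_(i < N) a i) => h1 h2.
have := cmod_tri x (\sum_(i < m) a i) (\sum_(i < n) a i).
rewrite (cmodC x (\sum_(i < n) a i)); lra.
Qed.

(** Cauchy-Schwarz from the weighted inequality [x y <= t x^2 / 2 + y^2 / (2 t)]; the weight
    [t = hnorm g / hnorm f] balances the two sums, so vanishing norms are treated first. *)
Lemma sum_mul_hnorm f g n : \sum_(i < n) cmod (coef f i * (coef g i)^*) <= hnorm f * hnorm g.
Proof.
have f0 := hnorm_ge0 f; have g0 := hnorm_ge0 g.
have [fz|fnz] := eqVneq (hnorm f) 0.
  rewrite fz mul0r big1// => i _; have := coef_le_hnorm f i; rewrite fz => h.
  by apply/eqP; rewrite cmodM mulf_eq0 eq_le h cmod_ge0.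
have [gz|gnz] := eqVneq (hnorm g) 0.
  rewrite gz mulr0 big1// => i _; have := coef_le_hnorm g i; rewrite gz => h.
  by apply/eqP; rewrite cmodM cmod_conj mulf_eq0 orbC eq_le h cmod_ge0.
have fp : 0 < hnorm f by rewrite lt_def fnz.
have gp : 0 < hnorm g by rewrite lt_def gnz.
pose t := hnorm g / hnorm f.
have t0 : 0 < t by rewrite divr_gt0.
have amgm (x y : R) : x * y <= t / 2 * x ^+ 2 + (2 * t)^-1 * y ^+ 2.
  rewrite -subr_ge0 (_ : _ - _ = (2 * t)^-1 * (t * x - y) ^+ 2).
    by rewrite mulr_ge0 ?sqr_ge0// invr_ge0 mulr_ge0// ltW.
  by field; rewrite gt_eqF.
apply: (@le_trans _ _ (t / 2 * hnorm f ^+ 2 + (2 * t)^-1 * hnorm g ^+ 2)); last first.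
  rewrite /t le_eqVlt; apply/orP; left; apply/eqP; field.
  by rewrite !gt_eqF.
apply: (@le_trans _ _ (\sum_(i < n) (t / 2 * cmod (coef f i) ^+ 2 + (2 * t)^-1 * cmod (coef g i) ^+ 2))).
  by apply: ler_sum => i _; rewrite cmodM cmod_conj.
rewrite big_split/= -!mulr_sumr; apply: lerD; apply: ler_wpM2l; try exact: sum_le_hnorm.
  by rewrite divr_ge0// ltW.
by rewrite invr_ge0 mulr_ge0// ltW.
Qed.

Lemma dot_lim f g : limC (fun n => \sum_(i < n) coef f i * (coef g i)^*) (H2_dot f g).
Proof.
have [l Hl] := @abs_cvg (fun i => coef f i * (coef g i)^*) _ (sum_mul_hnorm f g).
have E : series (fun n => H2_coef f n * (H2_coef g n)^*) =
    (fun n => \sum_(i < n) coef f i * (coef g i)^*).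
  by apply/funext => n; rewrite seriesE; apply: eq_bigr => i _; rewrite !H2_coefE.
rewrite /H2_dot E (_ : limn _ = l)//.
by apply/cvg_lim => //; apply/limC_cvg.
Qed.

Lemma dot_le f g : cmod (H2_dot f g) <= hnorm f * hnorm g.
Proof.
apply: (@limC_cmod_le _ _ _ _ 0 _ (dot_lim f g)) => n _.
exact: le_trans (cmod_sum _ _ _) (sum_mul_hnorm f g n).
Qed.

Lemma dot_lin c f1 f2 g : H2_dot (c *: f1 + f2) g = c * H2_dot f1 g + H2_dot f2 g.
Proof.
apply: limC_uniq (dot_lim _ _) _.
have := limC_D (limC_M (limC_cst c) (dot_lim f1 g)) (dot_lim f2 g).
congr limC; apply/funext => n; rewrite mulr_sumr -big_split/=.
by apply: eq_bigr => i _; rewrite coefH2D mulrDl mulrA.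
Qed.

Lemma norm_of_dotE f : norm_of_dot (@H2_dot R) f = rc (hnorm f).
Proof.
rewrite /norm_of_dot (_ : H2_dot f f = rc (hnorm f) ^+ 2).
  by apply: sqrCK; rewrite -(rc0 R) rc_le hnorm_ge0.
apply: limC_uniq (dot_lim f f) _; rewrite -rcX hnorm_sq.
have cv : series (fun n => cmod (coef f n) ^+ 2) @ \oo --> limn (series (fun n => cmod (coef f n) ^+ 2)).
  by have [] := coefP f.
move=> e e0; move/cvgrPdist_lt : cv => /(_ e e0)[N _ HN].
exists N => n Nn; have := HN n Nn; rewrite /= seriesE distrC -cmod_rc rcB rc_sum.
suff -> : \sum_(i < n) coef f i * (coef f i)^* = \sum_(i < n) rc (cmod (coef f i) ^+ 2) by [].
by apply: eq_bigr => i _; rewrite cmod_mulconj.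
Qed.

Lemma bounded_opP (T : H2 R -> H2 R) : bounded_op (@H2_dot R) T <->
  linear T /\ exists2 M : R, 0 <= M & forall f, hnorm (T f) <= M * hnorm f.
Proof.
split=> -[lT [M M0 HM]]; split=> //.
  have ME : M = rc (cmod M) by rewrite cmodE ger0_norm.
  exists (cmod M); first exact: cmod_ge0.
  by move=> f; have := HM f; rewrite !norm_of_dotE {1}ME -rcM rc_le.
exists (rc M); first by rewrite -(rc0 R) rc_le.
by move=> f; rewrite !norm_of_dotE -rcM rc_le.
Qed.

Lemma H2_of_coef a (M : R) : (forall n, \sum_(i < n) cmod (a i) ^+ 2 <= M ^+ 2) -> 0 <= M ->
  exists f, coef f = a.
Proof.
move=> aM M0; have aM' n := cmod_le_sum2 n M0 aM.
have /choice[F HF] z : exists l, cmod z < 1 -> limC (fun n => psum a n z) l.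
  have [z1|z1] := pselect (cmod z < 1); last by exists 0.
  by have [l Hl] := psum_cvg aM' z1; exists l.
have fH : (fun z => if cmod z < 1 then F z else 0) \in hardy (R := R).
  apply/asboolP; split; first by move=> z; case: ifP => // h []; apply/odiscE.
  exists a; first exact: bdd_sq_summ aM.
  by apply/pseries_power_series => z z1; rewrite z1; exact: HF.
exists (MkH2 fH); apply: coef_unique M0 aM _ => z z1 /=; rewrite z1; exact: HF.
Qed.

(** The Szego kernel, with coefficients the powers of [z^*]. It makes point evaluations matrix
    coefficients, hence visible to the weak operator topology. *)
Lemma kernel_exists z : cmod z < 1 -> exists k, forall f, H2_dot f k = f z.
Proof.
move=> z1; have z0 := cmod_ge0 z.
have k1 : 1 <= 1 / (1 - cmod z) by rewrite ler_pdivlMr; lra.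
have [||k kE] := @H2_of_coef (fun n => (z^*) ^+ n) (1 / (1 - cmod z)).
- move=> n; apply: (@le_trans _ _ (\sum_(0 <= i < n) cmod z ^+ i)).
    rewrite big_mkord; apply: ler_sum => i _; rewrite cmodX cmod_conj expr2.
    by apply: ler_piMr; rewrite ?exprn_ge0// exprn_ile1// ltW.
  apply: le_trans (geo_tail z0 z1 (leq0n n)) _; rewrite expr0 expr2.
  by apply: ler_peMr => //; lra.
- lra.
exists k => f; apply: limC_uniq (dot_lim f k) _.
have := proj2 (coefP f) z z1; congr limC; apply/funext => n.
by apply: eq_bigr => i _; rewrite kE rmorphXn/= conjCK.
Qed.

Lemma coef_close (g : C -> C) p e : discalg g -> (forall z, cmod z <= 1 -> cmod (g z - p.[z]) <= e) ->
  forall i, cmod (coef (toH2 g) i - p`_i) <= e.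
Proof.
move=> dg gp.
have dgp : discalg (fun z => g z - p.[z]).
  move=> d /dg[q Hq]; exists (q - p) => z z1; rewrite hornerD hornerN opprB addrA subrK.
  exact: Hq.
have [|a [a2 pa]] := @discalg_coef _ _ e dgp; first by move=> z z1; apply: gp; rewrite z1.
have e0 : 0 <= e by apply: le_trans (cmod_ge0 _) (gp 0 _); rewrite cmod0 ler01.
have ab := cmod_le_sum2 _ e0 a2.
pose B := \sum_(j < size p) cmod p`_j.
have pB i : cmod p`_i <= B.
  have [ip|ip] := ltnP i (size p); last first.
    by rewrite nth_default// cmod0 sumr_ge0// => j _; exact: cmod_ge0.
  rewrite /B (bigD1 (Ordinal ip))//= lerDl sumr_ge0// => j _; exact: cmod_ge0.
have h0 := hnorm_ge0 (toH2 g).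
have B0 : 0 <= B by apply: le_trans (cmod_ge0 _) (pB 0%N).
suff E : (fun i => coef (toH2 g) i - p`_i) = a by move=> i; rewrite -[_ - _]/((fun i => coef (toH2 g) i - p`_i) i) E.
apply: (@pseries_unique _ _ _ (fun z => g z - p.[z]) (hnorm (toH2 g) + B + e)) => //.
- move=> i; apply: le_trans (cmodB _ _) _.
  by have := coef_le_hnorm (toH2 g) i; have := pB i; lra.
- by move=> i; have := ab i; lra.
move=> z z1; rewrite -(toH2E dg z1).
move=> d d0; have [N HN] := proj2 (coefP (toH2 g)) z z1 d d0.
exists (maxn N (size p)) => n; rewrite geq_max => /andP[/HN h np].
rewrite (_ : psum _ n z = psum (coef (toH2 g)) n z - p.[z]).
  by rewrite opprB addrA subrK.
rewrite /psum (horner_coef_wide _ np) -sumrB; apply: eq_bigr => i _; ring.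
Qed.

(** Lower semicontinuity of the norm: uniform approximation makes each coefficient converge
    ([coef_close]), and finite square sums pass to the limit. *)
Lemma hnorm_toH2_approx (g : C -> C) (B : R) : discalg g -> 0 <= B ->
  (forall e, 0 < e -> exists p, (forall z, cmod z <= 1 -> cmod (g z - p.[z]) <= e) /\
     forall n, \sum_(i < n) cmod p`_i ^+ 2 <= B ^+ 2) ->
  hnorm (toH2 g) <= B.
Proof.
move=> dg B0 H.
have /choice[p Hp] (m : nat) : exists p, (forall z, cmod z <= 1 -> cmod (g z - p.[z]) <= m.+1%:R^-1) /\
     forall n, \sum_(i < n) cmod p`_i ^+ 2 <= B ^+ 2.
  by apply: H; rewrite invr_gt0 ltr0n.
apply: hnorm_le => // n.
apply: (@limC_l2 _ _ (fun i m => (p m)`_i) _ _ 0) => [i|m _]; last by have [] := Hp m.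
move=> e /invS_lt[N HN]; exists N => m /HN h; rewrite cmodC.
by apply: le_lt_trans h; apply: coef_close => //; have [] := Hp m.
Qed.

(** * Subordination for polynomials, then for the Hardy space *)

Definition sqnorm p : R := \sum_(i < size p) cmod p`_i ^+ 2.

Lemma sum_le_sqnorm p n : \sum_(i < n) cmod p`_i ^+ 2 <= sqnorm p.
Proof.
have [sqnorm'|np] := leqP (size p) n.
  rewrite /sqnorm (big_ord_widen n (fun i => cmod p`_i ^+ 2) sqnorm') [leLHS](bigID (fun i : 'I_n => (i < size p)%N))/=.
  rewrite [X in _ + X]big1 ?addr0// => i; rewrite -leqNgt => h.
  by rewrite nth_default// cmod0 expr0n.
rewrite /sqnorm (big_ord_widen (size p) (fun i => cmod p`_i ^+ 2) (ltnW np)) [leRHS](bigID (fun i : 'I_(size p) => (i < n)%N))/=.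
by rewrite lerDl sumr_ge0// => i _; exact: sqr_ge0.
Qed.

(** Parseval over one set of roots of unity, large enough for both polynomials, reduces this to a
    pointwise comparison. *)
Lemma sqnorm_mul p q : (forall z, cmod z = 1 -> cmod q.[z] <= 1) -> sqnorm (p * q) <= sqnorm p.
Proof.
move=> q1.
have [N [w [nN N1 wN _]]] := root_near1 (maxn (size p) (size (p * q))) (@ltr01 R).
have N0 : (0 < N)%N := ltnW N1.
move: nN; rewrite geq_max => /andP[pN pqN].
have wide (s : {poly C}) : (size s <= N)%N -> sqnorm s = \sum_(i < N) cmod s`_i ^+ 2.
  move=> sN; apply/eqP; rewrite eq_le sum_le_sqnorm andbT /sqnorm.
  rewrite (big_ord_widen N (fun i => cmod s`_i ^+ 2) sN) [leRHS](bigID (fun i : 'I_N => (i < size s)%N))/=.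
  by rewrite lerDl sumr_ge0// => i _; exact: sqr_ge0.
rewrite !wide// !(poly_parseval wN)// ler_wpM2l ?invr_ge0 ?ler0n//.
apply: ler_sum => k _; rewrite hornerM cmodM exprMn ler_piMr ?sqr_ge0//.
rewrite exprn_ile1 ?cmod_ge0// q1// cmodX (cmod_root N0) ?expr1n//.
exact: prim_expr_order.
Qed.

(* Littlewood's subordination principle: for [p = c + 'X p1] the two summands of
   [p \Po q = c + q (p1 \Po q)] are orthogonal since [q] vanishes at 0. *)
Lemma sqnorm_comp p q : (forall z, cmod z = 1 -> cmod q.[z] <= 1) -> q`_0 = 0 -> sqnorm (p \Po q) <= sqnorm p.
Proof.
move=> q1 q0; elim/poly_ind: p => [|p c IH]; first by rewrite comp_poly0.
rewrite comp_poly_MXaddC.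
have s0 : ((p \Po q) * q)`_0 = 0 by rewrite coef0M q0 mulr0.
have split1 (s : {poly C}) n : \sum_(i < n) cmod (s + c%:P)`_i ^+ 2 <= cmod (s`_0 + c) ^+ 2 + \sum_(i < n) cmod s`_i.+1 ^+ 2.
  case: n => [|n]; first by rewrite !big_ord0 addr0 sqr_ge0.
  rewrite big_ord_recl/= coefD coefC eqxx lerD2l.
  rewrite [leRHS]big_ord_recr/= (eq_bigr (fun i : 'I_n => cmod s`_i.+1 ^+ 2)).
    by rewrite lerDl sqr_ge0.
  by move=> i _; rewrite /bump/= add1n coefD coefC/= addr0.
apply: le_trans (split1 _ _) _; rewrite s0 add0r.
have -> : sqnorm (p * 'X + c%:P) = cmod c ^+ 2 + sqnorm p.
  apply/eqP; rewrite eq_le; apply/andP; split.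
    apply: le_trans (split1 _ _) _; rewrite coefMX/= add0r lerD2l.
    under eq_bigr do rewrite coefMX/=.
    exact: sum_le_sqnorm.
  apply: (@le_trans _ _ (\sum_(i < (size p).+1) cmod (p * 'X + c%:P)`_i ^+ 2)); last exact: sum_le_sqnorm.
  rewrite big_ord_recl/= coefD coefC coefMX/= add0r lerD2l /sqnorm.
  by apply: ler_sum => i _; rewrite /bump/= add1n coefD coefC coefMX/= addr0.
rewrite lerD2l; apply: le_trans IH; apply: le_trans (sqnorm_mul _ q1).
set s := _ * _; apply: le_trans (sum_le_sqnorm s (size (s + c%:P)).+1).
by rewrite big_ord_recl/= lerDr sqr_ge0.
Qed.

Definition trunc f n : {poly C} := \poly_(i < n) coef f i.

Lemma truncE f n z : (trunc f n).[z] = psum (coef f) n z.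
Proof. by rewrite /trunc horner_poly. Qed.

Lemma sqnorm_trunc f n : sqnorm (trunc f n) <= hnorm f ^+ 2.
Proof.
apply: (@le_trans _ _ (\sum_(i < n) cmod (coef f i) ^+ 2)); last exact: sum_le_hnorm.
have sz : (size (trunc f n) <= n)%N by exact: size_poly.
rewrite /sqnorm (big_ord_widen n (fun i => cmod (trunc f n)`_i ^+ 2) sz).
apply: (@le_trans _ _ (\sum_(i < n) cmod (trunc f n)`_i ^+ 2)).
  rewrite [leRHS](bigID (fun i : 'I_n => (i < size (trunc f n))%N))/= lerDl.
  by rewrite sumr_ge0// => i _; exact: sqr_ge0.
by apply: ler_sum => i _; rewrite coef_poly ltn_ord.
Qed.

Lemma trunc_near f r e : 0 <= r -> r < 1 -> 0 < e -> exists N, forall n z, (N <= n)%N ->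
  cmod z <= r -> cmod ((trunc f n).[z] - f z) < e.
Proof.
move=> r0 r1 e0; have h0 := hnorm_ge0 f.
have k0 : 0 < 1 - r by lra.
have e1 : 0 < e / (hnorm f + 1) * (1 - r) by rewrite mulr_gt0// divr_gt0//; lra.
have [N HN] := expr_lt r0 r1 e1.
exists N => n z Nn zr; rewrite truncE cmodC.
apply: le_lt_trans (pseries_tail n (coef_le_hnorm f) (proj2 (coefP f)) zr r1) _.
have := HN n Nn; rewrite -ltr_pdivrMr// ltr_pdivlMr; last by lra.
have : 0 <= r ^+ n / (1 - r) by rewrite divr_ge0 ?exprn_ge0// ltW.
set t := _ / _ => t0; nra.
Qed.

Lemma udiff_horner (phi phi' : C -> C) p K : udiff K phi phi' -> exists g' : C -> C, udiff K (fun z => p.[phi z]) g'.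
Proof.
move=> uphi.
have /choice[g' Hg] (i : 'I_(size p)) : exists g' : C -> C, udiff K (fun z => phi z ^+ i) g'.
  by have [h' uh] := udiff_X i uphi; exists h'.
exists (fun z => \sum_(i < size p) p`_i * g' i z).
apply: udiff_ext (udiff_sum (fun i : 'I_(size p) => udiff_scale p`_i (Hg i))) => // z _.
by rewrite horner_coef.
Qed.

(** The Taylor polynomials of [f] converge uniformly on the disc of radius [r < 1] that contains the
    image of [phi]. *)
Lemma discalg_comp f (phi phi' : C -> C) r : udiff (@udisc R) phi phi' -> 0 <= r -> r < 1 ->
  (forall z, cmod z <= 1 -> cmod (phi z) <= r) -> discalg (fun z => f (phi z)).
Proof.
move=> uphi r0 r1 phir; apply: (@discalg_lim _ (fun n z => (trunc f n).[phi z])).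
  by move=> n; have [g' ug] := udiff_horner (trunc f n) uphi; exact: udiff_discalg ug.
move=> e /(trunc_near f r0 r1)[N HN]; exists N => n z Nn z1.
by apply: HN => //; exact: phir.
Qed.

(** Both [f] and [phi] are replaced by polynomials; [sqnorm_comp] applies to them and
    [hnorm_toH2_approx] carries the bound back. *)
Lemma littlewood f (phi phi' : C -> C) r : udiff (@udisc R) phi phi' -> 0 <= r -> r < 1 ->
  (forall z, cmod z <= 1 -> cmod (phi z) <= r) -> phi 0 = 0 ->
  hnorm (toH2 (fun z => f (phi z))) <= hnorm f.
Proof.
move=> uphi r0 r1 phir phi0; apply: hnorm_toH2_approx; [exact: discalg_comp uphi r0 r1 phir|exact: hnorm_ge0|].
move=> e e0; have e2 : 0 < e / 2 by lra.
have [N /(_ N _ (leqnn _)) HN] := trunc_near f r0 r1 e2.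
have [t' ut] := udiff_poly (trunc f N).
have [d d0 Hd] := udiff_cont ut e2.
(* The polynomial [q] is within [2 * d'] of [phi]: one [d'] for approximating, one for restoring the
   value 0 at 0. This stays below [d], and [r + 2 * d'] stays below 1. *)
pose d' := Num.min (d / 4) ((1 - r) / 4).
have d'0 : 0 < d' by rewrite lt_min; apply/andP; split; lra.
have dd : d' <= d / 4 by rewrite ge_min lexx.
have dr : d' <= (1 - r) / 4 by rewrite ge_min lexx orbT.
have [p Hp] := udiff_discalg uphi d'0.
have p0 : cmod p.[0] <= d'.
  by have := Hp 0; rewrite phi0 sub0r cmodN cmod0; apply; exact: ler01.
pose q := p - (p.[0])%:P.
have qphi z : cmod z <= 1 -> cmod (phi z - q.[z]) <= 2 * d'.
  move=> z1; rewrite hornerD hornerN hornerC opprB addrCA -[_ + (_ - _)]addrC.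
  have := cmodD (phi z - p.[z]) p.[0]; have := Hp z z1; lra.
have q1 z : cmod z <= 1 -> cmod q.[z] <= 1.
  move=> z1; have := qphi z z1; have := phir z z1.
  have := cmod_triB q.[z] (phi z); rewrite (cmodC q.[z] (phi z)); lra.
exists (trunc f N \Po q); split.
  move=> z z1; rewrite horner_comp.
  have h1 := HN (phi z) (phir z z1).
  have h2 : cmod ((trunc f N).[phi z] - (trunc f N).[q.[z]]) < e / 2.
    apply: Hd; [exact: q1|apply: le_trans (phir z z1) _; lra|].
    by have := qphi z z1; lra.
  have := cmod_tri (trunc f N).[phi z] (f (phi z)) (trunc f N).[q.[z]].
  rewrite (cmodC (f (phi z)) (trunc f N).[phi z]); lra.
move=> n; apply: le_trans (sum_le_sqnorm _ _) _; apply: le_trans (sqnorm_comp _ _ _) _.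
- by move=> z z1; apply: q1; rewrite z1.
- by rewrite -horner_coef0 hornerD hornerN hornerC subrr.
exact: sqnorm_trunc.
Qed.

End HardyDot.


(** * Closures in the weak operator topology *)

Section WeakOperatorTopology.
Set Implicit Arguments.
Unset Strict Implicit.

(** A matrix of maximal rank among those with row space inside [V] has row space equal to [V], and
    the columns of its cokernel are functionals that detect membership. *)
Lemma subspace_separation (F : fieldType) n (V : set 'rV[F]_n) v : V 0 ->
  (forall c u w, V u -> V w -> V (c *: u + w)) ->
  (forall k : 'cV[F]_n, (forall u, V u -> u *m k = 0) -> v *m k = 0) -> V v.
Proof.
move=> V0 Vlin Hv.
pose P r := `[< exists2 A : 'M[F]_n, \rank A = r & forall u : 'rV_n, (u <= A)%MS -> V u >].
have P0 : exists r, P r.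
  exists 0%N; apply/asboolP; exists 0; first exact: mxrank0.
  by move=> u; rewrite submx0 => /eqP ->.
have Pn r : P r -> (r <= n)%N by move=> /asboolP[A <- _]; exact: rank_leq_row.
have [r /asboolP[A rA VA] rmax] := ex_maxnP P0 Pn.
have subA u : V u -> (u <= A)%MS.
  move=> Vu; apply: contraT => uA.
  have : P (\rank (A + u)%MS).
    apply/asboolP; exists (A + u)%MS => // w /sub_addsmxP[[a b] /= ->].
    rewrite addrC [b]mx11_scalar mul_scalar_mx.
    exact: Vlin (VA _ (submxMl _ _)).
  move/rmax; rewrite -rA => h.
  have : (A < A + u)%MS.
    by rewrite ltmxE addsmxSl/= addsmx_sub submx_refl.
  by rewrite ltmxErank ltnNge h andbF.
have [vA|vA] := boolP (v <= A)%MS; first exact: VA.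
exfalso; move: vA; rewrite submxE => /eqP; apply.
apply/matrixP => i j; rewrite ord1 [RHS]mxE.
have cE (u : 'rV_n) : (u *m col j (cokermx A)) = (u *m cokermx A) 0 j *: 1%:M.
  apply/matrixP => a b; rewrite !ord1 !mxE eqxx mulr1.
  by apply: eq_bigr => l _; rewrite !mxE.
have : v *m col j (cokermx A) = 0.
  by apply: Hv => u /subA; rewrite cE submxE => /eqP ->; rewrite mxE scale0r.
by rewrite cE => /matrixP/(_ 0 0); rewrite !mxE eqxx mulr1.
Qed.

Variables (R : realType) (H : lmodType (Cplx R)) (dot : H -> H -> Cplx R).
Local Notation C := (Cplx R).
Local Notation mc := (matrix_coefs dot).

Lemma wot_nbhs (T : initial_topology mc) (p : H * H) (e : R) : 0 < e ->
  nbhs T [set S : initial_topology mc | cmod (mc S p - mc T p) < e].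
Proof.
move=> e0.
have := @proj_continuous _ (fun=> C) p (mc T) _ (ball_within_nbhs (mc T p) e0).
move=> /(@initial_continuous _ _ mc T); exact.
Qed.

Lemma wot_closure_eq (S : set (H -> H)) (T : H -> H) x y x' y' : wot_closure dot S T ->
  (forall A, S A -> dot (A x) y = dot (A x') y') -> dot (T x) y = dot (T x') y'.
Proof.
move=> [_ clT] HS; apply/eqP; rewrite -subr_eq0 -cmod_eq0 eq_le cmod_ge0 andbT.
apply/ler_addgt0Pr => e e0; rewrite add0r.
have e2 : 0 < e / 2 by lra.
have [A [SA [/= h1 h2]]] := clT _ (filterI (wot_nbhs T (x, y) e2) (wot_nbhs T (x', y') e2)).
move: h1 h2; rewrite /matrix_coefs /= (HS A SA) => h1 h2.
have := cmod_tri (dot (A x') y') (dot (T x) y) (dot (T x') y').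
rewrite (cmodC (dot (T x) y) (dot (A x') y')); lra.
Qed.

(** For finitely many pairs, the vectors of matrix coefficients of members of [S] form a subspace,
    so separation gives some [A] in [S] that agrees exactly with [T] on these pairs. *)
Lemma wot_closure_separation (S : set (H -> H)) (T : H -> H) : bounded_op dot T ->
  (exists A, S A) ->
  (forall c A B, S A -> S B -> exists2 D, S D & forall x y,
     dot (D x) y = c * dot (A x) y + dot (B x) y) ->
  (forall n (x y : 'I_n -> H) (k : 'I_n -> C),
     (forall A, S A -> \sum_i k i * dot (A (x i)) (y i) = 0) ->
     \sum_i k i * dot (T (x i)) (y i) = 0) ->
  wot_closure dot S T.
Proof.
move=> bT [A0 SA0] Slin Hsep; split=> //.
have agree (l : seq (H * H)) : exists2 A, S A & forall p, p \in l -> mc A p = mc T p.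
  pose n := size l; pose x (i : 'I_n) := nth (0, 0) l i.
  pose vec (A : H -> H) : 'rV[C]_n := \row_i mc A (x i).
  suff [A SA AT] : [set u | exists2 A, S A & u = vec A] (vec T).
    exists A => // p pl; have i0 : (index p l < n)%N by rewrite index_mem.
    move/rowP: AT => /(_ (Ordinal i0)); rewrite !mxE /x /= nth_index//.
  apply: subspace_separation.
  - have [D SD DE] := Slin (-1) _ _ SA0 SA0; exists D => //.
    by apply/rowP => i; rewrite !mxE /matrix_coefs DE mulN1r addNr.
  - move=> c _ _ [A SA ->] [B SB ->]; have [D SD DE] := Slin c _ _ SA SB.
    by exists D => //; apply/rowP => i; rewrite !mxE /matrix_coefs DE.
  - move=> k Hk.
    have vk A : (vec A *m k) = (\sum_i k i 0 * dot (A (x i).1) (x i).2)%:M.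
      apply/matrixP => a b; rewrite !ord1 !mxE eqxx mulr1n.
      by apply: eq_bigr => i _; rewrite !mxE mulrC.
    rewrite vk (Hsep _ (fun i => (x i).1) (fun i => (x i).2) (fun i => k i 0)).
      by apply/matrixP => a b; rewrite !mxE mul0rn.
    move=> A SA; have := Hk (vec A); rewrite vk => /(_ _)/matrixP h.
    have /h /(_ 0 0) : exists2 A0, S A0 & vec A = vec A0 by exists A.
    by rewrite !mxE eqxx mulr1n.
(* The filter generated by the members of [S] agreeing with [T] on a finite list. Every coordinate
   is eventually constant along it, so it converges to [T]. *)
pose G : set_system (initial_topology mc) := [set P | exists l : seq (H * H),
  forall A, S A -> (forall p, p \in l -> mc A p = mc T p) -> P A].
have GF : Filter G.
  split.
  - by exists [::].
  - move=> P Q [l Hl] [l' Hl']; exists (l ++ l') => A SA h; split.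
      by apply: Hl => // p pl; apply: h; rewrite mem_cat pl.
    by apply: Hl' => // p pl; apply: h; rewrite mem_cat pl orbT.
  - by move=> P Q PQ [l Hl]; exists l => A SA h; apply: PQ; exact: Hl.
have cvG : {ptws, (mc : initial_topology mc -> _) @ G --> mc T}.
  apply/cvg_sup => p P [_ [[B oB <-] /= BT BP]].
  by exists [:: p] => A SA h /=; apply: BP => /=; rewrite h ?mem_head.
move=> P; rewrite nbhsE => -[U [[B oB BE] UT] UP].
have GU : G U.
  rewrite -BE; apply: (cvG B); apply: open_nbhs_nbhs; split=> //.
  by move: UT; rewrite -BE.
have [l Hl] := GU; have [A SA HA] := agree l.
by exists A; split=> //; apply: UP; exact: Hl.
Qed.

End WeakOperatorTopology.


(** * The Koenigs function *)

Section InfiniteProducts.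
Set Implicit Arguments.
Unset Strict Implicit.
Variable R : realType.
Local Notation C := (Cplx R).

Lemma limC_V (u : nat -> C) l : l != 0 -> limC u l -> limC (fun n => (u n)^-1) l^-1.
Proof.
move=> l0 ul e e0; have nl : 0 < cmod l by rewrite cmod_gt0.
pose d := Num.min (cmod l / 2) (e * (cmod l ^+ 2) / 4).
have d0 : 0 < d by rewrite lt_min !divr_gt0// mulr_gt0// exprn_gt0.
have d1 : d <= cmod l / 2 by rewrite ge_min lexx.
have d2 : d <= e * (cmod l ^+ 2) / 4 by rewrite ge_min lexx orbT.
have [N HN] := ul _ d0; exists N => n /HN h.
have un : cmod l / 2 <= cmod (u n).
  have := cmod_triB l (u n); rewrite (cmodC l (u n)); lra.
have u0 : u n != 0 by rewrite -cmod_gt0; lra.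
have up : 0 < cmod (u n) by rewrite cmod_gt0.
rewrite (_ : _ - _ = (l - u n) / (u n * l)); last by field; rewrite l0 u0.
rewrite cmodM cmodV cmodM ltr_pdivrMr ?mulr_gt0// (cmodC l (u n)).
apply: lt_le_trans h _; apply: le_trans d2 _.
have e1 : 0 < e * cmod l by rewrite mulr_gt0.
rewrite -subr_ge0 (_ : _ - _ = e * cmod l * (cmod (u n) - cmod l / 4)); last by field.
by apply: mulr_ge0; lra.
Qed.

(** Infinite products with factors [1 + d n]: the inequality [1 + x <= expR x] bounds the partial
    products uniformly, after which their increments are dominated by a geometric series. *)
Lemma prod_unif (K : set C) (p d : nat -> C -> C) (A r B : R) :
  0 <= A -> 0 <= r -> r < 1 -> (forall z, K z -> cmod (p 0%N z) <= B) ->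
  (forall n z, K z -> p n.+1 z = p n z * (1 + d n z)) ->
  (forall n z, K z -> cmod (d n z) <= A * r ^+ n) ->
  exists l, unif_lim K p l.
Proof.
move=> A0 r0 r1 pB pS dA.
pose M := Num.max B 0 * expR (A * (1 / (1 - r))).
have B0 : 0 <= Num.max B 0 by rewrite le_max lexx orbT.
have pM n z : K z -> cmod (p n z) <= M.
  move=> Kz; apply: (@le_trans _ _ (Num.max B 0 * expR (A * \sum_(0 <= i < n) r ^+ i))).
    elim: n => [|n IH].
      by rewrite big_geq// mulr0 expR0 mulr1 le_max pB.
    rewrite pS// cmodM big_nat_recr//= mulrDr expRD mulrA.
    apply: ler_pM; rewrite ?cmod_ge0//; apply: le_trans (expR_ge1Dx _).
    by apply: le_trans (cmodD _ _) _; rewrite cmod1 lerD2l dA.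
  apply: ler_wpM2l => //; rewrite ler_expR; apply: ler_wpM2l => //.
  by apply: le_trans (geo_tail r0 r1 (leq0n n)) _; rewrite expr0.
have diff n m z : K z -> (n <= m)%N -> cmod (p m z - p n z) <= M * A * (r ^+ n / (1 - r)).
  move=> Kz cmod'; have M0 : 0 <= M by apply: le_trans (pM 0%N z Kz); exact: cmod_ge0.
  have -> : p m z - p n z = \sum_(n <= i < m) (p i.+1 z - p i z) by rewrite telescope_sumr.
  apply: le_trans (cmod_sum _ _ _) _.
  apply: (@le_trans _ _ (\sum_(n <= i < m) M * A * r ^+ i)).
    apply: ler_sum => i _; rewrite pS// mulrDr mulr1 addrAC subrr add0r cmodM -mulrA.
    by apply: ler_pM; rewrite ?cmod_ge0// ?pM// dA.
  by rewrite -mulr_sumr; apply: ler_wpM2l; [exact: mulr_ge0|exact: geo_tail].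
have unifC e : 0 < e -> exists N, forall n m z, (N <= n)%N -> (n <= m)%N -> K z ->
    cmod (p m z - p n z) < e.
  move=> e0; have k0 : 0 < 1 - r by lra.
  pose D := `|M * A| + 1; have D0 : 0 < D by rewrite /D; have := normr_ge0 (M * A); lra.
  have e1 : 0 < e / D * (1 - r) by rewrite mulr_gt0// divr_gt0.
  have [N HN] := expr_lt r0 r1 e1.
  exists N => n m z Nn cmod' Kz; apply: le_lt_trans (diff _ _ _ Kz cmod') _.
  have := HN n Nn; rewrite -ltr_pdivrMr// ltr_pdivlMr//.
  have : 0 <= r ^+ n / (1 - r) by rewrite divr_ge0 ?exprn_ge0// ltW.
  have := ler_norm (M * A); rewrite /D.
  set t := r ^+ n / _; set a := M * A; set b := `| _ | => h1 h2; nra.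
have /choice[l Hl] z : exists l, K z -> limC (p^~ z) l.
  have [Kz|nKz] := pselect (K z); last by exists 0.
  have [|l Hl] := @cauchyC _ (p^~ z); last by exists l.
  move=> e /unifC[N HN]; exists N => m n Nm Nn.
  have [mn|/ltnW mn] := leqP m n; last exact: HN.
  by rewrite cmodC; exact: HN.
exists l => e e0; have e2 : 0 < e / 2 by lra.
have [N HN] := unifC _ e2; exists N => n z Nn Kz.
have : cmod (l z - p n z) <= e / 2.
  apply: (@limC_cmod_le _ (fun m => p m z - p n z) _ _ n).
    by move=> m cmod'; apply/ltW/HN.
  by apply: limC_B; [exact: Hl|exact: limC_cst].
by rewrite cmodC; lra.
Qed.

Lemma udiff_radius (f f' : C -> C) : udiff (@udisc R) f f' -> (forall z, cmod z <= 1 -> cmod (f z) < 1) ->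
  exists r : R, [/\ 0 <= r, r < 1 & forall z, cmod z <= 1 -> cmod (f z) <= r].
Proof.
move=> uf f1.
have [|||z z1 Hz] := @min_attained _ (@udisc R) (fun z => 1 - cmod (f z)) (@disc_cpt _ 1) _.
- by exists 0; have : cmod (0 : C) <= 1 by rewrite cmod0.
- by move=> z /f1 h; lra.
- move=> z z1 e /(udiff_cont uf)[d d0 Hd]; exists d => // w w1 /(Hd _ _ z1 w1).
  rewrite opprB addrCA addrAC subrr add0r; apply: le_lt_trans.
  have := cmod_triB (f z) (f w); have := cmod_triB (f w) (f z).
  rewrite (cmodC (f z) (f w)) ler_norml => h1 h2; apply/andP; split; lra.
exists (cmod (f z)); split; [exact: cmod_ge0|exact: f1|].
by move=> w /Hz; lra.
Qed.

End InfiniteProducts.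

(** * Linearisation of [phi] at its fixed point 0 *)

Section Koenigs.
Set Implicit Arguments.
Unset Strict Implicit.
Variable R : realType.
Local Notation C := (Cplx R).
Local Notation udisc := (@udisc R).
Implicit Types (z w : C).
Variables (psi psi' phi : C -> C) (lam : C).
Hypothesis upsi : udiff udisc psi psi'.
Hypothesis psi0 : psi 0 = 0.
Hypothesis phiE : forall z, phi z = lam * z * (1 + psi z).
Hypothesis phi_inj : forall z w, cmod z <= 1 -> cmod w <= 1 -> phi z = phi w -> z = w.
Hypothesis phi_maps : forall z, cmod z <= 1 -> cmod (phi z) < 1.

Definition phi_deriv z := lam * (1 + psi z) + lam * z * psi' z.

Lemma udiff_idD : udiff udisc id (fun=> 1). Proof. by apply: udiff_id; exists 1. Qed.

Lemma udiff_phi : udiff udisc phi phi_deriv.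
Proof.
have := udiff_M (udiff_scale lam udiff_idD) (udiff_D (udiff_cst udisc 1) upsi).
by apply: udiff_ext => z _; rewrite ?phiE// /phi_deriv mulr1 add0r.
Qed.

Lemma phi0 : phi 0 = 0. Proof. by rewrite phiE mulr0 mul0r. Qed.

Lemma udisc0 : udisc 0. Proof. by have : cmod (0 : C) <= 1 by rewrite cmod0. Qed.

Lemma lam_neq0 : lam != 0.
Proof.
apply/eqP => l0; have /eqP : 1 = 0 :> C.
  apply: phi_inj; rewrite ?cmod1 ?cmod0//.
  by rewrite !phiE l0 !mul0r.
by rewrite oner_eq0.
Qed.

Lemma phi_radius : exists r : R, [/\ 0 <= r, r < 1 & forall z, cmod z <= 1 -> cmod (phi z) <= r].
Proof.
exact: (udiff_radius udiff_phi phi_maps).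
Qed.

(** Schwarz's lemma: the quotient of [phi z] by [z] is explicitly [lam * (1 + psi z)], to which the
    maximum principle applies. *)
Lemma schwarz r : (forall z, cmod z <= 1 -> cmod (phi z) <= r) ->
  forall z, cmod z <= 1 -> cmod (phi z) <= r * cmod z.
Proof.
move=> Hr z z1; rewrite phiE mulrAC cmodM; apply: ler_wpM2r; first exact: cmod_ge0.
have uh := udiff_scale lam (udiff_D (udiff_cst udisc 1) upsi).
apply: (max_principle uh) => // w w1.
have -> : cmod (lam * (1 + psi w)) = cmod (phi w) by rewrite phiE !cmodM w1 mulr1.
by apply: Hr; rewrite w1.
Qed.

Lemma iter_bound r n z : 0 <= r -> r <= 1 -> (forall z, cmod z <= 1 -> cmod (phi z) <= r) -> cmod z <= 1 ->
  cmod (iter n phi z) <= r ^+ n * cmod z.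
Proof.
move=> r0 r1 Hr z1; elim: n => [|n IH]; first by rewrite expr0 mul1r.
have h : cmod (iter n phi z) <= 1.
  by apply: le_trans IH _; rewrite mulr_ile1 ?exprn_ge0 ?cmod_ge0 ?exprn_ile1.
by rewrite iterS exprS -mulrA; apply: le_trans (schwarz Hr h) _; exact: ler_wpM2l.
Qed.

Lemma iter_udisc n z : cmod z <= 1 -> cmod (iter n phi z) <= 1.
Proof. by move=> z1; elim: n => // n IH; rewrite iterS ltW// phi_maps. Qed.

Definition iter_deriv n z := \prod_(i < n) phi_deriv (iter i phi z).

Lemma udiff_iter n : udiff udisc (iter n phi) (iter_deriv n).
Proof.
elim: n => [|n IH]; first by apply: udiff_ext udiff_idD => // z _; rewrite /iter_deriv big_ord0.
apply: udiff_ext (udiff_comp udiff_phi IH _) => //; last by move=> z; exact: iter_udisc.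
by move=> z _; rewrite /iter_deriv big_ord_recr/= mulrC.
Qed.

(** Both sequences are infinite products. Their factors differ from 1 by [psi] and by
    [psi + id * psi'] at the n-th iterate, which is at most a constant times [r ^+ n] because
    [psi 0 = 0] and the iterates shrink geometrically. *)
Lemma koenigs_limits : exists s s', [/\ unif_lim udisc (fun n z => iter n phi z / lam ^+ n) s,
  unif_lim udisc (fun n z => iter_deriv n z / lam ^+ n) s' & udiff udisc s s'].
Proof.
have [r [r0 r1 Hr]] := phi_radius; have l0 := lam_neq0.
have [_ [M HM] _] := upsi.
have psiM z : cmod z <= 1 -> cmod (psi z) <= M * cmod z.
  move=> z1; have := mean_value_le (@convexC_disc _ 1) upsi HM udisc0 z1.
  by rewrite psi0 !subr0.
have M0 : 0 <= M by apply: le_trans (cmod_ge0 _) (HM _ udisc0).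
have itr n z : cmod z <= 1 -> cmod (iter n phi z) <= r ^+ n.
  move=> z1; apply: le_trans (iter_bound n r0 (ltW r1) Hr z1) _.
  by rewrite ler_piMr ?exprn_ge0.
have [|||s Hs] := @prod_unif _ udisc (fun n z => iter n phi z / lam ^+ n) (fun n z => psi (iter n phi z)) M r 1 M0 r0 r1.
- by move=> z z1; rewrite expr0 divr1.
- by move=> n z _; rewrite iterS phiE exprS; field; rewrite expf_neq0.
- move=> n z z1; apply: le_trans (psiM _ (iter_udisc n z1)) _.
  by apply: ler_wpM2l => //; exact: itr.
have [||||s' Hs'] := @prod_unif _ udisc (fun n z => iter_deriv n z / lam ^+ n)
  (fun n z => psi (iter n phi z) + iter n phi z * psi' (iter n phi z)) (M + M) r 1 _ r0 r1.
- by rewrite addr_ge0.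
- by move=> z z1; rewrite expr0 divr1 /iter_deriv big_ord0 cmod1.
- move=> n z _; rewrite /iter_deriv big_ord_recr/= /phi_deriv exprS; field; by rewrite expf_neq0.
- move=> n z z1; apply: le_trans (cmodD _ _) _; rewrite mulrDl; apply: lerD.
    apply: le_trans (psiM _ (iter_udisc n z1)) _; apply: ler_wpM2l => //; exact: itr.
  rewrite cmodM mulrC; apply: ler_pM; rewrite ?cmod_ge0//; [exact: HM (iter_udisc n z1)|exact: itr].
exists s, s'; split=> //.
apply: (@udiff_lim _ udisc (fun n z => iter n phi z / lam ^+ n) (fun n z => iter_deriv n z / lam ^+ n)) => //.
  exact: (@convexC_disc _ 1).
move=> n; apply: udiff_ext (udiff_scale (lam ^- n) (udiff_iter n)) => z _; exact: mulrC.
Qed.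

Lemma iter_neq0 n z : cmod z <= 1 -> z != 0 -> iter n phi z != 0.
Proof.
move=> z1 z0; elim: n => // n IH; rewrite iterS.
apply: contra_neq IH => h; apply: phi_inj; rewrite ?cmod0 ?iter_udisc// h phi0//.
Qed.

Lemma one_psi_neq0 z : cmod z <= 1 -> 1 + psi z != 0.
Proof.
move=> z1; have [->|z0] := eqVneq z 0; first by rewrite psi0 addr0 oner_eq0.
have := iter_neq0 1 z1 z0; rewrite /= phiE mulf_eq0 negb_or => /andP[]; by [].
Qed.

(** Logarithmic differentiation of the product expressing the n-th iterate. The partial sums of the
    hypothesis appear on the right, so their limit is [z s' / s - 1]. *)
Lemma log_derivative n z : cmod z <= 1 -> z != 0 ->
  z * iter_deriv n z / iter n phi z =
  1 + \sum_(j < n) z * iter_deriv j z * psi' (iter j phi z) / (1 + psi (iter j phi z)).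
Proof.
move=> z1 z0; elim: n => [|n IH].
  by rewrite /iter_deriv !big_ord0 mulr1 addr0 divff.
rewrite big_ord_recr/= addrA -IH /iter_deriv big_ord_recr/= -/(iter_deriv n z) phiE /phi_deriv.
have h := iter_neq0 n z1 z0; have h' := one_psi_neq0 (iter_udisc n z1); have h'' := lam_neq0.
by field; rewrite h h' h''.
Qed.

Lemma koenigs : exists s s' : C -> C, [/\ udiff udisc s s', s 0 = 0, s' 0 = 1,
  (forall z, cmod z <= 1 -> s (phi z) = lam * s z) &
  (forall z w, cmod z <= 1 -> cmod w <= 1 -> s z = s w -> z = w) /\
  (forall z, cmod z <= 1 -> z != 0 -> limC
    (fun n => \sum_(j < n) z * iter_deriv j z * psi' (iter j phi z) / (1 + psi (iter j phi z)))
    (z * s' z / s z - 1))].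
Proof.
have [s [s' [Hs Hs' us]]] := koenigs_limits; have l0 := lam_neq0.
have it0 n : iter n phi 0 = 0 by elim: n => // n IH; rewrite iterS IH phi0.
have ls z : cmod z <= 1 -> limC (fun n => iter n phi z / lam ^+ n) (s z).
  exact: unif_lim_limC Hs.
have ls' z : cmod z <= 1 -> limC (fun n => iter_deriv n z / lam ^+ n) (s' z).
  exact: unif_lim_limC Hs'.
have s0 : s 0 = 0.
  apply: limC_uniq (ls 0 udisc0) _.
  by under [X in limC X]funext do rewrite it0 mul0r; exact: limC_cst.
have s'0 : s' 0 = 1.
  apply: limC_uniq (ls' 0 udisc0) _.
  rewrite (_ : (fun n => _) = fun=> 1); first exact: limC_cst.
  apply/funext => n; rewrite /iter_deriv (eq_bigr (fun=> lam)).
    by rewrite prodr_const card_ord divff// expf_neq0.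
  by move=> i _; rewrite it0 /phi_deriv psi0 addr0 mulr0 mul0r addr0 mulr1.
have sphi z : cmod z <= 1 -> s (phi z) = lam * s z.
  move=> z1; apply: limC_uniq (ls _ (ltW (phi_maps z1))) _.
  have := limC_M (limC_cst lam) (limC_sub_seq (s := S) (fun k => leqnSn k) (ls z z1)).
  congr limC; apply/funext => n /=; rewrite -iterSr iterS exprS; field.
  by rewrite expf_neq0.
have sit n z : cmod z <= 1 -> s (iter n phi z) = lam ^+ n * s z.
  move=> z1; elim: n => [|n IH]; first by rewrite mul1r.
  by rewrite iterS sphi ?iter_udisc// IH exprS mulrA.
(* Near 0 the map [s] is injective because [s' 0 = 1]; iterating [phi] brings
   any two points of the disc there. *)
have sinj z w : cmod z <= 1 -> cmod w <= 1 -> s z = s w -> z = w.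
  move=> z1 w1 szw.
  (* Near 0 one has [|s' x| >= 3 / 4] up to strictness; equal values of [s] with an expansion error
     of 1/4 then force the two points to coincide. *)
  have e4 : (0 : R) < 1 / 4 by lra.
  have [d1 d10 h1] : exists2 d, 0 < d & forall z w, udisc z -> udisc w -> cmod (w - z) < d ->
     cmod (s w - s z - s' z * (w - z)) <= 1 / 4 * cmod (w - z) by have [_ _] := us; apply.
  have [d2 d20 h2] := udiff_dcont us e4.
  have loc x y : cmod x <= 1 -> cmod y <= 1 -> cmod x < d2 -> cmod (y - x) < d1 -> s x = s y -> x = y.
    move=> x1 y1 xd yd sxy; have := h1 _ _ x1 y1 yd.
    rewrite sxy subrr sub0r cmodN cmodM => a1.
    have := h2 _ _ udisc0 x1; rewrite subr0 s'0 => /(_ xd) a2.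
    have := cmod_triB 1 (s' x); rewrite cmod1 (cmodC 1 (s' x)) => a3.
    have a4 := cmod_ge0 (y - x).
    have : cmod (y - x) = 0 by apply/eqP; rewrite eq_le a4 andbT; nra.
    by move/eqP; rewrite cmod_eq0 subr_eq0 => /eqP.
  have [r [r0 r1 Hr]] := phi_radius.
  pose d := Num.min d2 (d1 / 2).
  have d0 : 0 < d by rewrite lt_min d20; lra.
  have [N /(_ N (leqnn _)) HN] := expr_lt r0 r1 d0.
  have small x : cmod x <= 1 -> cmod (iter N phi x) < d.
    move=> x1; apply: le_lt_trans HN; apply: le_trans (iter_bound N r0 (ltW r1) Hr x1) _.
    by rewrite ler_piMr ?exprn_ge0.
  have : iter N phi z = iter N phi w.
    apply: loc; rewrite ?iter_udisc//.
    - by apply: lt_le_trans (small z z1) _; rewrite ge_min lexx.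
    - have a := small z z1; have b := small w w1.
      have : d <= d1 / 2 by rewrite ge_min lexx orbT.
      have := cmodB (iter N phi w) (iter N phi z); lra.
    - by rewrite !sit// szw.
  elim: (N) => // n IH; rewrite !iterS => h; apply: IH; apply: phi_inj; rewrite ?iter_udisc//.
exists s, s'; split=> //; split=> // z z1 z0.
have sz0 : s z != 0 by apply: contra_neq z0 => h; apply: sinj; rewrite ?cmod0// h s0.
have := limC_B (limC_M (limC_M (limC_cst z) (ls' z z1)) (limC_V sz0 (ls z z1))) (limC_cst 1).
congr limC; apply/funext => n.
have -> : z * (iter_deriv n z / lam ^+ n) / (iter n phi z / lam ^+ n) = z * iter_deriv n z / iter n phi z.
  by field; rewrite iter_neq0// expf_neq0.
by rewrite log_derivative// addrAC subrr add0r.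
Qed.

End Koenigs.


(** * The flow on a starlike Koenigs domain *)

Section Starlike.
Set Implicit Arguments.
Unset Strict Implicit.
Variable R : realType.
Local Notation C := (Cplx R).
Local Notation udisc := (@udisc R).
Implicit Types (z w y v : C) (t e : R).
Variables (s s' : C -> C).
Hypothesis us : udiff udisc s s'.
Hypothesis s0 : s 0 = 0.
Hypothesis s'0 : s' 0 = 1.
Hypothesis sinj : forall z w, cmod z <= 1 -> cmod w <= 1 -> s z = s w -> z = w.
Hypothesis sstar : forall z, cmod z <= 1 -> z != 0 -> 0 < complex.Re (z * s' z / s z).

Definition koenigs_range : set C := [set w | exists2 z, cmod z <= 1 & s z = w].

(** The inverse of [s], set to 0 outside [koenigs_range]. The flow is [tau (c * s z)], with [c] real
    or complex. *)
Definition tau w : C := xget 0 [set z | cmod z <= 1 /\ s z = w].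

Lemma tauP w : koenigs_range w -> cmod (tau w) <= 1 /\ s (tau w) = w.
Proof.
move=> [z z1 zw]; suff : [set z | cmod z <= 1 /\ s z = w] (tau w) by [].
by apply: xgetPex; exists z.
Qed.

Lemma tauK z : cmod z <= 1 -> tau (s z) = z.
Proof.
move=> z1; have [|h1 h2] := @tauP (s z); first by exists z.
exact: sinj.
Qed.

Lemma cmod0_le1 : cmod (0 : C) <= 1. Proof. by rewrite cmod0. Qed.

Lemma tau0 : tau 0 = 0. Proof. by rewrite -{1}s0 tauK// cmod0_le1. Qed.

Lemma s_neq0 z : cmod z <= 1 -> z != 0 -> s z != 0.
Proof. by move=> z1; apply: contra_neq => h; apply: sinj; rewrite ?cmod0_le1// h s0. Qed.

(** Away from 0, a zero of [s'] would annihilate [z * s' z / s z], against its positive real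
    part. *)
Lemma s'_neq0 z : cmod z <= 1 -> s' z != 0.
Proof.
move=> z1; have [->|z0] := eqVneq z 0; first by rewrite s'0 oner_eq0.
by apply: contraTneq (sstar z1 z0) => ->; rewrite mulr0 mul0r ltxx.
Qed.

Lemma s'_lower : exists2 m : R, 0 < m & forall z, cmod z <= 1 -> m <= cmod (s' z).
Proof.
have [|||z z1 Hz] := @min_attained _ udisc (fun z => cmod (s' z)) (@disc_cpt _ 1).
- by exists 0; exact: cmod0_le1.
- by move=> z _; exact: cmod_ge0.
- move=> z z1 e /(udiff_dcont us)[d d0 Hd]; exists d => // w w1 /(Hd _ _ z1 w1).
  apply: le_lt_trans; have := cmod_triB (s' z) (s' w); have := cmod_triB (s' w) (s' z).
  by rewrite (cmodC (s' z) (s' w)) ler_norml => h1 h2; apply/andP; split; lra.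
by exists (cmod (s' z)) => //; rewrite cmod_gt0 s'_neq0.
Qed.

Lemma limC_contC (K : set C) (f : C -> C) (u : nat -> C) l : cont_onC K f -> K l ->
  (forall n, K (u n)) -> limC u l -> limC (fun n => f (u n)) (f l).
Proof.
move=> cf Kl Ku ul e /(cf l Kl)[d d0 Hd]; have [N HN] := ul _ d0.
by exists N => n /HN; exact: Hd.
Qed.

(** A continuous injection on a compact set has a uniformly continuous inverse: bad pairs would
    accumulate at two distinct points with the same image. *)
Lemma s_inv_cont e : 0 < e -> exists2 d, 0 < d & forall u v, cmod u <= 1 -> cmod v <= 1 ->
  cmod (s u - s v) < d -> cmod (u - v) < e.
Proof.
move=> e0; apply: contrapT => H.
have /choice[u Hu] (n : nat) : exists p : C * C, [/\ cmod p.1 <= 1, cmod p.2 <= 1,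
    cmod (s p.1 - s p.2) < n.+1%:R^-1 & e <= cmod (p.1 - p.2)].
  apply: contrapT => H'; apply: H.
  exists (n.+1%:R^-1); first by rewrite invr_gt0 ltr0n.
  move=> a b a1 b1 h; rewrite ltNge; apply/negP => h'; apply: H'.
  by exists (a, b).
have [n|a [t [a1 Ht cva]]] := @disc_cpt _ 1 (fst \o u); first by have [] := Hu n.
have [n|b [t' [b1 Ht' cvb]]] := @disc_cpt _ 1 (snd \o u \o t); first by have [] := Hu (t n).
have {}cva := limC_sub_seq Ht' cva.
have csu := limC_contC (udiff_contC us) a1 (u := (fst \o u \o t) \o t') _ cva.
have csv := limC_contC (udiff_contC us) b1 (u := (snd \o u \o t) \o t') _ cvb.
have {}csu : limC (fun n => s (u (t (t' n))).1) (s a).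
  by apply: csu => n; have [] := Hu (t (t' n)).
have {}csv : limC (fun n => s (u (t (t' n))).2) (s b).
  by apply: csv => n; have [] := Hu (t (t' n)).
have sab : s a = s b.
  apply: limC_uniq (limC_sub csu _) csv.
  move=> d /invS_lt[N HN]; exists N => n Nn; rewrite subr0.
  have [_ _ h _] := Hu (t (t' n)); apply: lt_trans h (HN _ _).
  exact: leq_trans Nn (leq_trans (Ht' n) (Ht _)).
have ab := sinj a1 b1 sab.
have := limC_B cva cvb; rewrite ab subrr => /(_ e e0)[N /(_ N (leqnn _))].
by rewrite subr0 /= => h; have [_ _ _] := Hu (t (t' N)); rewrite leNgt h.
Qed.

Lemma tau_cont e : 0 < e -> exists2 d, 0 < d & forall w w', koenigs_range w -> koenigs_range w' ->
  cmod (w' - w) < d -> cmod (tau w' - tau w) < e.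
Proof.
move=> /s_inv_cont[d d0 Hd]; exists d => // w w' /tauP[a1 a2] /tauP[b1 b2] h.
by apply: Hd => //; rewrite a2 b2.
Qed.

Lemma udiff_tau : udiff koenigs_range tau (fun w => (s' (tau w))^-1).
Proof.
have [m m0 Hm] := s'_lower; split.
- by exists 1 => w /tauP[].
- exists m^-1 => w /tauP[h _]; rewrite cmodV lef_pV2 ?posrE// ?Hm//.
  by apply: lt_le_trans m0 _; exact: Hm.
move=> e e0; have [_ _ H] := us.
(* The first entry gives [|x| <= 2 |w' - w| / m]; inserting this in the error of [s], divided by
   [s'], the second entry leaves at most [e |w' - w|]. *)
pose e' := Num.min (m / 2) (e * m ^+ 2 / 2).
have e'0 : 0 < e' by rewrite lt_min !divr_gt0// mulr_gt0// exprn_gt0.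
have e1 : e' <= m / 2 by rewrite ge_min lexx.
have e2 : e' <= e * m ^+ 2 / 2 by rewrite ge_min lexx orbT.
have [d d0 Hd] := H _ e'0.
have [d' d'0 Hd'] := tau_cont d0.
exists d' => // w w' Ow Ow' h; have h2 := Hd' _ _ Ow Ow' h.
have [a1 a2] := tauP Ow; have [b1 b2] := tauP Ow'.
have h3 := Hd _ _ a1 b1 h2; rewrite a2 b2 in h3.
set x := tau w' - tau w in h2 h3 *.
have sn := Hm _ a1; have sp : 0 < cmod (s' (tau w)) by lra.
have nx := cmod_ge0 x.
have h4 := cmod_triB (s' (tau w) * x) (w' - w).
rewrite (cmodC (s' (tau w) * x) (w' - w)) cmodM in h4.
have h5 : m / 2 * cmod x <= cmod (w' - w) by nra.
have -> : x - (s' (tau w))^-1 * (w' - w) = - ((s' (tau w))^-1 * (w' - w - s' (tau w) * x)).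
  by field; rewrite s'_neq0.
rewrite cmodN cmodM cmodV ler_pdivrMl//.
apply: le_trans h3 _.
have : e' * cmod x <= e * m ^+ 2 / 2 * cmod x by rewrite ler_wpM2r.
have : e * m * (m / 2 * cmod x) <= e * m * cmod (w' - w).
  by apply: ler_wpM2l => //; rewrite mulr_ge0// ltW.
have : m * (e * cmod (w' - w)) <= cmod (s' (tau w)) * (e * cmod (w' - w)).
  by apply: ler_wpM2r => //; rewrite mulr_ge0 ?cmod_ge0// ltW.
rewrite expr2; lra.
Qed.

Lemma value_attained (r : R) w : r <= 1 -> 0 <= r ->
  (forall e, 0 < e -> exists2 v, cmod v <= r & cmod (s v - w) < e) ->
  exists2 v, cmod v <= r & s v = w.
Proof.
move=> r1 r0 H.
have [|||v v1 Hv] := @min_attained _ [set z | cmod z <= r] (fun z => cmod (s z - w)) (@disc_cpt _ r).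
- by exists 0; have : cmod (0 : C) <= r by rewrite cmod0.
- by move=> z _; exact: cmod_ge0.
- move=> z /= z1 e /(udiff_cont us)[d d0 Hd]; exists d => // y y1 h.
  have := Hd z y (le_trans z1 r1) (le_trans y1 r1) h; apply: le_lt_trans.
  have := cmod_triB (s y - w) (s z - w); have := cmod_triB (s z - w) (s y - w).
  rewrite !opprB !addrA !subrK (cmodC (s z) (s y)) => h1 h2.
  by rewrite ler_norml; apply/andP; split; lra.
exists v => //; apply/eqP; rewrite -subr_eq0 -cmod_eq0 eq_le cmod_ge0 andbT.
apply/ler_addgt0Pr => e /H[y y1 h]; rewrite add0r.
by apply: le_trans (Hv y y1) (ltW h).
Qed.

(* A point of the open disc minimising [|s v - w|] must satisfy [s v = w],
   since moving along [(w - s v) / s' v] decreases this distance. *)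
Lemma interior_min v w : cmod v < 1 -> (forall y, cmod y <= 1 -> cmod (s v - w) <= cmod (s y - w)) ->
  s v = w.
Proof.
move=> v1 vmin; apply/eqP; rewrite -subr_eq0; apply/negPn/negP => Dn0.
have s'v := s'_neq0 (ltW v1).
have sp : 0 < cmod (s' v) / 2 by rewrite divr_gt0// cmod_gt0.
have [_ _ H] := us; have [d d0 Hd] := H _ sp.
pose D := w - s v.
have Dp : 0 < cmod D by rewrite cmodC cmod_gt0.
pose q := D / s' v.
have qp : 0 < cmod q by rewrite cmodM cmodV divr_gt0// cmod_gt0.
pose t := Num.min 1 (Num.min ((1 - cmod v) / cmod q) (d / 2 / cmod q)).
have t0 : 0 < t by rewrite !lt_min ltr01 !divr_gt0//= ?subr_gt0.
have t1 : t <= 1 by rewrite ge_min lexx.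
have t2 : t * cmod q <= 1 - cmod v by rewrite -ler_pdivlMr// !ge_min lexx !orbT.
have t3 : t * cmod q <= d / 2 by rewrite -ler_pdivlMr// !ge_min lexx !orbT.
pose y := v + rc t * q.
have nyv : cmod (y - v) = t * cmod q.
  by rewrite /y [v + _]addrC addrK cmodM cmod_rc gtr0_norm.
have y1 : cmod y <= 1.
  by have := cmodD v (rc t * q); rewrite cmodM cmod_rc gtr0_norm// -/y; lra.
have ydv : cmod (y - v) < d by rewrite nyv; lra.
have := Hd _ _ (ltW v1) y1 ydv.
have -> : s' v * (y - v) = rc t * D by rewrite /y /q; field; exact: s'v.
rewrite nyv => h.
have qD : cmod (s' v) * cmod q = cmod D by rewrite -cmodM /q mulrC divfK.
have := vmin y y1; rewrite (cmodC (s v) w) -/D.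
have -> : s y - w = (s y - s v - rc t * D) - rc (1 - t) * D by rewrite rcB rc1 /D; ring.
have := cmodB (s y - s v - rc t * D) (rc (1 - t) * D).
rewrite cmodM cmod_rc ger0_norm ?subr_ge0//.
have : cmod (s' v) / 2 * (t * cmod q) = t / 2 * cmod D by rewrite -qD; ring.
have : 0 < t * cmod D by rewrite mulr_gt0.
nra.
Qed.

(** A minimiser [v] of [|s v - w|] satisfies [|s v - s y| <= 2 |w - s y|], so [s_inv_cont] keeps it
    off the unit circle and [interior_min] applies. The radius is uniform in [y]. *)
Lemma open_mapping (r : R) : r < 1 -> exists2 d, 0 < d & forall y w, cmod y <= r ->
  cmod (w - s y) < d -> koenigs_range w.
Proof.
move=> r1; have e0 : 0 < 1 - r by lra.
have [d d0 Hd] := s_inv_cont e0.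
exists (d / 2); first by rewrite divr_gt0.
move=> y w yr wy.
have [|||v v1 Hv] := @min_attained _ udisc (fun z => cmod (s z - w)) (@disc_cpt _ 1).
- by exists 0; exact: cmod0_le1.
- by move=> z _; exact: cmod_ge0.
- move=> z /= z1 e /(udiff_cont us)[d' d'0 Hd']; exists d' => // x x1 h.
  have := Hd' z x z1 x1 h; apply: le_lt_trans.
  have := cmod_triB (s x - w) (s z - w); have := cmod_triB (s z - w) (s x - w).
  rewrite !opprB !addrA !subrK (cmodC (s z) (s x)) => h1 h2.
  by rewrite ler_norml; apply/andP; split; lra.
have y1 : cmod y <= 1 by lra.
have v_lt1 : cmod v < 1.
  rewrite lt_def v1 andbT; apply/eqP => nv1.
  have : cmod (v - y) < 1 - r.
    apply: Hd => //; have := Hv y y1; have := cmod_tri w (s v) (s y).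
    rewrite (cmodC (s y) w); lra.
  by have := cmod_triB v y; rewrite -nv1; lra.
by exists v => //; apply: interior_min.
Qed.

(* The curve [t |-> tau (t s y)] starts at [y] for [t = 1] and points inwards as
   [t] decreases, because its velocity is [- s y / s' y = - y / p] where
   [p = y s' y / s y] has positive real part. *)
Lemma descent y : cmod y <= 1 -> y != 0 -> exists2 h, 0 < h & forall e, 0 < e -> e < h ->
  koenigs_range (rc (1 - e) * s y) -> cmod (tau (rc (1 - e) * s y)) < cmod y.
Proof.
move=> y1 y0; have sy0 := s_neq0 y1 y0; have s'y0 := s'_neq0 y1.
pose a := s y / (y * s' y).
have yp : 0 < cmod y by rewrite cmod_gt0.
have syp : 0 < cmod (s y) by rewrite cmod_gt0.
have ra : 0 < complex.Re a.
  pose p := y * s' y / s y.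
  have sqnorm : p != 0 by rewrite mulf_neq0 ?invr_neq0// mulf_neq0.
  have pp : 0 < cmod p ^+ 2 by rewrite exprn_gt0// cmod_gt0.
  have -> : a = rc ((cmod p ^+ 2)^-1) * p^*.
    have -> : a = p^-1 by rewrite /p invf_div.
    have : p^* != 0 by rewrite conjC_eq0.
    rewrite rcV -cmod_mulconj; move: (p^*) => q q0; field; by rewrite sqnorm q0.
  rewrite Re_rcM (_ : complex.Re p^* = complex.Re p); last by case: (p).
  by rewrite mulr_gt0 ?invr_gt0// sstar.
(* The linear part gains [e |y| Re a / 2]; this choice limits the expansion error to half of that
   gain. *)
pose e' := cmod y * complex.Re a / 4 / cmod (s y).
have e'0 : 0 < e' by rewrite !divr_gt0// mulr_gt0.
have Oy : koenigs_range (s y) by exists y.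
have [_ _ H] := udiff_tau; have [d d0 Hd] := H _ e'0.
pose A := cmod a ^+ 2 + 1.
have A0 : 0 < A by rewrite ltr_wpDl// sqr_ge0.
pose h := Num.min (d / cmod (s y)) (Num.min (complex.Re a / A) (1 / complex.Re a)).
have h0 : 0 < h by rewrite !lt_min !divr_gt0.
exists h => // e e0; rewrite /h !lt_min => /and3P[].
rewrite !ltr_pdivlMr// => k1 k2 k3 Oe.
have dB : rc (1 - e) * s y - s y = - (rc e * s y) by rewrite rcB rc1; ring.
have nB : cmod (rc (1 - e) * s y - s y) = e * cmod (s y).
  by rewrite dB cmodN cmodM cmod_rc gtr0_norm.
have := Hd _ _ Oy Oe; rewrite nB => /(_ k1).
rewrite tauK// dB.
set T := tau _.
have -> : T - y - (s' y)^-1 * - (rc e * s y) = T - y * (1 - rc e * a).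
  by rewrite /a; field; rewrite y0 s'y0.
have -> : e' * (e * cmod (s y)) = e * (cmod y * complex.Re a) / 4.
  by rewrite /e'; field; rewrite gt_eqF.
have := cmod_triB T (y * (1 - rc e * a)); rewrite cmodM.
have : cmod (1 - rc e * a) <= 1 - e * complex.Re a / 2.
  rewrite -ler_sqr ?nnegrE ?cmod_ge0//; last by lra.
  rewrite cmod_sq ReB ImB Re_rcM (_ : complex.Re (1 : C) = 1)// (_ : complex.Im (1 : C) = 0)//.
  have -> : complex.Im (rc e * a) = e * complex.Im a by case: (a) => x x' /=; ring.
  have E : (1 - e * complex.Re a) ^+ 2 + (0 - e * complex.Im a) ^+ 2 =
     1 - 2 * e * complex.Re a + e * (e * cmod a ^+ 2) by rewrite cmod_sq; ring.
  rewrite E; have : e * cmod a ^+ 2 <= complex.Re a by rewrite /A in k2; nra.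
  nra.
set X := cmod (1 - _) => hX h1 h2.
have : cmod y * X <= cmod y * (1 - e * complex.Re a / 2) by rewrite ler_wpM2l// ltW.
have : 0 < e * (cmod y * complex.Re a) by rewrite !mulr_gt0.
lra.
Qed.

(** Continuity method: the infimum of the attainable parameters in [[t0, 1]] is attained by
    compactness. If it exceeded [t0], [open_mapping] would allow a smaller parameter and [descent]
    would keep its preimage in the disc of radius [|z|]. *)
Lemma star_interior z t0 : cmod z < 1 -> 0 < t0 -> t0 <= 1 ->
  exists2 y, cmod y <= cmod z & s y = rc t0 * s z.
Proof.
move=> z1 t00 t01.
have [->|z0] := eqVneq z 0; first by exists 0 => //; rewrite s0 mulr0.
pose S := [set t | [/\ t0 <= t, t <= 1 & exists2 y, cmod y <= cmod z & s y = rc t * s z]].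
have S1 : S 1 by split=> //; exists z => //; rewrite rc1 mul1r.
have hS : has_inf S by split; [exists 1|exists t0 => t []].
pose T := inf S.
have T0 : t0 <= T by apply: lb_le_inf; [exists 1|move=> t []].
have T1 : T <= 1 by apply: (ge_inf (proj2 hS)).
have sz0 := s_neq0 (ltW z1) z0.
have szp : 0 < cmod (s z) by rewrite cmod_gt0.
have [y yz syT] : exists2 y, cmod y <= cmod z & s y = rc T * s z.
  apply: value_attained; [exact: ltW|exact: cmod_ge0|move=> e e0].
  have e1 : 0 < e / cmod (s z) by rewrite divr_gt0.
  have [t St] := inf_adherent e1 hS; have [_ _ [v vz sv]] := St.
  rewrite -/T => tT; exists v => //.
  have Tt : T <= t by apply: (ge_inf (proj2 hS)).
  rewrite sv -mulrBl -rcB cmodM cmod_rc ger0_norm ?subr_ge0// -ltr_pdivlMr//; lra.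
have [<-|T_neq] := eqVneq T t0; first by exists y.
exfalso.
have tT : t0 < T by rewrite lt_def T_neq.
have y1 : cmod y <= 1 by lra.
have y0 : y != 0.
  apply: contra_neq sz0 => yE; move: syT; rewrite yE s0 => /esym/eqP.
  by rewrite mulf_eq0 -(rc0 R) (inj_eq (@rc_inj R)) gt_eqF ?orFb//=; [move/eqP|lra].
have [d d0 Hd] := open_mapping z1.
have [h h0 Hh] := descent y1 y0.
pose e := Num.min (h / 2) (Num.min (d / 2 / (cmod (s y) + 1)) ((T - t0) / T)).
have T00 : 0 < T by lra.
have syn : 0 < cmod (s y) + 1 by have := cmod_ge0 (s y); lra.
have e0 : 0 < e by rewrite !lt_min !divr_gt0//= subr_gt0.
have e1 : e <= h / 2 by rewrite ge_min lexx.
have e2 : e * (cmod (s y) + 1) <= d / 2 by rewrite -ler_pdivlMr// !ge_min lexx !orbT.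
have e3 : e * T <= T - t0 by rewrite -ler_pdivlMr// !ge_min lexx !orbT.
have Oe : koenigs_range (rc (1 - e) * s y).
  apply: (Hd y) => //.
  rewrite (_ : _ - _ = - (rc e * s y)); last by rewrite rcB rc1; ring.
  by rewrite cmodN cmodM cmod_rc gtr0_norm//; lra.
have eh : e < h by lra.
have := Hh e e0 eh Oe; have [v1 v2] := tauP Oe; set v := tau _ in v1 v2 * => vy.
have Sv : S ((1 - e) * T).
  split; [lra|nra|exists v; first by lra].
  by rewrite v2 syT mulrA rcM.
have := ge_inf (proj2 hS) Sv; rewrite -/T; nra.
Qed.

Lemma flow_starlike z t : cmod z <= 1 -> 0 < t -> t <= 1 ->
  koenigs_range (rc t * s z) /\ cmod (tau (rc t * s z)) <= cmod z.
Proof.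
move=> z1 t0 t1; suff [y yz sy] : exists2 y, cmod y <= cmod z & s y = rc t * s z.
  by rewrite -sy tauK; [split=> //; exists y => //|]; apply: le_trans z1.
have [zlt|zge] := ltP (cmod z) 1; first exact: star_interior.
apply: value_attained => [||e e0]; [exact: z1|exact: cmod_ge0|].
have [d d0 Hd] := udiff_cont us e0.
pose x := Num.min (d / 2) (1 / 2) : R.
have x0 : 0 < x by rewrite lt_min !divr_gt0.
have xd : x <= d / 2 by rewrite ge_min lexx.
have x1 : x <= 1 / 2 by rewrite ge_min lexx orbT.
pose z' := rc (1 - x) * z.
have z'1 : cmod z' < 1 by rewrite cmodM cmod_rc ger0_norm; [nra|lra].
have [y yz sy] := star_interior z'1 t0 t1.
exists y; first by lra.
rewrite sy -mulrBr cmodM cmod_rc gtr0_norm//.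
have : cmod (s z' - s z) < e.
  apply: Hd => //; first exact: ltW.
  rewrite (_ : z' - z = - (rc x * z)); last by rewrite /z' rcB rc1; ring.
  by rewrite cmodN cmodM cmod_rc gtr0_norm//; nra.
have := cmod_ge0 (s z' - s z); nra.
Qed.

(** From a boundary point, [descent] gives a strict decrease for the factor [1 - e]; the remaining
    factor [t / (1 - e)] does not increase the modulus. *)
Lemma flow_lt1 z t : cmod z <= 1 -> 0 < t -> t < 1 -> cmod (tau (rc t * s z)) < 1.
Proof.
move=> z1 t0 t1; have [_ h] := flow_starlike z1 t0 (ltW t1).
have [zlt|zge] := ltP (cmod z) 1; first exact: le_lt_trans h zlt.
have z0 : z != 0 by rewrite -cmod_gt0; lra.
have [d d0 Hd] := descent z1 z0.
pose e := Num.min (d / 2) (1 - t).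
have e0 : 0 < e by rewrite lt_min divr_gt0//= subr_gt0.
have e1 : e <= d / 2 by rewrite ge_min lexx.
have e2 : e <= 1 - t by rewrite ge_min lexx orbT.
have ep : 0 < 1 - e by lra.
have e3 : 1 - e <= 1 by lra.
have [Oe _] := flow_starlike z1 ep e3.
have ed : e < d by lra.
have := Hd e e0 ed Oe; have [y1 sy] := tauP Oe; set y := tau _ in y1 sy * => yz.
have q0 : 0 < t / (1 - e) by rewrite divr_gt0.
have q1 : t / (1 - e) <= 1 by rewrite ler_pdivrMr// mul1r; lra.
have [_] := flow_starlike y1 q0 q1.
rewrite sy mulrA -rcM divfK ?gt_eqF//; lra.
Qed.

Lemma udiff_flow (c : C) : (forall z, cmod z <= 1 -> koenigs_range (c * s z)) ->
  exists f' : C -> C, udiff udisc (fun z => tau (c * s z)) f'.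
Proof.
move=> H; exists (fun z => (s' (tau (c * s z)))^-1 * (c * s' z)).
exact: (udiff_comp udiff_tau (udiff_scale c us) H).
Qed.

Lemma s_bdd : exists2 M : R, 0 < M & forall z, cmod z <= 1 -> cmod (s z) <= M.
Proof. by have [b _ _] := us; exact: bdd_pos b. Qed.

Lemma flow_nbhs t0 : 0 < t0 -> t0 < 1 -> exists d r : R, [/\ 0 < d, 0 <= r, r < 1 &
  forall (c : C) z, cmod (c - rc t0) <= d -> cmod z <= 1 ->
    koenigs_range (c * s z) /\ cmod (tau (c * s z)) <= r].
Proof.
move=> t00 t01; have [M M0 sM] := s_bdd.
have [|f' uf] := @udiff_flow (rc t0).
  by move=> z z1; have [] := flow_starlike z1 t00 (ltW t01).
have [r [r0 r1 Hr]] := udiff_radius uf (fun z (z1 : cmod z <= 1) => flow_lt1 z1 t00 t01).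
have [d d0 Hd] := open_mapping r1.
have e0 : 0 < (1 - r) / 2 by lra.
have [d' d'0 Hd'] := tau_cont e0.
pose D := Num.min d d' / 2 / M.
have D0 : 0 < D by rewrite !divr_gt0// lt_min d0.
have DM : D * M < d /\ D * M < d'.
  rewrite /D divfK ?gt_eqF//.
  have : Num.min d d' <= d by rewrite ge_min lexx.
  have : Num.min d d' <= d' by rewrite ge_min lexx orbT.
  by split; lra.
exists D, ((1 + r) / 2); split; [by []|lra|lra|move=> c z cD z1].
have [oz1 _] := flow_starlike z1 t00 (ltW t01); have [y1 sy] := tauP oz1.
have dist : cmod (c * s z - rc t0 * s z) <= D * M.
  by rewrite -mulrBl cmodM; apply: ler_pM; rewrite ?cmod_ge0// sM.
have Oc : koenigs_range (c * s z).
  by apply: (Hd (tau (rc t0 * s z))); [exact: Hr|rewrite sy; lra].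
split=> //; have := Hd' _ _ oz1 Oc; have := cmod_triB (tau (c * s z)) (tau (rc t0 * s z)).
have := Hr z z1 => h1 h2 h3; have : cmod (c * s z - rc t0 * s z) < d' by lra.
by move/h3; lra.
Qed.

Lemma flow_nbhs0 : exists2 d : R, 0 < d & forall w, cmod w <= d -> koenigs_range w /\ cmod (tau w) <= 1 / 2.
Proof.
have [|d d0 Hd] := @open_mapping 0; first exact: ltr01.
have [|d' d'0 Hd'] := @tau_cont (1 / 2); first by lra.
exists (Num.min d d' / 2); first by rewrite divr_gt0// lt_min d0.
move=> w wd.
have h1 : Num.min d d' <= d by rewrite ge_min lexx.
have h2 : Num.min d d' <= d' by rewrite ge_min lexx orbT.
have Ow : koenigs_range w by apply: (Hd 0); rewrite ?cmod0// s0 subr0; lra.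
have O0 : koenigs_range 0 by exists 0; [exact: cmod0_le1|exact: s0].
split=> //; have := Hd' _ _ O0 Ow; rewrite tau0 !subr0 => h; apply/ltW/h; lra.
Qed.

Lemma flow_to1 e : 0 < e -> exists2 d : R, 0 < d & forall t z, 0 < t -> 1 - d < t -> t < 1 ->
  cmod z <= 1 -> cmod (tau (rc t * s z) - z) < e.
Proof.
move=> e0; have [M M0 sM] := s_bdd; have [d d0 Hd] := tau_cont e0.
exists (d / M); first by rewrite divr_gt0.
move=> t z t0 td t1 z1; have [oz1 _] := flow_starlike z1 t0 (ltW t1).
have Oz : koenigs_range (s z) by exists z.
rewrite -{2}(tauK z1); apply: Hd => //.
rewrite (_ : _ - _ = - (rc (1 - t) * s z)); last by rewrite rcB rc1; ring.
rewrite cmodN cmodM cmod_rc ger0_norm; last by lra.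
have : 1 - t < d / M by lra.
rewrite ltr_pdivlMr//; have := sM z z1; nra.
Qed.

End Starlike.


(** * Bounded functionals on the Hardy space *)

Section Functionals.
Set Implicit Arguments.
Unset Strict Implicit.
Variable R : realType.
Local Notation C := (Cplx R).
Local Notation udisc := (@udisc R).
Implicit Types (z w : C) (t e r : R) (f : H2 R).

Definition functional (l : H2 R -> C) := (forall c f g, l (c *: f + g) = c * l f + l g) /\
  exists2 L : R, 0 < L & forall f, cmod (l f) <= L * hnorm f.

Lemma functional_sum l (I : Type) (sq : seq I) (k : I -> C) (f : I -> H2 R) : functional l ->
  l (\sum_(i <- sq) k i *: f i) = \sum_(i <- sq) k i * l (f i).
Proof.
move=> [lin _]; elim: sq => [|i sq IH]; last by rewrite !big_cons lin IH.
have := lin 1 0 0; rewrite !big_nil scaler0 addr0 mul1r => h.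
by apply: (addrI (l 0)); rewrite -h addr0.
Qed.

Lemma functionalB l f g : functional l -> l f - l g = l (f - g).
Proof. by move=> [lin _]; have := lin (-1) g f; rewrite scaleN1r mulN1r [f - g]addrC [_ - l g]addrC. Qed.

Lemma H2_sum (I : Type) (sq : seq I) (k : I -> C) (f : I -> H2 R) z :
  (\sum_(i <- sq) k i *: f i) z = \sum_(i <- sq) k i * f i z.
Proof.
elim: sq => [|i sq IH]; first by rewrite !big_nil H20.
by rewrite !big_cons H2D H2Z IH.
Qed.

Lemma dot_functional (T : H2 R -> H2 R) y : bounded_op (@H2_dot R) T ->
  functional (fun f => H2_dot (T f) y).
Proof.
move=> /bounded_opP[lT [M M0 HM]]; split; first by move=> c f g; rewrite lT dot_lin.
exists (M * hnorm y + 1); first by rewrite ltr_wpDl// mulr_ge0 ?hnorm_ge0.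
move=> f; apply: le_trans (dot_le _ _) _.
have := hnorm_ge0 f; have := hnorm_ge0 y; have := HM f; have := hnorm_ge0 (T f).
move: (hnorm (T f)) (hnorm f) (hnorm y) => a b c a0 ab c0 b0.
have : a * c <= M * b * c by rewrite ler_wpM2r.
lra.
Qed.

Lemma discalg_near (g : C -> C) : (forall e, 0 < e -> exists2 h, discalg h & forall z, cmod z <= 1 -> cmod (g z - h z) <= e) -> discalg g.
Proof.
move=> H e e0; have e2 : 0 < e / 2 by lra.
have [h dh Hh] := H _ e2; have [p Hp] := dh _ e2.
exists p => z z1; have := Hh z z1; have := Hp z z1.
have := cmod_tri (h z) (g z) p.[z]; lra.
Qed.

Lemma discalg_sum (I : Type) (sq : seq I) (k : I -> C) (h : I -> C -> C) : (forall i, discalg (h i)) ->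
  discalg (fun z => \sum_(i <- sq) k i * h i z).
Proof.
move=> dh; elim: sq => [|i sq IH].
  move=> e e0; exists 0 => z _; rewrite big_nil horner0 subrr cmod0; exact: ltW.
by apply: discalg_ext (discalg_lin (k i) (dh i) IH) => z _; rewrite big_cons.
Qed.

(* A vector-valued version of [udiff] for the sup norm on the disc: a bounded
   functional maps it to a scalar [udiff] function. *)
Lemma udiff_functional l (F F' : C -> C -> C) (M : R) : functional l ->
  (forall u, udisc u -> discalg (F u)) ->
  (forall u z, udisc u -> cmod z <= 1 -> cmod (F u z) <= M /\ cmod (F' u z) <= M) ->
  (forall e, 0 < e -> exists2 d, 0 < d & forall u v z, udisc u -> udisc v -> cmod z <= 1 ->
     cmod (v - u) < d -> cmod (F v z - F u z - F' u z * (v - u)) <= e * cmod (v - u)) ->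
  udiff udisc (fun u => l (toH2 (F u))) (fun u => l (toH2 (F' u))).
Proof.
move=> fl dF FM FF'; have [lin [L L0 HL]] := fl.
have dF' u : udisc u -> discalg (F' u).
  move=> u1; apply: discalg_near => e e0; have [d d0 Hd] := FF' e e0.
  (* The difference quotient towards a nearby [v] approximates [F' u] uniformly in [z]; [v] is taken
     on the radius of [u], or on the real axis if [u = 0]. *)
  have [v [v1 vu vd]] : exists v, [/\ cmod v <= 1, v != u & cmod (v - u) < d].
    pose x := Num.min (d / 2) 1.
    have x0 : 0 < x by rewrite lt_min ltr01 divr_gt0.
    have xd : x <= d / 2 by rewrite ge_min lexx.
    have x1 : x <= 1 by rewrite ge_min lexx orbT.
    have nx : cmod (rc x) = x by rewrite cmod_rc gtr0_norm.
    have [->|un0] := eqVneq u 0.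
      exists (rc x); rewrite subr0 nx; split=> //; last by lra.
      by rewrite -cmod_gt0 nx.
    exists (u - rc x * u); split.
    - rewrite (_ : _ - _ = rc (1 - x) * u); last by rewrite rcB rc1; ring.
      rewrite cmodM cmod_rc ger0_norm ?subr_ge0//; have := cmod_ge0 u.
      have : cmod u <= 1 by []; nra.
    - rewrite -subr_eq0 addrAC subrr add0r oppr_eq0 mulf_neq0// -(rc0 R).
      by rewrite (inj_eq (@rc_inj R)) gt_eqF.
    - rewrite addrAC subrr add0r cmodN cmodM nx; have : cmod u <= 1 by []; have := cmod_ge0 u; nra.
  have vu0 : v - u != 0 by rewrite subr_eq0.
  exists (fun z => (v - u)^-1 * F v z + (- (v - u)^-1 * F u z + 0)).
    apply: discalg_lin; first exact: dF.
    apply: discalg_lin; first exact: dF.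
    by move=> a a0; exists 0 => z _; rewrite horner0 subrr cmod0; exact: ltW.
  move=> z z1; rewrite cmodC.
  rewrite (_ : _ - _ = (v - u)^-1 * (F v z - F u z - F' u z * (v - u))); last by field.
  by rewrite cmodM cmodV ler_pdivrMl ?cmod_gt0// [leRHS]mulrC; exact: Hd.
have bound (G : C -> C -> C) u : (forall z, cmod z <= 1 -> cmod (G u z) <= M) -> discalg (G u) -> cmod (l (toH2 (G u))) <= L * M.
  move=> GM dG; apply: le_trans (HL _) _; apply: ler_wpM2l; first exact: ltW.
  by apply: hnorm_toH2 => // z z1; apply: GM; rewrite z1.
split.
- exists (L * M) => u u1; apply: bound; last exact: dF.
  by move=> z z1; have [] := FM u z u1 z1.
- exists (L * M) => u u1; apply: (bound F' u); last exact: dF'.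
  by move=> z z1; have [] := FM u z u1 z1.
move=> e e0; have eL : 0 < e / L by rewrite divr_gt0.
have [d d0 Hd] := FF' _ eL; exists d => // u v u1 v1 uv.
have -> : l (toH2 (F v)) - l (toH2 (F u)) - l (toH2 (F' u)) * (v - u) =
    l ((toH2 (F v) - toH2 (F u)) - (v - u) *: toH2 (F' u)).
  rewrite -functionalB// -functionalB//; congr (_ - _).
  by have := lin (v - u) (toH2 (F' u)) 0; have := functionalB 0 0 fl; rewrite !subrr addr0 => <- ->; rewrite addr0 mulrC.
apply: le_trans (HL _) _; rewrite mulrC -ler_pdivlMr// mulrAC.
apply: (@hnorm_sub_le _ _ _ (fun z => F v z - F u z - F' u z * (v - u))).
- have h := discalg_lin (- (v - u)) (dF' u u1) (discalg_lin (-1) (dF u u1) (dF v v1)).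
  by apply: discalg_ext h => z _; ring.
- move=> z z1; rewrite H2D H2N H2Z !toH2E//; first by ring.
  + exact: dF'.
  + exact: dF.
  + exact: dF.
- by move=> z z1; apply: Hd => //; rewrite z1.
Qed.

Lemma discalg_zero_near0 g : discalg g -> (forall e, 0 < e -> exists2 z, 0 < cmod z & cmod z < e /\ g z = 0) ->
  forall z, cmod z < 1 -> g z = 0.
Proof.
move=> dg H; have [M HM] : exists M : R, forall z, cmod z = 1 -> cmod (g z) <= M.
  have [p Hp] := dg 1 ltr01.
  have [M HM] : bdd_on udisc (fun z => p.[z]) by have [g' []] := udiff_poly p.
  exists (M + 1) => z z1; have zz : cmod z <= 1 by rewrite z1.
  have := Hp z zz; have := HM z zz; have := cmod_triB (g z) p.[z]; lra.
have [a [a2 pa]] := discalg_coef dg HM.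
have M0 : 0 <= M by have := HM 1 (cmod1 _); have := cmod_ge0 (g 1); lra.
have a0 n : a n = 0.
  apply: (@psum_eq0 _ a M 1) => //.
    by move=> i; rewrite expr1n mulr1; exact: cmod_le_sum2.
  move=> e e0; have e1 : 0 < Num.min e 1 by rewrite lt_min e0 ltr01.
  have [z z0 [ze gz]] := H _ e1; move: ze; rewrite lt_min => /andP[ze z1].
  by exists z; split=> //; rewrite -gz; exact: pa.
move=> z z1; apply: limC_uniq (pa z z1) _.
rewrite (_ : (fun n => _) = fun=> 0); first exact: limC_cst.
by apply/funext => n; rewrite /psum big1// => i _; rewrite a0 mul0r.
Qed.

Lemma hnorm_tail f e : 0 < e -> exists N, hnorm (f - toH2 (fun z => (trunc f N).[z])) <= e.
Proof.
move=> e0; have e2 : 0 < e ^+ 2 by rewrite exprn_gt0.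
pose S n : R := \sum_(i < n) cmod (coef f i) ^+ 2.
have hs : has_sup (range S).
  by split; [exists (S 0%N), 0%N|exists (hnorm f ^+ 2) => _ [n _ <-]; exact: sum_le_hnorm].
have [_ [N _ <-] HN] := sup_adherent e2 hs.
have dp : discalg (fun z => (trunc f N).[z]) by have [g' ug] := udiff_poly (trunc f N); exact: udiff_discalg ug.
exists N; apply: hnorm_le; first exact: ltW.
move=> n.
have cE i : coef (toH2 (fun z => (trunc f N).[z])) i = (trunc f N)`_i.
  apply/eqP; rewrite -subr_eq0 -cmod_eq0 eq_le cmod_ge0 andbT.
  by apply: coef_close => // z _; rewrite subrr cmod0.
have dE i : coef (f - toH2 (fun z => (trunc f N).[z])) i = if (i < N)%N then 0 else coef f i.
  rewrite (@coef_lin _ (-1) (toH2 (fun z => (trunc f N).[z])) f); last first.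
    by move=> z _; rewrite H2D H2N mulN1r addrC.
  rewrite cE coef_poly; case: ifP => _; first by rewrite mulN1r addNr.
  by rewrite mulr0 add0r.
apply: (@le_trans _ _ (S (maxn n N) - S N)); last first.
  have : S (maxn n N) <= sup (range S) by apply: (ub_le_sup (proj2 hs)); exists (maxn n N).
  by move: HN; lra.
rewrite /S -!(big_mkord xpredT (fun i => cmod (coef f i) ^+ 2)) (big_cat_nat (leq0n N) (leq_maxr n N))/=.
rewrite addrAC subrr add0r.
apply: (@le_trans _ _ (\sum_(i < maxn n N) cmod (coef (f - toH2 (fun z => (trunc f N).[z])) i) ^+ 2)).
  rewrite (big_ord_widen (maxn n N) (fun i => cmod (coef (f - toH2 (fun z => (trunc f N).[z])) i) ^+ 2) (leq_maxl n N)).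
  rewrite [leRHS](bigID (fun i : 'I_(maxn n N) => (i < n)%N))/= lerDl.
  by rewrite sumr_ge0// => i _; exact: sqr_ge0.
rewrite -(big_mkord xpredT (fun i => cmod (coef (f - toH2 (fun z => (trunc f N).[z])) i) ^+ 2)).
rewrite (big_cat_nat (leq0n N) (leq_maxr n N))/= big_nat_cond big1 ?add0r.
  rewrite big_nat_cond [leRHS]big_nat_cond; apply: ler_sum => i /andP[/andP[Ni _] _].
  by rewrite dE ltnNge Ni.
by move=> i /andP[/andP[_ iN] _]; rewrite dE iN cmod0 expr0n.
Qed.

End Functionals.


(** * The commutant of the composition operator *)

Section Commutant.
Set Implicit Arguments.
Unset Strict Implicit.
Variable R : realType.
Local Notation C := (Cplx R).
Local Notation udisc := (@udisc R).
Implicit Types (z w y v : C) (t e r : R) (f g : H2 R).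
Variables (phi phi' : C -> C) (lam : C) (s s' : C -> C).
Hypothesis uphi : udiff udisc phi phi'.
Hypothesis phi0 : phi 0 = 0.
Hypothesis phi'0 : phi' 0 = lam.
Hypothesis phi_inj : forall z w, cmod z <= 1 -> cmod w <= 1 -> phi z = phi w -> z = w.
Hypothesis phi_lt1 : forall z, cmod z <= 1 -> cmod (phi z) < 1.
Hypothesis lam0 : lam != 0.
Hypothesis lam1 : cmod lam < 1.
Hypothesis us : udiff udisc s s'.
Hypothesis s0 : s 0 = 0.
Hypothesis s'0 : s' 0 = 1.
Hypothesis sinj : forall z w, cmod z <= 1 -> cmod w <= 1 -> s z = s w -> z = w.
Hypothesis sstar : forall z, cmod z <= 1 -> z != 0 -> 0 < complex.Re (z * s' z / s z).
Hypothesis sphi : forall z, cmod z <= 1 -> s (phi z) = lam * s z.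

Local Notation tau := (tau s).

Definition Cphi f : H2 R := toH2 (fun z => f (phi z)).

Lemma discalg_phi f : discalg (fun z => f (phi z)).
Proof. by have [r [r0 r1 Hr]] := udiff_radius uphi phi_lt1; exact: discalg_comp uphi r0 r1 Hr. Qed.

Lemma CphiE f z : cmod z < 1 -> Cphi f z = f (phi z).
Proof. by move=> z1; rewrite toH2E//; exact: discalg_phi. Qed.

Lemma Cphi_lin c f g : Cphi (c *: f + g) = c *: Cphi f + Cphi g.
Proof. by apply: H2_ext => z z1; rewrite H2D H2Z !CphiE. Qed.

Lemma Cphi_bounded : bounded_op (@H2_dot R) Cphi.
Proof.
apply/bounded_opP; split; first by move=> c f g; exact: Cphi_lin.
exists 1 => // f; rewrite mul1r.
by have [r [r0 r1 Hr]] := udiff_radius uphi phi_lt1; exact: littlewood uphi r0 r1 Hr phi0.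
Qed.

Lemma iter_le1 N z : cmod z <= 1 -> cmod (iter N phi z) <= 1.
Proof. by move=> z1; elim: N => // N IH; rewrite iterS ltW// phi_lt1. Qed.

Lemma iter_Cphi N f z : cmod z < 1 -> iter N Cphi f z = f (iter N phi z).
Proof.
elim: N z => // N IH z z1; rewrite iterS CphiE// IH ?iterSr//.
exact: phi_lt1 (ltW z1).
Qed.

Lemma s_iter N z : cmod z <= 1 -> s (iter N phi z) = lam ^+ N * s z.
Proof.
move=> z1; elim: N => [|N IH]; first by rewrite mul1r.
by rewrite iterS sphi ?iter_le1// IH exprS mulrA.
Qed.

(** The iterates of [phi] are the flow at the complex parameters [lam ^+ N]. *)
Lemma tau_iter N z : cmod z <= 1 -> tau (lam ^+ N * s z) = iter N phi z.
Proof. by move=> z1; rewrite -s_iter// tauK// iter_le1. Qed.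

Definition koenigs_pow n : H2 R := toH2 (fun z => s z ^+ n).

Lemma discalg_koenigs_pow n : discalg (fun z => s z ^+ n).
Proof. by have [g' ug] := udiff_X n us; exact: udiff_discalg ug. Qed.

Lemma koenigs_powE n z : cmod z < 1 -> koenigs_pow n z = s z ^+ n.
Proof. by move=> z1; rewrite toH2E//; exact: discalg_koenigs_pow. Qed.

Lemma Cphi_koenigs_pow n : Cphi (koenigs_pow n) = lam ^+ n *: koenigs_pow n.
Proof.
apply: H2_ext => z z1; rewrite H2Z CphiE// !koenigs_powE//; last exact: phi_lt1 (ltW z1).
by rewrite sphi ?ltW// exprMn.
Qed.

(** * Eigenvectors of the composition operator *)

Lemma lead_coef_lim f k (u : nat -> C) : (forall j, (j < k)%N -> coef f j = 0) ->
  limC u 0 -> (forall n, u n != 0 /\ cmod (u n) <= 1 / 2) ->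
  limC (fun n => f (u n) / u n ^+ k) (coef f k).
Proof.
(* The factor 2 bounds [1 / (1 - |u n|)] for [|u n| <= 1 / 2]; the added 1 allows division by
   [A]. *)
move=> fk ul u0 e e0; pose A := hnorm f * 2 + 1.
have A0 : 0 < A by rewrite /A; have := hnorm_ge0 f; lra.
have e1 : 0 < e / A by rewrite divr_gt0.
have [N HN] := ul _ e1; exists N => n /HN; rewrite subr0 ltr_pdivlMr// => h.
have [un0 un] := u0 n; have up : 0 < cmod (u n) by rewrite cmod_gt0.
have u1 : cmod (u n) < 1 by lra.
have := pseries_tail k.+1 (coef_le_hnorm f) (proj2 (coefP f)) (lexx _) u1.
rewrite {1}/psum big_ord_recr/= big1 ?add0r; last by move=> i _; rewrite fk ?mul0r.
move=> h2.
have -> : f (u n) / u n ^+ k - coef f k = (f (u n) - coef f k * u n ^+ k) / u n ^+ k.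
  by field; rewrite expf_neq0.
rewrite cmodM cmodV cmodX ltr_pdivrMr ?exprn_gt0//; apply: le_lt_trans h2 _.
have -> : hnorm f * (cmod (u n) ^+ k.+1 / (1 - cmod (u n))) = (hnorm f / (1 - cmod (u n))) * cmod (u n) * cmod (u n) ^+ k.
  by rewrite exprS; field; rewrite gt_eqF// subr_gt0.
rewrite ltr_pM2r ?exprn_gt0//; apply: le_lt_trans h; rewrite mulrC; apply: ler_wpM2l; first exact: ltW.
rewrite ler_pdivrMr ?subr_gt0// /A; have := hnorm_ge0 f; nra.
Qed.

(* Comparing the leading terms of [f \o phi] and [mu f] at 0. *)
Lemma eigen_order f (mu : C) k : (forall z, cmod z < 1 -> f (phi z) = mu * f z) ->
  (forall j, (j < k)%N -> coef f j = 0) -> coef f k != 0 -> mu = lam ^+ k.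
Proof.
move=> fmu fk ck.
have udisc0 : udisc 0 by have : cmod (0 : C) <= 1 by rewrite cmod0.
have e2 : (0 : R) < 1 / 2 by lra.
have [d d0 Hd] := udiff_cont uphi e2.
have [N HN] : exists N, forall n, (N <= n)%N -> (n.+1%:R^-1 : R) < Num.min d (1 / 2).
  by apply: invS_lt; rewrite lt_min d0 e2.
pose u n : C := rc (n + N).+1%:R^-1.
have up n : 0 < ((n + N).+1%:R^-1 : R) by rewrite invr_gt0 ltr0n.
have nu n : cmod (u n) = (n + N).+1%:R^-1 by rewrite cmod_rc gtr0_norm.
have un0 n : u n != 0 by rewrite -cmod_gt0 nu.
have ud2 n : cmod (u n) < d /\ cmod (u n) <= 1 / 2.
  have := HN (n + N)%N (leq_addl _ _); rewrite -nu lt_min => /andP[h1 h2]; split=> //.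
  exact: ltW.
have u1 n : cmod (u n) <= 1 by have [_ h] := ud2 n; lra.
have ul : limC u 0.
  move=> e /invS_lt[M HM]; exists M => n Mn; rewrite subr0 nu; apply: HM.
  exact: leq_trans Mn (leq_addr _ _).
pose v n := phi (u n).
have vl : limC v 0.
  rewrite -phi0; exact: (limC_contC (udiff_contC uphi) udisc0 u1 ul).
have v0 n : v n != 0.
  by apply: contra_neq (un0 n) => h; apply: phi_inj => //; rewrite phi0.
have v2 n : cmod (v n) <= 1 / 2.
  by have := Hd 0 (u n) udisc0 (u1 n); rewrite phi0 !subr0 => h; apply/ltW/h; have [] := ud2 n.
have Lv := lead_coef_lim fk vl (fun n => conj (v0 n) (v2 n)).
have Lu := lead_coef_lim fk ul (fun n => conj (un0 n) (proj2 (ud2 n))).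
have vu : limC (fun n => v n / u n) lam.
  move=> e e0; have e1 : 0 < e / 2 by lra.
  have [d' d'0 Hd'] := udiff_diff_within uphi udisc0 e1.
  have [M HM] := ul _ d'0; exists M => n Mn.
  have h := HM n Mn; have := Hd' (u n) (u1 n) h.
  rewrite phi0 phi'0 !subr0 => h2.
  have -> : v n / u n - lam = (v n - lam * u n) / u n by rewrite mulrBl mulfK.
  have un : 0 < cmod (u n) by rewrite cmod_gt0.
  by rewrite cmodM cmodV ltr_pdivrMr//; apply: le_lt_trans h2 _; rewrite ltr_pM2r//; lra.
have L1 := limC_M Lv (limC_X k vu).
have L2 := limC_M (limC_cst mu) Lu.
have : coef f k * lam ^+ k = mu * coef f k.
  apply: limC_uniq L1 _; move: L2; congr limC; apply/funext => n.
  have u_lt1 : cmod (u n) < 1 by have [_ h] := ud2 n; lra.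
  rewrite /v fmu// -/(v n) expr_div_n; field.
  by rewrite !expf_neq0.
by rewrite [mu * _]mulrC => /(mulfI ck).
Qed.

Lemma lam_exp_inj m n : lam ^+ m = lam ^+ n -> m = n.
Proof.
move=> h; have : cmod lam ^+ m = cmod lam ^+ n by rewrite -!cmodX h.
by apply: ieexprIn; [rewrite cmod_gt0|rewrite lt_eqF].
Qed.

Lemma eigen_coef0 f n : (forall z, cmod z < 1 -> f (phi z) = lam ^+ n * f z) ->
  coef f n = 0 -> f = 0.
Proof.
move=> fn cn; apply: H2_coef0; elim/ltn_ind => k IH.
apply/eqP/negPn/negP => ck; have /lam_exp_inj nk := eigen_order fn IH ck.
by move: ck; rewrite -nk cn eqxx.
Qed.

(** By [eigen_coef0] an eigenvector is determined by its n-th coefficient. That of [s^n] is nonzero,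
    since otherwise [s^n] would vanish, whereas [s] is nonzero at 1/2. *)
Lemma eigen f n : (forall z, cmod z < 1 -> f (phi z) = lam ^+ n * f z) ->
  exists c, f = c *: koenigs_pow n.
Proof.
move=> fn.
have sn z : cmod z < 1 -> koenigs_pow n (phi z) = lam ^+ n * koenigs_pow n z.
  by move=> z1; rewrite -CphiE// Cphi_koenigs_pow H2Z.
pose z1 : C := rc (1 / 2).
have nz1 : cmod z1 = 1 / 2 by rewrite cmod_rc ger0_norm//; lra.
have b0 : coef (koenigs_pow n) n != 0.
  apply/negP => /eqP /(eigen_coef0 sn) sn0.
  have z11 : cmod z1 < 1 by rewrite nz1; lra.
  have : koenigs_pow n z1 = 0 by rewrite sn0 H20.
  rewrite koenigs_powE// => /eqP; rewrite expf_eq0 => /andP[_ /eqP sz].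
  have : z1 = 0 by apply: sinj; rewrite ?cmod0 ?s0// ltW.
  by move=> /(congr1 (@cmod R)); rewrite nz1 cmod0; lra.
exists (coef f n / coef (koenigs_pow n) n); set c := _ / _.
apply/eqP; rewrite -subr_eq0; apply/eqP; apply: (@eigen_coef0 _ n).
  by move=> z zz; rewrite !H2D !H2N !H2Z fn// sn//; ring.
rewrite (@coef_lin _ (- c) (koenigs_pow n) f); last by move=> z zz; rewrite H2D H2N H2Z; ring.
by rewrite /c mulNr divfK// addNr.
Qed.

Lemma commutant_eigen (T : H2 R -> H2 R) n : linear T -> T \o Cphi = Cphi \o T ->
  exists c, T (koenigs_pow n) = c *: koenigs_pow n.
Proof.
move=> lT TC; apply: eigen => z z1; rewrite -CphiE//.
have /= <- := congr1 (fun F : H2 R -> H2 R => F (koenigs_pow n)) TC.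
have := lT (lam ^+ n) (koenigs_pow n) 0; rewrite Cphi_koenigs_pow addr0 => ->.
have T0 : T 0 = 0.
  have := lT 1 0 0; rewrite !scale1r addr0 => h.
  by apply: (addrI (T 0)); rewrite addr0 -h.
by rewrite T0 addr0 H2Z.
Qed.

(** Rescaling by [rho] turns [f \o tau] near 0 into a disc algebra function on the unit disc; its
    bound [2 * hnorm f] comes from [|tau| <= 1 / 2]. *)
Lemma taylor_tau (rho : R) f : 0 < rho ->
  (forall w : C, cmod w <= rho -> koenigs_range s w /\ cmod (tau w) <= 1 / 2) ->
  exists a, (exists A : R, 0 < A /\ forall n, cmod (a n) <= A) /\
    forall w, cmod w < rho -> limC (fun n => psum a n (w / rc rho)) (f (tau w)).
Proof.
move=> rho0 Hrho.
have inO u : cmod u <= 1 -> cmod (rc rho * u) <= rho.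
  by move=> u1; rewrite cmodM cmod_rc gtr0_norm// ler_piMr// ltW.
have ug : udiff udisc (fun u => tau (rc rho * u)) (fun u => (s' (tau (rc rho * u)))^-1 * (rc rho * 1)).
  apply: (udiff_comp (udiff_tau us s'0 sinj sstar) (udiff_scale (rc rho) (udiff_idD R))).
  by move=> u u1; have [] := Hrho _ (inO u u1).
have h2 : (0 : R) <= 1 / 2 by lra.
have h1 : 1 / 2 < (1 : R) by lra.
have tau2 u : cmod u <= 1 -> cmod (tau (rc rho * u)) <= 1 / 2.
  by move=> u1; have [] := Hrho _ (inO u u1).
have dg := discalg_comp f ug h2 h1 tau2.
have [|a [a2 pa]] := @discalg_coef _ _ (hnorm f * 2) dg.
  move=> u u1; have := pseries_tail 0 (coef_le_hnorm f) (proj2 (coefP f)) (tau2 u _) h1.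
  rewrite /psum big_ord0 subr0 expr0 u1 => /(_ (lexx _)).
  by rewrite (_ : 1 / (1 - 1 / 2) = 2 :> R)//; field.
have hA := hnorm_ge0 f.
exists a; split.
  exists (hnorm f * 2 + 1); split; first by lra.
  move=> n; have := cmod_le_sum2 n _ a2 => h; apply: le_trans (h _) _; lra.
move=> w wr; have rn : rc rho != 0 by rewrite -cmod_gt0 cmod_rc gtr0_norm.
have w1 : cmod (w / rc rho) < 1.
  by rewrite cmodM cmodV cmod_rc gtr0_norm// ltr_pdivrMr// mul1r.
by have := pa _ w1; rewrite [rc rho * _]mulrC divfK.
Qed.

(** With [|c s z| <= rho / 2] the expansion converges uniformly in [z] with ratio 1/2, hence in
    [H2], and [l] may be applied term by term. *)
Lemma flow_expansion (l : H2 R -> C) f a (A rho M : R) (c : C) : functional l -> 0 < rho ->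
  0 < M -> (forall z, cmod z <= 1 -> cmod (s z) <= M) ->
  (forall w : C, cmod w <= rho -> koenigs_range s w /\ cmod (tau w) <= 1 / 2) ->
  0 < A -> (forall n, cmod (a n) <= A) ->
  (forall w, cmod w < rho -> limC (fun n => psum a n (w / rc rho)) (f (tau w))) ->
  cmod c * M <= rho / 2 ->
  discalg (fun z => f (tau (c * s z))) /\
  limC (fun K => \sum_(n < K) a n * (c / rc rho) ^+ n * l (koenigs_pow n)) (l (toH2 (fun z => f (tau (c * s z))))).
Proof.
move=> fl rho0 M0 sM Hrho A0 aA aT cM; have [_ [L L0 HL]] := fl.
have cs z : cmod z <= 1 -> cmod (c * s z) <= rho / 2.
  move=> z1; rewrite cmodM; apply: le_trans cM.
  by apply: ler_wpM2l; [exact: cmod_ge0|exact: sM].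
have csr z : cmod z <= 1 -> cmod (c * s z) <= rho by move=> /cs; lra.
have [f' uf] : exists f' : C -> C, udiff udisc (fun z => tau (c * s z)) f'.
  by apply: (udiff_flow us) => // z z1; have [] := Hrho _ (csr z z1).
have h2 : (0 : R) <= 1 / 2 by lra.
have h1 : 1 / 2 < (1 : R) by lra.
have tau2 z : cmod z <= 1 -> cmod (tau (c * s z)) <= 1 / 2.
  by move=> z1; have [] := Hrho _ (csr z z1).
have dF := discalg_comp f uf h2 h1 tau2; split=> // e e0.
have e1 : 0 < e / (L * A * 2) by rewrite divr_gt0// !mulr_gt0.
have [N HN] := expr_lt h2 h1 e1; exists N => K /HN hK.
have rn : rc rho != 0 by rewrite -cmod_gt0 cmod_rc gtr0_norm.
rewrite cmodC -(functional_sum _ _ _ fl) functionalB//; apply: le_lt_trans (HL _) _.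
apply: (@le_lt_trans _ _ (L * (A * ((1 / 2) ^+ K * 2)))); last first.
  by move: hK; rewrite ltr_pdivlMr ?mulr_gt0//; lra.
apply: ler_wpM2l; first exact: ltW.
apply: (@hnorm_sub_le _ _ _ (fun z => f (tau (c * s z)) - psum a K (c * s z / rc rho))).
- have dp : discalg (fun z => psum a K (c * s z / rc rho)).
    have := discalg_sum (index_enum _) (fun n : 'I_K => a n * (c / rc rho) ^+ n) (fun n : 'I_K => discalg_koenigs_pow n).
    apply: discalg_ext => z _; apply: eq_bigr => n _.
    by rewrite !exprMn; ring.
  have := discalg_lin (-1) dp dF; apply: discalg_ext => z _; ring.
- move=> z z1; rewrite toH2E// H2_sum; congr (_ - _); apply: eq_bigr => n _.
  by rewrite koenigs_powE// !exprMn; ring.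
move=> z z1; have zz : cmod z <= 1 by rewrite z1.
have wr : cmod (c * s z) < rho by have := cs z zz; lra.
have w2 : cmod (c * s z / rc rho) <= 1 / 2.
  by rewrite cmodM cmodV cmod_rc gtr0_norm// ler_pdivrMr//; have := cs z zz; lra.
apply: (@limC_cmod_le _ (fun m => psum a m (c * s z / rc rho) - psum a K (c * s z / rc rho)) _ _ K).
  move=> m Km; apply: le_trans (psum_tail aA w2 h1 Km) _.
  by rewrite (_ : (1 - 1 / 2)^-1 = 2 :> R)//; field.
by apply: limC_B; [exact: aT|exact: limC_cst].
Qed.

Lemma flow_discalg (c : C) r f : (forall z, cmod z <= 1 -> koenigs_range s (c * s z) /\ cmod (tau (c * s z)) <= r) ->
  0 <= r -> r < 1 ->
  [/\ forall j, discalg (fun z => tau (c * s z) ^+ j), forall p : {poly C}, discalg (fun z => p.[tau (c * s z)]) &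
   discalg (fun z => f (tau (c * s z)))].
Proof.
move=> Hc r0 r1; have [|f' uf] := udiff_flow us s'0 sinj sstar (c := c).
  by move=> z /Hc[].
split=> [j|p|].
- by have [g' ug] := udiff_X j uf; exact: udiff_discalg ug.
- by have [g' ug] := udiff_horner p uf; exact: udiff_discalg ug.
- by apply: discalg_comp uf r0 r1 _ => z /Hc[].
Qed.

Lemma toH2_horner (c : C) r (p : {poly C}) (l : H2 R -> C) : functional l ->
  (forall z, cmod z <= 1 -> koenigs_range s (c * s z) /\ cmod (tau (c * s z)) <= r) -> 0 <= r -> r < 1 ->
  l (toH2 (fun z => p.[tau (c * s z)])) = \sum_(i < size p) p`_i * l (toH2 (fun z => tau (c * s z) ^+ i)).
Proof.
move=> fl Hc r0 r1; have [dX dP _] := flow_discalg 0 Hc r0 r1.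
rewrite -(functional_sum _ _ _ fl); congr l; apply: H2_ext => z z1.
rewrite toH2E// H2_sum horner_coef; by apply: eq_bigr => i _; rewrite toH2E.
Qed.

(** For powers of [tau] this is [udiff_functional]; a general [f] is a uniform limit of its Taylor
    polynomials on the disc of radius [r]. *)
Lemma flow_analytic (l : H2 R -> C) f (t0 d r : R) : functional l -> 0 < d -> 0 <= r -> r < 1 ->
  (forall (c : C) z, cmod (c - rc t0) <= d -> cmod z <= 1 ->
    koenigs_range s (c * s z) /\ cmod (tau (c * s z)) <= r) ->
  discalg (fun u => l (toH2 (fun z => f (tau ((rc t0 + rc d * u) * s z))))).
Proof.
move=> fl d0 r0 r1 Hd; have [_ [L L0 HL]] := fl; have [M M0 sM] := s_bdd us.
pose cc u : C := rc t0 + rc d * u.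
have Hcc u : cmod u <= 1 -> forall z, cmod z <= 1 -> koenigs_range s (cc u * s z) /\ cmod (tau (cc u * s z)) <= r.
  move=> u1 z z1; apply: Hd => //; rewrite /cc addrAC subrr add0r cmodM cmod_rc gtr0_norm//.
  by rewrite ler_piMr// ltW.
have pow j : discalg (fun u => l (toH2 (fun z => tau (cc u * s z) ^+ j))).
  have [G' uG] := udiff_X j (udiff_tau us s'0 sinj sstar).
  have [_ /bdd_pos[B B0 HB] HG] := uG.
  have Md0 : 0 < M * d by rewrite mulr_gt0.
  apply: udiff_discalg; apply: (@udiff_functional _ _ (fun u z => tau (cc u * s z) ^+ j)
    (fun u z => G' (cc u * s z) * (s z * rc d)) (1 + B * (M * d)) fl).
  - by move=> u u1; have [dX _ _] := flow_discalg 0 (Hcc u u1) r0 r1; exact: dX.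
  - move=> u z u1 z1; have [Oz t1] := Hcc u u1 z z1; split.
      rewrite cmodX; have : cmod (tau (cc u * s z)) ^+ j <= 1.
        by rewrite exprn_ile1 ?cmod_ge0//; lra.
      by have : 0 < B * (M * d) by [rewrite mulr_gt0]; lra.
    rewrite !cmodM cmod_rc gtr0_norm//.
    have : cmod (G' (cc u * s z)) * (cmod (s z) * d) <= B * (M * d).
      apply: ler_pM; [exact: cmod_ge0|by rewrite mulr_ge0 ?cmod_ge0 ?(ltW d0)|exact: HB|].
      by rewrite ler_wpM2r ?(ltW d0)// sM.
    by lra.
  move=> e e0; have e1 : 0 < e / (M * d) by rewrite divr_gt0.
  have [d1 d10 Hd1] := HG _ e1; exists (d1 / (M * d)); first by rewrite divr_gt0.
  move=> u v z u1 v1 z1; rewrite ltr_pdivlMr// => uv.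
  have [Ou _] := Hcc u u1 z z1; have [Ov _] := Hcc v v1 z z1.
  have E : cc v * s z - cc u * s z = s z * rc d * (v - u) by rewrite /cc; ring.
  have nE : cmod (cc v * s z - cc u * s z) <= M * d * cmod (v - u).
    rewrite E !cmodM cmod_rc gtr0_norm//; apply: ler_wpM2r; first exact: cmod_ge0.
    by apply: ler_wpM2r; [exact: ltW|exact: sM].
  have := Hd1 _ _ Ou Ov; rewrite -(mulrA (G' _)) -E => h.
  apply: le_trans (h _) _; first by apply: le_lt_trans nE _; rewrite mulrC.
  apply: le_trans (ler_wpM2l (ltW e1) nE) _.
  by rewrite mulrA divfK// gt_eqF.
apply: discalg_near => e e0; have eL : 0 < e / L by rewrite divr_gt0.
have [N /(_ N _ (leqnn _)) HN] := trunc_near f r0 r1 eL.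
exists (fun u => l (toH2 (fun z => (trunc f N).[tau (cc u * s z)]))).
  apply: discalg_ext (discalg_sum (index_enum _) (fun i : 'I_(size (trunc f N)) => (trunc f N)`_i) (fun i => pow i)).
  by move=> u u1; rewrite (toH2_horner _ fl (Hcc u u1) r0 r1).
move=> u u1; have [_ dP dF] := flow_discalg f (Hcc u u1) r0 r1.
rewrite functionalB//; apply: le_trans (HL _) _; rewrite mulrC -ler_pdivlMr//.
apply: (@hnorm_sub_le _ _ _ (fun z => f (tau (cc u * s z)) - (trunc f N).[tau (cc u * s z)])).
- by apply: discalg_ext (discalg_lin (-1) (dP _) dF) => z _; rewrite mulN1r addrC.
- by move=> z z1; rewrite !toH2E.
move=> z z1; have zz : cmod z <= 1 by rewrite z1.
by have [_ h] := Hcc u u1 z zz; rewrite cmodC; apply/ltW/HN.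
Qed.

(** Analytic continuation along (0, 1): at the supremum [T] of the vanishing range, zeros accumulate
    from the left, so the function vanishes on a whole disc around [T], which reaches beyond [T] if
    [T < 1]. *)
Lemma flow_vanish n (x : 'I_n -> H2 R) (k : 'I_n -> C) (l : 'I_n -> H2 R -> C) (eta : R) :
  (forall i, functional (l i)) -> 0 < eta ->
  (forall t, 0 < t -> t < eta -> \sum_i k i * l i (toH2 (fun z => x i (tau (rc t * s z)))) = 0) ->
  forall t, 0 < t -> t < 1 -> \sum_i k i * l i (toH2 (fun z => x i (tau (rc t * s z)))) = 0.
Proof.
move=> fl eta0 H; pose h c := \sum_i k i * l i (toH2 (fun z => x i (tau (c * s z)))).
pose Z := [set t : R | [/\ 0 < t, t < 1 & forall t', 0 < t' -> t' <= t -> h (rc t') = 0]].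
pose t1 := Num.min (eta / 2) (1 / 2).
have t10 : 0 < t1 by rewrite lt_min !divr_gt0.
have t1e : t1 <= eta / 2 by rewrite ge_min lexx.
have t11 : t1 <= 1 / 2 by rewrite ge_min lexx orbT.
have Zt1 : Z t1 by split=> // [|t' t'0 t't]; [lra|apply: H => //; lra].
have hZ : has_sup Z by split; [exists t1|exists 1 => t [_ /ltW]].
pose T := sup Z.
have T1 : T <= 1 by apply: ge_sup; [exists t1|move=> t [_ /ltW]].
have tT : t1 <= T by apply: (ub_le_sup (proj2 hZ)).
have below t : 0 < t -> t < T -> h (rc t) = 0.
  move=> t0 tlt; have e0 : 0 < T - t by lra.
  have [t2 [_ _ Zt2] lt2] := sup_adherent e0 hZ.
  by apply: Zt2 => //; move: lt2; rewrite -/T; lra.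
have [TE|T_lt] := eqVneq T 1; first by move=> t t0 tt1; apply: below => //; rewrite TE.
exfalso; have {}T1 : T < 1 by rewrite lt_def eq_sym T_lt.
have T0 : 0 < T by lra.
have [d [r [d0 r0 r1 Hd]]] := flow_nbhs us s0 s'0 sinj sstar T0 T1.
have dk : discalg (fun u => h (rc T + rc d * u)).
  by apply: discalg_sum => i; apply: (flow_analytic (x i) (fl i) d0 r0 r1 Hd).
have hz := discalg_zero_near0 dk.
have {}hz u : cmod u < 1 -> h (rc T + rc d * u) = 0.
  apply: hz => e e0; pose y := Num.min (e / 2) (Num.min 1 (T / d) / 2).
  have y0 : 0 < y by rewrite lt_min !divr_gt0//= lt_min ltr01 divr_gt0.
  have y1 : y <= e / 2 by rewrite ge_min lexx.
  have y2 : y * d <= T / 2.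
    rewrite -ler_pdivlMr// ge_min; apply/orP; right.
    rewrite mulrAC ler_pM2r ?invr_gt0// ge_min lexx orbT//.
  have ny : cmod (- rc y) = y by rewrite cmodN cmod_rc gtr0_norm.
  exists (- rc y); first by rewrite ny.
  split; first by rewrite ny; lra.
  have -> : rc T + rc d * - rc y = rc (T - y * d) by rewrite rcB rcM; ring.
  have : 0 < y * d by rewrite mulr_gt0.
  by move=> yd; apply: below; lra.
pose q := Num.min (1 / 2) ((1 - T) / 2 / d).
have q0 : 0 < q by rewrite lt_min !divr_gt0// subr_gt0.
have q1 : q <= 1 / 2 by rewrite ge_min lexx.
have q2 : q * d <= (1 - T) / 2 by rewrite -ler_pdivlMr// ge_min lexx orbT.
have qd : 0 < q * d by rewrite mulr_gt0.
have q3 : q * d <= 1 / 2 * d by rewrite ler_pM2r.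
have : Z (T + q * d).
  split=> [||t' t'0 t't]; [lra|lra|].
  have [lt|ge] := ltP t' T; first exact: below.
  have -> : rc t' = rc T + rc d * rc ((t' - T) / d).
    by rewrite -rcM -rcD; congr rc; field; rewrite gt_eqF.
  have q' : 0 <= (t' - T) / d by apply: divr_ge0; [rewrite subr_ge0|exact: ltW].
  apply: hz; rewrite cmod_rc ger0_norm//.
  by rewrite ltr_pdivrMr//; lra.
by move/(ub_le_sup (proj2 hZ)); rewrite -/T; lra.
Qed.

(** The flow operators are contractions, so [f] may be replaced by a polynomial; for that, [phi_t]
    tends to the identity uniformly on the disc. *)
Lemma flow_lim (l : H2 R -> C) f e : functional l -> 0 < e -> exists2 d : R, 0 < d &
  forall t, 0 < t -> 1 - d < t -> t < 1 -> cmod (l (toH2 (fun z => f (tau (rc t * s z)))) - l f) <= e.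
Proof.
move=> fl e0; have [_ [L L0 HL]] := fl.
have e3 : 0 < e / 3 / L by rewrite !divr_gt0.
have [N HN] := hnorm_tail f e3; set P := toH2 _ in HN.
have [p' up] := udiff_poly (trunc f N).
have [d1 d10 Hd1] := udiff_cont up e3.
have [d d0 Hd] := flow_to1 us s0 s'0 sinj sstar d10.
exists d => // t t0 td t1.
have [|f' uf] := udiff_flow us s'0 sinj sstar (c := rc t).
  by move=> z z1; have [] := flow_starlike us s0 s'0 sinj sstar z1 t0 (ltW t1).
have lt1 z : cmod z <= 1 -> cmod (tau (rc t * s z)) < 1.
  by move=> z1; exact: (flow_lt1 us s0 s'0 sinj sstar z1 t0 t1).
have [r [r0 r1 Hr]] := udiff_radius uf lt1.
have fl0 : tau (rc t * s 0) = 0 by rewrite s0 mulr0 tau0.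
pose F g := toH2 (fun z => g (tau (rc t * s z))).
have dF g : discalg (fun z => g (tau (rc t * s z))) by exact: discalg_comp uf r0 r1 Hr.
have h1 : cmod (l (F f) - l (F P)) <= e / 3.
  rewrite functionalB//; apply: le_trans (HL _) _; rewrite mulrC -ler_pdivlMr//.
  have -> : F f - F P = F (f - P).
    by apply: H2_ext => z z1; rewrite H2D H2N /F (toH2E (dF f) z1) (toH2E (dF P) z1) (toH2E (dF (f - P)) z1).
  exact: le_trans (littlewood (f - P) uf r0 r1 Hr fl0) HN.
have h2 : cmod (l (F P) - l P) <= e / 3.
  rewrite functionalB//; apply: le_trans (HL _) _; rewrite mulrC -ler_pdivlMr//.
  have dp := udiff_discalg up.
  apply: (@hnorm_sub_le _ _ _ (fun z => P (tau (rc t * s z)) - (trunc f N).[z])).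
  - by apply: discalg_ext (discalg_lin (-1) dp (dF P)) => z _; rewrite mulN1r addrC.
  - move=> z z1; rewrite [F P z](toH2E (dF P) z1); congr (_ - _); exact: (toH2E dp z1).
  move=> z z1; have zz : cmod z <= 1 by rewrite z1.
  rewrite /P toH2E//; last exact: lt1.
  by apply/ltW/Hd1 => //; [exact/ltW/lt1|exact: Hd].
have h3 : cmod (l P - l f) <= e / 3.
  by rewrite cmodC functionalB//; apply: le_trans (HL _) _; rewrite mulrC -ler_pdivlMr.
rewrite -/(F f).
have := cmod_tri (l (F P)) (l (F f)) (l f); have := cmod_tri (l P) (l (F P)) (l f); lra.
Qed.

(* With [x i (tau w) = sum_m a i m (w / rho)^m] near 0, the hypothesis says that the
   power series with coefficients [b m = sum_i k i a i m <s^m, y i>] vanishes at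
   the points [lam^N / rho], so [b = 0].  As [T s^m = c m s^m], the corresponding
   series for [T] has coefficients [c m b m = 0]. *)
Lemma commutant_separation n (x y : 'I_n -> H2 R) (k : 'I_n -> C) (T : H2 R -> H2 R) :
  bounded_op (@H2_dot R) T -> T \o Cphi = Cphi \o T ->
  (forall N, \sum_i k i * H2_dot (iter N Cphi (x i)) (y i) = 0) ->
  \sum_i k i * H2_dot (T (x i)) (y i) = 0.
Proof.
move=> bT TC H; have [M M0 sM] := s_bdd us.
have sum_shift (u v : 'I_n -> C) : \sum_i k i * u i = 0 ->
    \sum_i k i * v i = - \sum_i k i * (u i - v i).
  move=> u0; under [X in - X]eq_bigr do rewrite mulrBr.
  by rewrite sumrB u0 sub0r opprK.
have [rho rho0 Hrho] := flow_nbhs0 us s0 s'0 sinj sstar.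
have /choice[a Ha] i := taylor_tau (x i) rho0 Hrho.
have rn : rc rho != 0 :> C by rewrite -cmod_gt0 cmod_rc gtr0_norm.
have expand (l : 'I_n -> H2 R -> C) (c : C) : (forall i, functional (l i)) -> cmod c * M <= rho / 2 ->
    limC (fun K => \sum_(m < K) (\sum_i k i * (a i m * l i (koenigs_pow m))) * (c / rc rho) ^+ m)
      (\sum_i k i * l i (toH2 (fun z => x i (tau (c * s z))))).
  move=> fl cM.
  have lim i : limC (fun K => k i * \sum_(m < K) a i m * (c / rc rho) ^+ m * l i (koenigs_pow m))
      (k i * l i (toH2 (fun z => x i (tau (c * s z))))).
    apply: limC_M; first exact: limC_cst.
    have [[A [A0 aA]] aT] := Ha i.
    by have [] := flow_expansion (fl i) rho0 M0 sM Hrho A0 aA aT cM.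
  have := limC_sum (index_enum _) lim; congr limC; apply/funext => K.
  under eq_bigr do rewrite mulr_sumr.
  rewrite exchange_big/=; apply: eq_bigr => m _; rewrite mulr_suml.
  by apply: eq_bigr => i _; ring.
have bid : bounded_op (@H2_dot R) id.
  by apply/bounded_opP; split; [by []|exists 1 => // f; rewrite mul1r].
pose l0 i f := H2_dot f (y i); have fl0 i : functional (l0 i) := dot_functional (y i) bid.
pose l i f := H2_dot (T f) (y i); have fl i : functional (l i) := dot_functional (y i) bT.
pose b m := \sum_i k i * (a i m * l0 i (koenigs_pow m)).
have snM m : hnorm (koenigs_pow m) <= M ^+ m.
  apply: hnorm_toH2; first exact: discalg_koenigs_pow.
  by move=> z z1; rewrite cmodX lerXn2r ?nnegrE ?cmod_ge0 ?(ltW M0)// sM// z1.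
have b0 m : b m = 0.
  have /choice[B HB] i : exists B : R, 0 <= B /\ forall m, cmod (k i * (a i m * l0 i (koenigs_pow m))) <= B * M ^+ m.
    have [[A [A0 aA]] _] := Ha i; have [_ [L L0 HL]] := fl0 i.
    exists (cmod (k i) * (A * L)); split; first by rewrite !mulr_ge0 ?cmod_ge0// ltW.
    move=> j; rewrite !cmodM -!mulrA; apply: ler_wpM2l; first exact: cmod_ge0.
    apply: ler_pM; rewrite ?cmod_ge0//; apply: le_trans (HL _) _.
    by apply: ler_wpM2l; [exact: ltW|exact: snM].
  apply: (@psum_eq0 _ b (\sum_i B i) M _ (ltW M0)).
    move=> j; apply: le_trans (cmod_sum _ _ _) _; rewrite mulr_suml.
    by apply: ler_sum => i _; have [] := HB i.
  (* The first entry puts [lam ^+ N / rho] below [e], the second brings [lam ^+ N] into the range of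
     the expansion. *)
  move=> e e0; pose d := Num.min (e * rho) (rho / 2 / M).
  have d0 : 0 < d by rewrite lt_min mulr_gt0// !divr_gt0.
  have [N /(_ N (leqnn _)) HN] := expr_lt (cmod_ge0 lam) lam1 d0.
  have lN : 0 < cmod lam ^+ N by rewrite exprn_gt0// cmod_gt0.
  move: HN; rewrite lt_min => /andP[h1]; rewrite ltr_pdivlMr// => h2.
  exists (lam ^+ N / rc rho); rewrite cmodM cmodV cmod_rc gtr0_norm// cmodX; split.
  - by rewrite divr_gt0.
  - by rewrite ltr_pdivrMr.
  have h3 : cmod (lam ^+ N) * M <= rho / 2 by rewrite cmodX ltW.
  have E i : toH2 (fun z => x i (tau (lam ^+ N * s z))) = iter N Cphi (x i).
    have [[A [A0 aA]] aT] := Ha i.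
    have [dF _] := flow_expansion (fl0 i) rho0 M0 sM Hrho A0 aA aT h3.
    by apply: H2_ext => z z1; rewrite (toH2E dF z1) iter_Cphi// tau_iter// ltW.
  have Esum : \sum_i k i * l0 i (toH2 (fun z => x i (tau (lam ^+ N * s z)))) = 0.
    by rewrite -[RHS](H N); apply: eq_bigr => i _; rewrite E.
  by rewrite -Esum; exact: expand fl0 h3.
have /choice[c Hc] m := commutant_eigen m (proj1 bT) TC.
have small t : 0 < t -> t < rho / 2 / M ->
    \sum_i k i * l i (toH2 (fun z => x i (tau (rc t * s z)))) = 0.
  move=> t0; rewrite ltr_pdivlMr// => tM.
  have cM : cmod (rc t : C) * M <= rho / 2 by rewrite cmod_rc gtr0_norm// ltW.
  apply: limC_uniq (expand l (rc t) fl cM) _.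
  rewrite (_ : (fun K => _) = fun=> 0); first exact: limC_cst.
  apply/funext => K; apply: big1 => m _.
  suff -> : \sum_i k i * (a i m * l i (koenigs_pow m)) = 0 by rewrite mul0r.
  transitivity (c m * b m); last by rewrite b0 mulr0.
  rewrite mulr_sumr; apply: eq_bigr => i _; rewrite /l Hc.
  have -> : H2_dot (c m *: koenigs_pow m) (y i) = c m * l0 i (koenigs_pow m).
    have [lin0 _] := fl0 i; have := lin0 (c m) (koenigs_pow m) 0; rewrite addr0 /l0 => ->.
    have := functionalB 0 0 (fl0 i); rewrite /l0 !subrr => <-; exact: addr0.
  by ring.
have eta0 : 0 < rho / 2 / M by rewrite !divr_gt0.
have van := flow_vanish fl eta0 small.
apply/eqP; rewrite -cmod_eq0 eq_le cmod_ge0 andbT; apply/ler_addgt0Pr => e e0; rewrite add0r.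
pose Kt := \sum_i cmod (k i).
have K0 : 0 <= Kt by apply: sumr_ge0 => i _; exact: cmod_ge0.
have e1 : 0 < e / (Kt + 1) by rewrite divr_gt0//; lra.
have /choice[d Hd] i : exists d : R, 0 < d /\ forall t, 0 < t -> 1 - d < t -> t < 1 ->
    cmod (l i (toH2 (fun z => x i (tau (rc t * s z)))) - l i (x i)) <= e / (Kt + 1).
  by have [d d0 Hd] := flow_lim (x i) (fl i) e1; exists d.
(* The default 1 covers an empty family and keeps [t = 1 - D / 2] positive. *)
pose D := \big[Num.min/1]_i d i.
have D0 : 0 < D.
  by rewrite /D; elim/big_ind: _ => [|u v u0 v0|i _]; [exact: ltr01|rewrite lt_min u0|have [] := Hd i].
have Dd i : D <= d i by apply: bigmin_le_cond.
have D1 : D <= 1 by apply: bigmin_le_id.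
pose t := 1 - D / 2.
have t0 : 0 < t by rewrite /t; lra.
have t1 : t < 1 by rewrite /t; lra.
have := van t t0 t1 => hv.
have -> : \sum_i k i * H2_dot (T (x i)) (y i) =
    - \sum_i k i * (l i (toH2 (fun z => x i (tau (rc t * s z)))) - l i (x i)).
  exact: (sum_shift (fun i => l i (toH2 (fun z => x i (tau (rc t * s z))))) (fun i => l i (x i)) hv).
rewrite cmodN; apply: le_trans (cmod_sum _ _ _) _.
apply: (@le_trans _ _ (\sum_i cmod (k i) * (e / (Kt + 1)))).
  apply: ler_sum => i _; rewrite cmodM; apply: ler_wpM2l; first exact: cmod_ge0.
  have [_ h] := Hd i; apply: h => //; have := Dd i; rewrite /t; lra.
rewrite -mulr_suml -/Kt mulrA ler_pdivrMr; last by lra.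
by rewrite mulrC ler_wpM2l ?ltW//; lra.
Qed.

(** * Polynomials in the operator and the two inclusions *)

Lemma poly_op_wide (A : H2 R -> H2 R) (p : {poly C}) x m : (size p <= m)%N ->
  poly_op A p x = \sum_(i < m) p`_i *: iter i A x.
Proof.
move=> pm; rewrite /poly_op (big_ord_widen m (fun i => p`_i *: iter i A x) pm).
rewrite [RHS](bigID (fun i : 'I_m => (i < size p)%N))/= [X in _ + X]big1 ?addr0// => i.
by rewrite -leqNgt => h; rewrite nth_default// scale0r.
Qed.

Lemma poly_opXn (A : H2 R -> H2 R) N x : poly_op A 'X^N x = iter N A x.
Proof.
rewrite /poly_op size_polyXn big_ord_recr/= coefXn eqxx scale1r big1 ?add0r// => i _.
by rewrite coefXn ltn_eqF// scale0r.
Qed.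

Lemma minimal_commutant_Cphi : minimal_commutant (@H2_dot R) Cphi.
Proof.
split; first exact: Cphi_bounded.
apply/seteqP; split=> [T HT|T [bT TC]].
  have [bT _] := HT; split=> //; apply/funext => x /=; apply: H2_ext => z z1.
  have pz1 := phi_lt1 (ltW z1).
  (* Commutation evaluated at [z] becomes an equality of two matrix coefficients, which passes from
     polynomials in [Cphi] to their closure. *)
  have [kz Hkz] := kernel_exists z1; have [kp Hkp] := kernel_exists pz1.
  rewrite CphiE// -Hkz -Hkp; apply: (wot_closure_eq HT) => _ [p _ <-].
  rewrite Hkz Hkp /poly_op !H2_sum; apply: eq_bigr => i _.
  by rewrite -iterSr !iter_Cphi// iterSr.
apply: wot_closure_separation => //.
- by exists (poly_op Cphi 0), 0.
- move=> c _ _ [p _ <-] [q _ <-]; exists (poly_op Cphi (c *: p + q)); first by exists (c *: p + q).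
  move=> x y.
  suff -> : poly_op Cphi (c *: p + q) x = c *: poly_op Cphi p x + poly_op Cphi q x by exact: dot_lin.
  pose m := maxn (size (c *: p + q)) (maxn (size p) (size q)).
  rewrite !(@poly_op_wide _ _ _ m) ?leq_max ?leqnn ?orbT//.
  rewrite scaler_sumr -big_split/=; apply: eq_bigr => i _.
  by rewrite coefD coefZ scalerDl scalerA.
move=> n x y k H; apply: (commutant_separation (x := x) (y := y)) => // N.
rewrite -[RHS](H (poly_op Cphi 'X^N)); last by exists 'X^N.
by apply: eq_bigr => i _; rewrite poly_opXn.
Qed.

End Commutant.


(** * Derivatives relative to the closed disc *)

Section Interface.
Set Implicit Arguments.
Unset Strict Implicit.
Variable R : realType.
Local Notation C := (Cplx R).
Implicit Types (z w : C) (f : C -> C).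

Lemma dquot_cvg f z c : diff_within (@udisc R) f z c <->
  (f w - f z) / (w - z) @[w --> within (@cdisc R) z^'] --> c.
Proof.
split=> [df|cf].
  apply/cvgrPdist_le => e e0.
  have eE : e = rc (cmod e) by rewrite cmodE ger0_norm// ltW.
  have [|d d0 Hd] := df (cmod e); first by rewrite cmod_gt0 gt_eqF.
  rewrite near_withinE near_withinE; near=> w => wz /cdiscE w1.
  rewrite -cmodE eE rc_le cmodC.
  have wz0 : w - z != 0 by rewrite subr_eq0.
  rewrite (_ : _ - c = (f w - f z - c * (w - z)) / (w - z)); last by field.
  rewrite cmodM cmodV ler_pdivrMr ?cmod_gt0//; apply: Hd => //.
  near: w; exact: ball_within_nbhs.
move=> e e0; have re : (0 : C) < rc e by rewrite -(rc0 R) rc_lt.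
have /cvgrPdist_le/(_ _ re) := cf.
rewrite near_withinE near_withinE => /nbhs_ball_cmod[d d0 Hd].
exists d => // w w1 wd.
have [->|wz] := eqVneq w z; first by rewrite !subrr mulr0 subrr cmod0 mulr0.
have wz0 : w - z != 0 by rewrite subr_eq0.
have := Hd w wd wz (proj2 (cdiscE w) w1); rewrite -cmodE rc_le => h.
rewrite (_ : _ - _ - _ = ((f w - f z) / (w - z) - c) * (w - z)); last by field.
by rewrite cmodM (cmodC _ c) ler_wpM2r ?cmod_ge0.
Unshelve. all: by end_near.
Qed.

(** Properness makes limits along this filter unique, so that the [lim] in [derive_in] is the
    derivative carried by [udiff]. *)
Lemma within_cdisc_proper z : cmod z <= 1 -> ProperFilter (within (@cdisc R) z^').
Proof.
move=> z1; apply: Build_ProperFilter_ex => P /nbhs_ball_cmod[d d0 Hd].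
pose x := Num.min (d / 2) 1.
have x0 : 0 < x by rewrite lt_min ltr01 divr_gt0.
have xd : x <= d / 2 by rewrite ge_min lexx.
have x1 : x <= 1 by rewrite ge_min lexx orbT.
have [z0|z0] := eqVneq z 0.
  have nx : cmod (rc x : C) = x by rewrite cmod_rc gtr0_norm.
  exists (rc x); apply: Hd; first by rewrite z0 subr0 nx; lra.
    by rewrite z0 -cmod_gt0 nx.
  by apply/cdiscE; rewrite nx.
exists (z - rc x * z); apply: Hd.
- rewrite addrAC subrr add0r cmodN cmodM cmod_rc gtr0_norm//; have := cmod_ge0 z; nra.
- rewrite -subr_eq0 addrAC subrr add0r oppr_eq0 mulf_neq0// -(rc0 R).
  by rewrite (inj_eq (@rc_inj R)) gt_eqF.
- apply/cdiscE; rewrite (_ : _ - _ = rc (1 - x) * z); last by rewrite rcB rc1; ring.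
  by rewrite cmodM cmod_rc ger0_norm ?subr_ge0//; have := cmod_ge0 z; nra.
Qed.

Lemma derive_inE f f' z : udiff (@udisc R) f f' -> cmod z <= 1 -> derive_in (@cdisc R) f z = f' z.
Proof.
move=> uf z1; have PF := within_cdisc_proper z1.
by apply/cvg_lim => //; apply/dquot_cvg; exact: udiff_diff_within uf z1.
Qed.

Lemma C1_on_udiff f : C1_on (@cdisc R) f -> udiff (@udisc R) f (derive_in (@cdisc R) f).
Proof.
move=> [df cf]; apply: C1_udiff.
- exact: (@convexC_disc R 1).
- exact: (@disc_cpt R 1).
- move=> z z1; apply/dquot_cvg; apply: df; exact/cdiscE.
move=> z z1 e e0; have re : (0 : C) < rc e by rewrite -(rc0 R) rc_lt.
have /subspace_continuousP/(_ z (proj2 (cdiscE z) z1))/cvgrPdist_lt/(_ _ re) := cf.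
rewrite near_withinE => /nbhs_ball_cmod[d d0 Hd].
exists d => // w w1 wd; rewrite cmodC -rc_lt cmodE.
exact: Hd w wd (proj2 (cdiscE w) w1).
Qed.

Lemma limn_Re_series (u : nat -> C) l : limC (fun n => \sum_(j < n) u j) l ->
  limn (series (fun j => complex.Re (u j))) = complex.Re l.
Proof.
move=> ul; apply/cvg_lim => //; apply/cvgrPdist_lt => e /ul[N HN].
exists N => // n /HN /=; rewrite seriesE; apply: le_lt_trans.
rewrite cmodC (_ : \sum_(i < n) complex.Re (u i) = complex.Re (\sum_(i < n) u i)).
  by rewrite -ReB; exact: normRe_le.
by elim/big_rec2: _ => // i x y _ ->; rewrite ReD.
Qed.

End Interface.

Theorem theorem8p8 (R : realType) (psi phi : Cplx R -> Cplx R)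
    (lambda : Cplx R)
    (psi_holo : holomorphic_on (@odisc R) psi)
    (psi_C1 : C1_on (@cdisc R) psi)
    (psi0 : psi 0 = 0)
    (lambda_disc : odisc lambda)
    (phiE : forall z, phi z = lambda * z * (1 + psi z))
    (phi_univalent : set_inj (@cdisc R) phi)
    (phi_maps : phi @` (@cdisc R) `<=` @odisc R)
    (phi_sum : forall z : Cplx R, cdisc z ->
      -1 < limn (series (fun j : nat =>
             complex.Re (z * derive_in (@cdisc R) (iter j phi) z *
                           derive_in (@cdisc R) psi (iter j phi z) /
                         (1 + psi (iter j phi z)))))) :
  exists Cphi : H2 R -> H2 R,
    is_composition_op phi Cphi /\ minimal_commutant (@H2_dot R) Cphi.
Proof.
set psi' := derive_in (@cdisc R) psi.
have upsi : udiff (@udisc R) psi psi' := C1_on_udiff psi_C1.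
have lam1 : cmod lambda < 1 by apply/odiscE.
have phi_inj z w : cmod z <= 1 -> cmod w <= 1 -> phi z = phi w -> z = w.
  by move=> /cdiscE z1 /cdiscE w1; apply: phi_univalent; rewrite inE.
have phi_lt1 z : cmod z <= 1 -> cmod (phi z) < 1.
  by move=> /cdiscE z1; apply/odiscE; apply: phi_maps; exists z.
have [s [s' [us s0 s'0 sphi [sinj slim]]]] := koenigs upsi psi0 phiE phi_inj phi_lt1.
(* The summation hypothesis enters here: its sum is the real part of [z * s' z / s z - 1]. *)
have sstar z : cmod z <= 1 -> z != 0 -> 0 < complex.Re (z * s' z / s z).
  move=> z1 z0; have := phi_sum z (proj2 (cdiscE z) z1).
  rewrite (_ : limn _ = complex.Re (z * s' z / s z - 1)).
    by rewrite ReB (_ : complex.Re (1 : Cplx R) = 1)//; lra.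
  apply: limn_Re_series; move: (slim z z1 z0); congr limC; apply/funext => n.
  apply: eq_bigr => j _; congr (z * _ * _ / _); apply/esym/derive_inE => //.
  exact: (udiff_iter upsi phiE phi_lt1).
have uphi := udiff_phi upsi phiE.
have phid0 : phi_deriv psi psi' lambda 0 = lambda.
  by rewrite /phi_deriv psi0 addr0 mulr0 mul0r addr0 mulr1.
have phi0 : phi 0 = 0 by rewrite phiE mulr0 mul0r.
exists (Cphi phi); split.
  by move=> f z /odiscE z1; apply: (CphiE uphi phi_lt1).
have lam0 := lam_neq0 phiE phi_inj.
exact: (minimal_commutant_Cphi uphi phi0 phid0 phi_inj phi_lt1 lam0 lam1 us s0 s'0 sinj sstar sphi).
Qed.
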